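(* Let $(M,g)$ and $(N,h)$ be Kähler manifolds with $M$ compact. (i) Assume that $H^M(X)\ge K|X|^4$ and $H^N(Y)\le\kappa|Y|^4$ for all holomorphic tangent vectors $X$ of $M$ and $Y$ of $N$, with $K,\kappa>0$. Then for any nonconstant holomorphic map $f:M\to N$, $$\max_{x}\|\partial f\|_m^2(x)\ge\frac K\kappa.$$ (ii) Assume that $Ric^M\ge K_1$ and $H^N(Y)\le\kappa|Y|^4$ for all holomorphic tangent vectors $Y$ of $N$, with $K_1,\kappa>0$. Then for any non-constant holomorphic map $f:M\to N$, $$\max_{x}\|\partial f\|^2(x)\ge\frac{K_1}\kappa.$$
   Context: For a Kähler manifold with curvature tensor $R$ (sign convention: $R_{\alpha\bar\beta\gamma\bar\delta}=-\partial^2g_{\alpha\bar\beta}/\partial z^\gamma\partial\bar z^\delta$ at the center of holomorphic normal coordinates), $H(X)=R(X,\overline X,X,\overline X)$ is the holomorphic sectional curvature, $|X|^2=g(X,\overline X)$, and $Ric\ge K_1$ means $Ric(X,\overline X)=\sum_\alpha R(E_\alpha,\overline E_\alpha,X,\overline X)\ge K_1|X|^2$ ($\{E_\alpha\}$ unitary basis of $T'_xM$). For $\partial f:T'_xM\to T'_{f(x)}N$: $\|\partial f\|_m^2(x)=\sup_{v\ne0}|\partial f(v)|^2/|v|^2$ is the maximum norm square (subscript $m$ for ''maximum''), and $\|\partial f\|^2=g^{\alpha\bar\beta}h_{i\bar j}f^i_\alpha\overline{f^j_\beta}$ is the Hilbert–Schmidt norm square, where $f^i_\alpha=\partial f^i/\partial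 z^\alpha$. *)

(* Defs.v *)
From HB Require Import structures.
From mathcomp Require Import all_boot all_order all_algebra.
From mathcomp Require Import complex.
From mathcomp Require Import all_classical all_reals.
From mathcomp Require Import topology normedtype derive.
Set Implicit Arguments.
Unset Strict Implicit.
Unset Printing Implicit Defensive.
Import Order.TTheory GRing.Theory Num.Theory.
Import numFieldNormedType.Exports.
Local Open Scope classical_set_scope.
Local Open Scope ring_scope.

(* R[i] seen through its numClosedFieldType structure, which is what carries
   the topology and the normed-module structure on R[i] and 'rV[R[i]]_n. *)
Definition Cplx (R : realType) : numClosedFieldType := R[i].
Definition ofR (R : realType) (t : R) : Cplx R := (t%:C)%C.
Definition imag (R : realType) : Cplx R := 'i%C.

Section Calculus.
Context (R : realType) (n : nat).
Local Notation C := (Cplx R).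
Implicit Types (h : 'rV[C]_n -> C) (U : set 'rV[C]_n) (z v : 'rV[C]_n).

(* Real directional derivatives of a complex-valued function on C^n = R^2n:
   the increment t ranges over R, the direction v over C^n. *)
Definition re_line h z v (t : R) : R := complex.Re (h (z + ofR t *: v)).
Definition im_line h z v (t : R) : R := complex.Im (h (z + ofR t *: v)).

Definition real_derivable h v z : Prop :=
  derivable (re_line h z v) 0 1 /\ derivable (im_line h z v) 0 1.

Definition real_derive h v z : C :=
  (derive1 (re_line h z v) 0 +i* derive1 (im_line h z v) 0)%C.

Fixpoint Ck (k : nat) U h : Prop :=
  (forall z, U z -> {for z, continuous h}) /\
  (if k is k'.+1 then
     forall v, (forall z, U z -> real_derivable h v z) /\
               Ck k' U (real_derive h v)
   else True).

Definition smooth_on U h : Prop := forall k, Ck k U h.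

(* Wirtinger derivatives: with z = x + i y,
   d/dz = (d/dx - i d/dy) / 2  and  d/dzbar = (d/dx + i d/dy) / 2. *)
Definition dz (a : 'I_n) h z : C :=
  2^-1 * (real_derive h (delta_mx 0 a) z
          - imag R * real_derive h (imag R *: delta_mx 0 a) z).

Definition dzbar (a : 'I_n) h z : C :=
  2^-1 * (real_derive h (delta_mx 0 a) z
          + imag R * real_derive h (imag R *: delta_mx 0 a) z).

End Calculus.

(* Smooth maps whose differential is complex linear ([differentiable] is over
   the scalar field R[i]).  By the Cauchy integral formula the smoothness
   clause is implied by the other one; it is kept, as is customary in complex
   differential geometry, so that maps of manifolds are smooth by definition. *)
Definition holomorphic_on (R : realType) (m n : nat) (U : set 'rV[Cplx R]_m)
    (f : 'rV[Cplx R]_m -> 'rV[Cplx R]_n) : Prop :=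
  (forall j, smooth_on U (fun z => f z 0 j)) /\
  (forall z, U z -> differentiable f z).

(* A homeomorphism from an open subset of T onto an open subset of C^n;
   [coord] and [param] are irrelevant outside these open sets. *)
Record chart (R : realType) (n : nat) (T : topologicalType) := Chart {
  dom : set T;
  coord : T -> 'rV[Cplx R]_n;
  param : 'rV[Cplx R]_n -> T;
  dom_open : open dom;
  image_open : open (coord @` dom);
  coordK : forall x, dom x -> param (coord x) = x;
  coord_continuous : forall x, dom x -> {for x, continuous coord};
  param_continuous :
    forall z, (coord @` dom) z -> {for z, continuous param}
}.

Definition chart_image (R : realType) (n : nat) (T : topologicalType)
    (c : chart R n T) : set 'rV[Cplx R]_n := coord c @` dom c.

Definition overlap (R : realType) (n : nat) (T : topologicalType)
    (c d : chart R n T) : set 'rV[Cplx R]_n := coord c @` (dom c `&` dom d).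

Definition transition (R : realType) (n : nat) (T : topologicalType)
    (c d : chart R n T) : 'rV[Cplx R]_n -> 'rV[Cplx R]_n :=
  coord d \o param c.

(* Connectedness is not part of the definition.  Each point has a preferred
   chart, through which its holomorphic tangent space is identified with C^n. *)
Record complexManifold (R : realType) (n : nat) := ComplexManifold {
  space :> topologicalType;
  space_hausdorff : hausdorff_space space;
  space_second_countable : @second_countable space;
  chart_index : Type;
  charts : chart_index -> chart R n space;
  chart_at : space -> chart_index;
  chart_at_dom : forall x, dom (charts (chart_at x)) x;
  transition_holomorphic : forall i j,
    holomorphic_on (overlap (charts i) (charts j))
                   (transition (charts i) (charts j))
}.

(* The entry G a b is g_{a bbar}; hence g(v, wbar) = sum g_{a bbar} v^a wbar^b. *)
Definition hprod (R : realType) (n : nat) (G : 'M[Cplx R]_n)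
    (v w : 'rV[Cplx R]_n) : Cplx R :=
  \sum_a \sum_b G a b * v 0 a * (w 0 b)^*.

(* [metric i] is the expression of the metric in the coordinates of chart i.
   [metric_change] says that these expressions define a tensor, with
   'J phi z a k = d phi^k / d z^a, and [metric_closed] is d omega = 0 for
   omega = i g_{a bbar} dz^a /\ dzbar^b (the (1,2) part follows from
   the (2,1) part by hermitian symmetry). *)
Record kahlerManifold (R : realType) (n : nat) := KahlerManifold {
  kbase :> complexManifold R n;
  metric : chart_index kbase -> 'rV[Cplx R]_n -> 'M[Cplx R]_n;
  metric_smooth : forall i a b,
    smooth_on (chart_image (charts i)) (fun z => metric i z a b);
  metric_hermitian : forall i z a b, chart_image (charts i) z ->
    metric i z b a = (metric i z a b)^*;
  metric_pos : forall i z v, chart_image (charts i) z -> v != 0 ->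
    0 < hprod (metric i z) v v;
  metric_change : forall i j z, overlap (charts i) (charts j) z ->
    let J := 'J (transition (charts i) (charts j)) z in
    metric i z =
      J *m metric j (transition (charts i) (charts j) z)
        *m (map_mx Num.conj J)^T;
  metric_closed : forall i z a b c, chart_image (charts i) z ->
    dz c (fun w => metric i w a b) z = dz a (fun w => metric i w c b) z
}.

(* R_{a bbar c dbar} in arbitrary holomorphic coordinates,
     - d^2 g_{a bbar} / dz^c dzbar^d
     + g^{p qbar} (d g_{a qbar} / dz^c) (d g_{p bbar} / dzbar^d),
   where g^{p qbar} g_{r qbar} = delta^p_r, i.e. g^{p qbar} = (g^-1) q p.
   The second term vanishes at the center of holomorphic normal coordinates. *)
Definition curvature (R : realType) (n : nat)
    (g : 'rV[Cplx R]_n -> 'M[Cplx R]_n) (z : 'rV[Cplx R]_n)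
    (a b c d : 'I_n) : Cplx R :=
  - dz c (dzbar d (fun w => g w a b)) z
  + \sum_p \sum_q invmx (g z) q p *
      dz c (fun w => g w a q) z * dzbar d (fun w => g w p b) z.

Section Geometry.
Context (R : realType) (n : nat) (M : kahlerManifold R n).
Local Notation C := (Cplx R).

(* A vector of T'_x M is given by its components in the preferred chart at x. *)
Definition base_coord (x : M) : 'rV[C]_n := coord (charts (chart_at x)) x.

Definition metric_at (x : M) : 'M[C]_n := metric (chart_at x) (base_coord x).

(* R(X, Ybar, Z, Wbar) *)
Definition curv (x : M) (X Y Z W : 'rV[C]_n) : C :=
  \sum_a \sum_b \sum_c \sum_d
    curvature (metric (chart_at x)) (base_coord x) a b c d
      * X 0 a * (Y 0 b)^* * Z 0 c * (W 0 d)^*.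

(* The complex numbers whose real part is taken in this section, and in
   [hs_normsq] below, are real. *)
Definition normsq (x : M) (X : 'rV[C]_n) : R :=
  complex.Re (hprod (metric_at x) X X).

Definition hol_sec (x : M) (X : 'rV[C]_n) : R := complex.Re (curv x X X X X).

Definition unitary_basis (x : M) (E : 'I_n -> 'rV[C]_n) : Prop :=
  forall a b, hprod (metric_at x) (E a) (E b) = (a == b)%:R.

Definition ricci (x : M) (E : 'I_n -> 'rV[C]_n) (X : 'rV[C]_n) : R :=
  complex.Re (\sum_a curv x (E a) (E a) X X).

Definition hol_sec_ge (K : R) : Prop :=
  forall (x : M) (X : 'rV[C]_n), K * normsq x X ^+ 2 <= hol_sec x X.

Definition hol_sec_le (kappa : R) : Prop :=
  forall (x : M) (X : 'rV[C]_n), hol_sec x X <= kappa * normsq x X ^+ 2.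

Definition ricci_ge (K : R) : Prop :=
  forall (x : M) (E : 'I_n -> 'rV[C]_n), unitary_basis x E ->
  forall X : 'rV[C]_n, K * normsq x X <= ricci x E X.

End Geometry.

Section Maps.
Context (R : realType) (m n : nat).
Context (M : kahlerManifold R m) (N : kahlerManifold R n).
Local Notation C := (Cplx R).
Implicit Types f : M -> N.

Definition local_rep f (i : chart_index M) (j : chart_index N) :
    'rV[C]_m -> 'rV[C]_n :=
  coord (charts j) \o f \o param (charts i).

Definition holomorphic_map f : Prop :=
  continuous f /\
  forall i j,
    holomorphic_on (coord (charts i) @` (dom (charts i) `&` f @^-1` dom (charts j)))
                   (local_rep f i j).

Definition nonconstant f : Prop := exists x y, f x <> f y.

(* The entry (a, i) is df^i / dz^a, so that X is mapped to X *m jac f x. *)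
Definition jac f (x : M) : 'M[C]_(m, n) :=
  'J (local_rep f (chart_at x) (chart_at (f x))) (base_coord x).

Definition max_normsq f (x : M) : R :=
  sup [set normsq (f x) (v *m jac f x) / normsq x v | v in [set v | v != 0]].

(* g^{a bbar} is (g^-1) b a, as in [curvature]. *)
Definition hs_normsq f (x : M) : R :=
  complex.Re (\sum_a \sum_b \sum_i \sum_j
    invmx (metric_at x) b a * metric_at (f x) i j
      * jac f x a i * (jac f x b j)^*).

End Maps.

(* c <= max phi, including the fact that the maximum is attained. *)
Definition max_ge (R : realType) (T : Type) (phi : T -> R) (c : R) : Prop :=
  exists x0, (forall x, phi x <= phi x0) /\ c <= phi x0.

(* Main.v *)
(* At a maximum point x0, restrict to the complex line z0 + zeta v of a chart and
   compare |df(V)|^2 with |V|^2 along it, for a frame V whose covariant derivative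
   vanishes at x0. The zeta zetabar coefficients of these two functions are, with
   W = df(V), |nabla W|^2 - R^N(df v, df v, W, W) and - R^M(v, v, V, V), signs as for
   the curvature; dropping |nabla W|^2 >= 0, maximality of |df(V)|^2 - lambda |V|^2
   bounds lambda R^M from above by R^N. Taking V = v a maximal direction gives (i).
   For (ii), with g and A = f^*h as matrices, the trace tr(g^-1 A) is bounded below
   by 2 tr(V A V^* ) - tr(V g V^* V A V^* ), with equality for unitary V, so g^-1 need
   never be differentiated. Summing over a unitary frame diagonalising A, the
   Kaehler symmetries turn the M-term into Ricci curvature, and averaging over
   fourth roots of unity (Royden) bounds the N-term by the holomorphic sectional
   curvature.
   Smoothness enters only through expansions to second order along complex lines.
   The maximum is attained by upper semicontinuity, and is positive since a map with
   vanishing differential on a connected manifold is constant. *)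
Require Import Defs.
From mathcomp Require Import all_boot all_order all_algebra.
From mathcomp Require Import perm spectral sesquilinear complex ring lra.
From mathcomp Require Import all_classical all_reals.
From mathcomp Require Import topology normedtype derive realfun.
Set Implicit Arguments.
Unset Strict Implicit.
Unset Printing Implicit Defensive.
Import Order.TTheory GRing.Theory Num.Theory.
Import numFieldNormedType.Exports.
Local Open Scope classical_set_scope.
Local Open Scope ring_scope.

(** * Second-order jets in one complex variable *)

Section Modulus.
Context (R : realType).
Local Notation C := (Cplx R).
Implicit Types (z w : C) (t : R).

(** Neither quantity can be differentiated as it stands: a largest eigenvalue need not be smooth
    where eigenvalues cross, and the trace contains an inverse matrix. Test functions built from an
    affine frame E + t w replace them. The choice w = - Gamma(v, E) makes the frame parallel at t =
    0; no correction of higher order is wanted, because a t^2 term in the frame cannot reach the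
    coefficient of t tbar. In this way the Christoffel symbols are carried along and no normal
    coordinates have to be constructed. The coefficients of t^2 and tbar^2 are dropped from the jets
    for a related reason: they cancel on averaging over t, -t, it, -it, so a maximum says nothing
    about them. Preferred charts may jump from point to point, so neither matrix, metric or pulled
    back metric, need vary continuously with the point. What has a meaning is the pair of them up to
    a common congruence; its largest ratio and its trace are invariant. All analysis therefore takes
    place in the chart of one point, and results are carried over by congruence. *)

Definition cn z : R := complex.Re (`|z| : R[i]).

(** The norm of [Cplx R] takes values in [Cplx R]. Estimates are run with the real-valued copy [cn],
    for which order arguments in R and [lra] are available. *)
Lemma normcn z : `|z| = ofR (cn z).
Proof. by rewrite /cn normc_def. Qed.

Lemma ofR_le s t : (ofR s <= ofR t :> C) = (s <= t).
Proof. exact: lecR. Qed.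

Lemma ofR_lt s t : (ofR s < ofR t :> C) = (s < t).
Proof. exact: ltcR. Qed.

Lemma ofRD s t : ofR (s + t) = ofR s + ofR t :> C.
Proof. exact: (rmorphD (real_complex R)). Qed.
Lemma ofRM s t : ofR (s * t) = ofR s * ofR t :> C.
Proof. exact: (rmorphM (real_complex R)). Qed.
Lemma ofR0 : ofR 0 = 0 :> C. Proof. by []. Qed.
Lemma ofR1 : ofR 1 = 1 :> C. Proof. by []. Qed.

Lemma cn_ge0 z : 0 <= cn z.
Proof. by rewrite -ofR_le -normcn ofR0 normr_ge0. Qed.

Lemma cn0 : cn 0 = 0.
Proof. by rewrite /cn normr0. Qed.

Lemma cn_eq0 z : (cn z == 0) = (z == 0).
Proof.
apply/eqP/eqP => [h|->]; last exact: cn0.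
by apply: normr0_eq0; rewrite normcn h.
Qed.

Lemma cnD z w : cn (z + w) <= cn z + cn w.
Proof. by rewrite -ofR_le ofRD -!normcn ler_normD. Qed.

Lemma cnM z w : cn (z * w) = cn z * cn w.
Proof. by apply: (@complexI R); rewrite -/(ofR _) -normcn normrM !normcn -ofRM. Qed.

Lemma cnN z : cn (- z) = cn z.
Proof. by rewrite /cn normrN. Qed.

Lemma cn_conj z : cn z^* = cn z.
Proof. by rewrite /cn norm_conjC. Qed.

Lemma cn_ofR t : cn (ofR t) = `|t|.
Proof. by rewrite /cn normc_def /= expr0n addr0 sqrtr_sqr. Qed.

Lemma cn_sum I (r : seq I) (P : pred I) (F : I -> C) :
  cn (\sum_(i <- r | P i) F i) <= \sum_(i <- r | P i) cn (F i).
Proof.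
elim/big_rec2: _ => [|i y1 y2 _ h]; first by rewrite cn0.
by apply: (le_trans (cnD _ _)); rewrite lerD2l.
Qed.

Lemma Re_le_cn z : complex.Re z <= cn z.
Proof.
rewrite /cn normc_def /=; apply: (le_trans (ler_norm _)).
by rewrite -sqrtr_sqr ler_wsqrtr // lerDl sqr_ge0.
Qed.

Lemma cn_le_ReIm z : cn z <= `|complex.Re z| + `|complex.Im z|.
Proof.
rewrite {1}(complexE z); apply: (le_trans (cnD _ _)).
rewrite cnM -!/(ofR _) !cn_ofR; have -> : cn 'i%C = 1; last by rewrite mul1r.
by rewrite /cn normc_def /= expr0n add0r expr1n sqrtr1.
Qed.

Lemma cn_near0 (d : R) : 0 < d -> \forall z \near (0 : C), cn z < d.
Proof.
move=> d0; have := @nbhs0_lt C C (ofR d); rewrite -ofR0 ofR_lt => /(_ d0).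
by apply: filterS => z; rewrite normcn ofR_lt.
Qed.

End Modulus.

Section Jets.
Context (R : realType).
Local Notation C := (Cplx R).
Implicit Types (f g h : C -> C).

Definition bigo k f := exists K : R,
  0 <= K /\ \forall z \near (0 : C), cn (f z) <= K * cn z ^+ k.

Definition o2 f := forall e : R, 0 < e ->
  \forall z \near (0 : C), cn (f z) <= e * cn z ^+ 2.

Lemma bigoD k f g : bigo k f -> bigo k g -> bigo k (fun z => f z + g z).
Proof.
move=> [K [K0 hK]] [L [L0 hL]]; exists (K + L); split; first exact: addr_ge0.
near=> z; apply: (le_trans (cnD _ _)); rewrite mulrDl lerD //; near: z; by [].
Unshelve. all: by end_near. Qed.

Lemma bigoM k l f g : bigo k f -> bigo l g -> bigo (k + l) (fun z => f z * g z).
Proof.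
move=> [K [K0 hK]] [L [L0 hL]]; exists (K * L); split; first exact: mulr_ge0.
near=> z; rewrite cnM exprD mulrACA ler_pM ?cn_ge0 //; near: z; by [].
Unshelve. all: by end_near. Qed.

Lemma bigo_cst (c : C) : bigo 0 (fun=> c).
Proof. by exists (cn c); split; [exact: cn_ge0|near=> z; rewrite expr0 mulr1].
Unshelve. all: by end_near. Qed.

Lemma bigo_id : bigo 1 id.
Proof. by exists 1; split => //; near=> z; rewrite mul1r expr1.
Unshelve. all: by end_near. Qed.

Lemma bigo_conj k f : bigo k f -> bigo k (fun z => (f z)^*).
Proof. by move=> [K [K0 h]]; exists K; split => //; apply: filterS h => z; rewrite cn_conj. Qed.

Lemma bigoW k l f : (k <= l)%N -> bigo l f -> bigo k f.
Proof.
move=> kl [K [K0 h]]; exists K; split => //; near=> z.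
have hz : cn (f z) <= K * cn z ^+ l by near: z.
apply: (le_trans hz); rewrite ler_wpM2l // ler_wiXn2l ?cn_ge0 //.
by apply: ltW; near: z; apply: cn_near0.
Unshelve. all: by end_near. Qed.

Lemma bigo_sum k n (F : 'I_n -> C -> C) :
  (forall i, bigo k (F i)) -> bigo k (fun z => \sum_i F i z).
Proof.
move=> hF; elim: n F hF => [|n IH] F hF.
  by exists 0; split => //; near=> z; rewrite big_ord0 cn0 mul0r.
have [K [K0 h]] := bigoD (hF ord0) (IH (fun i => F (lift ord0 i)) (fun i => hF _)).
by exists K; split => //; apply: filterS h => z; rewrite big_ord_recl.
Unshelve. all: by end_near. Qed.

Lemma o2D f g : o2 f -> o2 g -> o2 (fun z => f z + g z).
Proof.
move=> hf hg e e0; have e2 : 0 < e / 2 by rewrite divr_gt0.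
near=> z; apply: (le_trans (cnD _ _)).
have h1 : cn (f z) <= e / 2 * cn z ^+ 2 by near: z; apply: hf.
have h2 : cn (g z) <= e / 2 * cn z ^+ 2 by near: z; apply: hg.
by lra.
Unshelve. all: by end_near. Qed.

Lemma o2_bigo f : o2 f -> bigo 2 f.
Proof. by move=> h; exists 1; split=> //; apply: h. Qed.

Lemma bigo3_o2 f : bigo 3 f -> o2 f.
Proof.
move=> [K [K0 h]] e e0; near=> z.
have hz : cn (f z) <= K * cn z ^+ 3 by near: z.
apply: (le_trans hz); rewrite exprS mulrA ler_wpM2r ?exprn_ge0 ?cn_ge0 //.
(* [K] may be zero, hence the denominator K + 1. *)
have hz' : cn z < e / (K + 1).
  by near: z; apply: cn_near0; rewrite divr_gt0 // ltr_wpDl.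
have K1 : 0 < K + 1 by rewrite ltr_wpDl.
apply: (@le_trans _ _ ((K + 1) * (e / (K + 1)))); last by rewrite mulrC divfK // gt_eqF.
by apply: ler_pM; rewrite ?cn_ge0 ?lerDl // ltW.
Unshelve. all: by end_near. Qed.

Lemma o2M f g : bigo 0 f -> o2 g -> o2 (fun z => f z * g z).
Proof.
move=> [K [K0 hf]] hg e e0; have K1 : 0 < K + 1 by rewrite ltr_wpDl.
near=> z; rewrite cnM.
have h1 : cn (f z) <= K by rewrite -[leRHS]mulr1 -(expr0 (cn z)); near: z.
have h2 : cn (g z) <= e / (K + 1) * cn z ^+ 2 by near: z; apply: hg; rewrite divr_gt0.
apply: (@le_trans _ _ ((K + 1) * (e / (K + 1) * cn z ^+ 2))).
  by rewrite ler_pM ?cn_ge0 // (le_trans h1) // lerDl.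
by rewrite mulrA [_ * (e / _)]mulrC divfK // gt_eqF.
Unshelve. all: by end_near. Qed.

Lemma o2_conj f : o2 f -> o2 (fun z => (f z)^*).
Proof. by move=> h e e0; apply: filterS (h e e0) => z; rewrite cn_conj. Qed.

Lemma o2_near f g : (\forall z \near (0 : C), f z = g z) -> o2 f -> o2 g.
Proof.
move=> fg h e e0; near=> z; have <- : f z = g z by near: z.
by near: z; apply: h.
Unshelve. all: by end_near. Qed.

Definition poly2 (c a b p q r z : C) : C :=
  c + (a * z + b * z^*) + (p * z ^+ 2 + q * (z * z^*) + r * z^* ^+ 2).

(* Second-order expansion at 0 in which only the coefficients of 1, z, zbar and
   z zbar are recorded; this information is stable under products. *)
Definition jet f (c a b q : C) := exists p r : C,
  o2 (fun z => f z - poly2 c a b p q r z).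

Lemma jet_near f g c a b q :
  (\forall z \near (0 : C), f z = g z) -> jet f c a b q -> jet g c a b q.
Proof.
move=> fg [p [r h]]; exists p, r; apply: o2_near h.
by apply: filterS fg => z ->.
Qed.

Lemma jet_ext f g c a b q : f =1 g -> jet f c a b q -> jet g c a b q.
Proof. by move=> /funext ->. Qed.

Lemma jet_eq f c a b q c' a' b' q' : jet f c a b q ->
  c = c' -> a = a' -> b = b' -> q = q' -> jet f c' a' b' q'.
Proof. by move=> ? <- <- <- <-. Qed.

Lemma o2_0 f : (forall z, f z = 0) -> o2 f.
Proof.
move=> h e e0; near=> z; rewrite h cn0 mulr_ge0 ?exprn_ge0 ?cn_ge0 //.
exact: ltW.
Unshelve. all: by end_near. Qed.

Lemma jet_cst (c : C) : jet (fun=> c) c 0 0 0.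
Proof. by exists 0, 0; apply: o2_0 => z; rewrite /poly2; ring. Qed.

Lemma jet_id : jet id 0 1 0 0.
Proof. by exists 0, 0; apply: o2_0 => z; rewrite /poly2; ring. Qed.

Lemma jetD f g c a b q c' a' b' q' : jet f c a b q -> jet g c' a' b' q' ->
  jet (fun z => f z + g z) (c + c') (a + a') (b + b') (q + q').
Proof.
move=> [p [r h]] [p' [r' h']]; exists (p + p'), (r + r').
apply: o2_near (o2D h h'); near=> z; rewrite /poly2; ring.
Unshelve. all: by end_near. Qed.

Lemma bigo_quad (p q r : C) :
  bigo 2 (fun z => p * z ^+ 2 + q * (z * z^*) + r * z^* ^+ 2).
Proof.
have i1 := bigo_id; have c1 := bigo_conj i1.
apply: bigoD; first apply: bigoD.
- exact: (bigoM (bigo_cst p) (bigoM i1 i1)).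
- exact: (bigoM (bigo_cst q) (bigoM i1 c1)).
- exact: (bigoM (bigo_cst r) (bigoM c1 c1)).
Qed.

Lemma bigo_lin (a b : C) : bigo 1 (fun z => a * z + b * z^*).
Proof.
apply: bigoD.
- exact: (bigoM (bigo_cst a) bigo_id).
- exact: (bigoM (bigo_cst b) (bigo_conj bigo_id)).
Qed.

Lemma bigo_poly2 (c a b p q r : C) : bigo 0 (poly2 c a b p q r).
Proof.
apply: bigoD; first apply: bigoD; first exact: bigo_cst.
- exact: (@bigoW 0 1 _ _ (bigo_lin a b)).
- exact: (@bigoW 0 2 _ _ (bigo_quad p q r)).
Qed.

Lemma jet_bigo f c a b q : jet f c a b q -> bigo 0 f.
Proof.
move=> [p [r h]].
have [K [K0 hK]] := bigoD (bigo_poly2 c a b p q r) (@bigoW 0 2 _ isT (o2_bigo h)).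
by exists K; split => //; apply: filterS hK => z; rewrite addrC subrK.
Qed.

Lemma jetM f g c a b q c' a' b' q' : jet f c a b q -> jet g c' a' b' q' ->
  jet (fun z => f z * g z) (c * c') (c * a' + a * c') (c * b' + b * c')
      (c * q' + q * c' + a * b' + b * a').
Proof.
move=> hf hg; have fb := jet_bigo hf.
case: hf hg => [p [r h]] [p' [r' h']].
exists (c * p' + p * c' + a * a'), (c * r' + r * c' + b * b').
(* Write f = P + eps and g = P' + eps' with quadratic polynomials P, P'. The error consists of the
   terms of P P' of degree at least 3 ([t1], [t2], [t3]) and of P' eps + f eps' ([u1], [u2]). *)
have l1 := bigo_lin a b; have l2 := bigo_lin a' b'.
have s1 := bigo_quad p q r; have s2 := bigo_quad p' q' r'.
have t1 := bigo3_o2 (bigoM l1 s2); have t2 := bigo3_o2 (bigoM s1 l2).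
have t3 := bigo3_o2 (@bigoW 3 4 _ isT (bigoM s1 s2)).
have u1 := o2M (bigo_poly2 c' a' b' p' q' r') h.
have u2 := o2M fb h'.
apply: o2_near (o2D (o2D (o2D t1 t2) t3) (o2D u1 u2)).
by near=> z; rewrite /poly2; ring.
Unshelve. all: by end_near. Qed.

Lemma jet_conj f c a b q : jet f c a b q ->
  jet (fun z => (f z)^*) c^* b^* a^* q^*.
Proof.
move=> [p [r h]]; exists r^*, p^*; apply: o2_near (o2_conj h).
near=> z; rewrite /poly2 !(rmorphB, rmorphD, rmorphM, rmorphXn) /= !conjCK; ring.
Unshelve. all: by end_near. Qed.

Lemma jet_sum n (F : 'I_n -> C -> C) (c a b q : 'I_n -> C) :
  (forall i, jet (F i) (c i) (a i) (b i) (q i)) ->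
  jet (fun z => \sum_i F i z) (\sum_i c i) (\sum_i a i) (\sum_i b i) (\sum_i q i).
Proof.
elim: n F c a b q => [|n IH] F c a b q hF.
  rewrite !big_ord0; apply: jet_near (jet_cst 0); near=> z; by rewrite big_ord0.
rewrite !big_ord_recl.
apply: jet_near (jetD (hF ord0) (IH _ _ _ _ _ (fun i => hF (lift ord0 i)))).
by near=> z; rewrite big_ord_recl.
Unshelve. all: by end_near. Qed.

Lemma jetZ (k : C) f c a b q : jet f c a b q ->
  jet (fun z => k * f z) (k * c) (k * a) (k * b) (k * q).
Proof. by move=> h; apply: jet_eq (jetM (jet_cst k) h) _ _ _ _; ring. Qed.

Lemma jet_o2 f : o2 f -> jet f 0 0 0 0.
Proof.
by move=> h; exists 0, 0; apply: o2_near h; near=> z; rewrite /poly2; ring.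
Unshelve. all: by end_near. Qed.

(** The linear terms and the terms in z^2 and zbar^2 cancel when summed over t, -t, it, -it, so the
    mean of [poly2] over these four points is c + q t^2. This is why the two other quadratic
    coefficients may stay hidden in [jet]. *)
Lemma jet_max f c a b q : jet f c a b q ->
  (\forall z \near (0 : C), complex.Re (f z) <= complex.Re c) -> complex.Re q <= 0.
Proof.
move=> [p [r h]] hm; apply/ler_addgt0Pr => e e0; rewrite add0r.
have [d /= d0 hd] := (@nbhs_ballP C C 0 _).1 (@filterI _ (nbhs (0 : C)) _ _ _ hm (h e e0)).
have d1 : 0 < cn d by rewrite lt_neqAle cn_ge0 eq_sym cn_eq0 gt_eqF.
(* Half the radius of the ball on which both estimates hold, so that the four test points lie inside
   it. *)
pose t : R := cn d / 2; have t0 : 0 < t by rewrite divr_gt0.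
have key (u : C) : cn u = 1 -> complex.Re (poly2 c a b p q r (ofR t * u)) <=
    complex.Re c + e * t ^+ 2.
  move=> u1; have hu : cn (ofR t * u) = t by rewrite cnM u1 mulr1 cn_ofR gtr0_norm.
  have [] := hd (ofR t * u).
    rewrite /ball /= sub0r normrN normcn hu -(gtr0_norm d0) (normcn d) ofR_lt.
    by rewrite /t; lra.
  rewrite hu => h1 h2.
  set P := poly2 _ _ _ _ _ _ _ in h2 *.
  have := Re_le_cn (P - f (ofR t * u)); rewrite -opprB cnN raddfN raddfB /=; lra.
have i1 : cn (imag R) = 1 by rewrite /cn normc_def /= expr0n add0r expr1n sqrtr1.
have e1 : cn (1 : C) = 1 by rewrite -ofR1 cn_ofR normr1.
have := conj (conj (key 1 e1) (key (-1) _)) (conj (key (imag R) i1) (key (- imag R) _)).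
rewrite !cnN => /(_ e1 i1) [[k1 k2] [k3 k4]].
have t2 : 0 < t ^+ 2 by rewrite exprn_gt0.
rewrite -(ler_pM2r t2).
suff : 4 * complex.Re q * t ^+ 2 + 4 * complex.Re c =
  complex.Re (poly2 c a b p q r (ofR t * 1)) + complex.Re (poly2 c a b p q r (ofR t * -1))
 + complex.Re (poly2 c a b p q r (ofR t * imag R)) + complex.Re (poly2 c a b p q r (ofR t * - imag R)).
  by lra.
have cj (x : C) : x^* = conjc x by [].
rewrite /poly2 !cj /ofR /imag !expr2.
case: c {h hm hd key k1 k2 k3 k4} => c1 c2; case: a => a1 a2; case: b => b1 b2.
case: p => p1 p2; case: q => q1 q2; case: r => r1 r2 /=; ring.
Qed.

End Jets.

(** * Taylor expansion and Wirtinger calculus *)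

Section RealLines.
Context (R : realType).
Implicit Types (f : R -> R) (t d : R).

Lemma is_deriveP f t d : is_derive t 1 f d <->
  (fun k => k^-1 * (f (k + t) - f t)) @ 0^' --> d.
Proof.
have E : (fun k => k^-1 *: ((f \o shift t) (k *: 1) - f t)) =
         (fun k => k^-1 * (f (k + t) - f t)).
  by apply/funext => k /=; rewrite [_%:A]mulr1.
split=> [[df <-]|h].
  by move: df; rewrite /derivable /derive E.
by split; [apply/cvg_ex; exists d|apply/cvg_lim => //]; rewrite E.
Qed.

Lemma is_derive_eps f t d (e : R) : is_derive t 1 f d -> 0 < e ->
  exists2 a : R, 0 < a & forall k, `|k| < a -> `|f (k + t) - f t - k * d| <= e * `|k|.
Proof.
move=> /is_deriveP /cvgrPdist_le/(_ _) h e0; have := h e e0.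
rewrite near_withinE => /nbhs_normP [a /= a0 ha]; exists a => // k ka.
have [->|k0] := eqVneq k 0; first by rewrite add0r mul0r subrr subr0 normr0 mulr0.
have := ha k; rewrite /= sub0r normrN => /(_ ka k0) hk.
have -> : f (k + t) - f t - k * d = - (d - k^-1 * (f (k + t) - f t)) * k.
  by field.
by rewrite normrM normrN ler_wpM2r.
Qed.

Lemma is_derive_mvt f (f' : R -> R) a : 0 < a ->
  (forall t, 0 <= t <= a -> is_derive t 1 f (f' t)) ->
  exists2 t, 0 < t < a & f a - f 0 = a * f' t.
Proof.
move=> a0 hf; have [||t] := @MVT R f f' 0 a a0.
- by move=> x; rewrite in_itv /= => /andP[x0 xa]; apply: hf; rewrite !ltW.
- apply: derivable_within_continuous => x; rewrite in_itv /= => xI.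
  by have [] := hf x xI.
by rewrite in_itv /= subr0 => ht ->; exists t; rewrite // mulrC.
Qed.

Lemma taylor_lagrange2 f (f1 f2 : R -> R) :
  (forall t, 0 <= t <= 1 -> is_derive t 1 f (f1 t)) ->
  (forall t, 0 <= t <= 1 -> is_derive t 1 f1 (f2 t)) ->
  exists2 t, 0 <= t <= 1 & f 1 = f 0 + f1 0 + f2 t / 2.
Proof.
(* [K] is chosen so that f(s) - f1(0) s - K s^2 takes the same value at 0 and at 1; since its
   derivative also vanishes at 0, Rolle's argument applies twice and gives f2 = 2 K somewhere. *)
move=> h1 h2; pose K := f 1 - f 0 - f1 0.
have d1 t : 0 <= t <= 1 ->
    is_derive t 1 (fun s => f s - (f1 0 * s + K * s ^+ 2)) (f1 t - (f1 0 + K * (2 * t))).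
  move=> /h1 ht; apply: is_derive_eq.
  by rewrite !(scaler0, scaler1, expr1, mulr1, add0r, addr0) /GRing.scale /=; ring.
have d2 t : 0 <= t <= 1 ->
    is_derive t 1 (fun s => f1 s - (f1 0 + K * (2 * s))) (f2 t - K * 2).
  move=> /h2 ht; apply: is_derive_eq.
  by rewrite !(scaler0, scaler1, expr1, mulr1, add0r, addr0) /GRing.scale /=; ring.
have [//|c /andP[c0 c1]] := is_derive_mvt _ d1.
have -> : f 1 - (f1 0 * 1 + K * 1 ^+ 2) - (f 0 - (f1 0 * 0 + K * 0 ^+ 2)) = 0.
  by rewrite /K; ring.
rewrite mul1r => hc.
have [t|b /andP[b0 bc]] := is_derive_mvt c0 (f' := fun t => f2 t - K * 2) (f := fun s => f1 s - (f1 0 + K * (2 * s))).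
  by move=> /andP[t0 tc]; apply: d2; rewrite t0 (le_trans tc) // ltW.
move=> E; exists b; first by rewrite ltW //= ltW // (lt_trans bc).
have : c * (f2 b - K * 2) = 0 by rewrite -E; lra.
move/eqP; rewrite mulf_eq0 gt_eqF //= subr_eq0 => /eqP ->.
by rewrite /K; field.
Qed.

End RealLines.

(** * Real directional derivatives on C^n: additivity, symmetry, Taylor formula *)

Section RowSize.
Context (R : realType) (n : nat).
Local Notation C := (Cplx R).
Implicit Types (z v w : 'rV[C]_n) (t : R).

Definition sz v : R := \sum_i cn (v 0 i).

Lemma sz_ge0 v : 0 <= sz v.
Proof. by apply: sumr_ge0 => i _; apply: cn_ge0. Qed.

Lemma szD v w : sz (v + w) <= sz v + sz w.
Proof. by rewrite -big_split /=; apply: ler_sum => i _; rewrite mxE cnD. Qed.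

Lemma szZ (a : C) v : sz (a *: v) = cn a * sz v.
Proof. by rewrite mulr_sumr; apply: eq_bigr => i _; rewrite mxE cnM. Qed.

Lemma cn_le_sz v i : cn (v 0 i) <= sz v.
Proof. by rewrite /sz (bigD1 i) //= lerDl sumr_ge0 // => j _; exact: cn_ge0. Qed.

Lemma nbhs_sz z (P : set 'rV[C]_n) : nbhs z P <->
  exists2 d : R, 0 < d & forall v, sz v < d -> P (z + v).
Proof.
split=> [/nbhs_ballP[e /= e0 he]|[d d0 hd]].
  have e1 : 0 < cn e by rewrite lt_neqAle cn_ge0 eq_sym cn_eq0 gt_eqF.
  exists (cn e) => // v hv; apply: he; split => // i j.
  rewrite ord1 mxE /ball /= opprD addNKr normrN normcn -(gtr0_norm e0) normcn ofR_lt.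
  exact: le_lt_trans (cn_le_sz _ _) hv.
(* The matrix topology comes from the maximum of the entries while [sz] is their sum. Dividing by n
   + 1 keeps n e strictly below d and covers n = 0. *)
pose e := d / n.+1%:R; have e0 : 0 < e by rewrite divr_gt0.
apply/nbhs_ballP; exists (ofR e) => /=; first by rewrite -ofR0 ofR_lt.
move=> w [_ hw]; rewrite -[w](addrNK z) addrC; apply: hd.
have hi i : cn ((w - z) 0 i) <= e.
  have := hw 0 i; rewrite /ball /= -normrN opprB normcn ofR_lt => /ltW.
  by rewrite !mxE.
apply: (@le_lt_trans _ _ (\sum_(i < n) e)); first exact: ler_sum.
rewrite sumr_const card_ord -mulr_natr /e -mulrA gtr_pMr //.
by rewrite mulrC ltr_pdivrMr // mul1r ltr_nat.
Qed.

Lemma sz_line (P : set 'rV[C]_n) z u v : nbhs z P ->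
  exists2 a : R, 0 < a & forall s t, 0 <= s <= a -> 0 <= t <= a ->
    P (z + ofR s *: u + ofR t *: v).
Proof.
move=> /nbhs_sz [d d0 hd]; pose K := sz u + sz v + 1.
have K0 : 0 < K by rewrite ltr_wpDl // addr_ge0 ?sz_ge0.
exists (d / 2 / K); first by rewrite !divr_gt0.
move=> s t /andP[s0 sa] /andP[t0 ta]; rewrite -addrA; apply: hd.
apply: (le_lt_trans (szD _ _)); rewrite !szZ !cn_ofR !ger0_norm //.
have E : d / 2 / K * K = d / 2 by rewrite divfK // gt_eqF.
have h1 := ler_wpM2r (sz_ge0 u) sa; have h2 := ler_wpM2r (sz_ge0 v) ta.
have : 0 < d / 2 / K by rewrite !divr_gt0.
move: E; rewrite /K; lra.
Qed.

Lemma nbhs_line (P : set 'rV[C]_n) z v : nbhs z P ->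
  \forall t \near (0 : R), P (z + ofR t *: v).
Proof.
move=> /nbhs_sz[d d0 hd]; have K0 : 0 < sz v + 1 by rewrite ltr_wpDl // sz_ge0.
apply/nbhs_normP; exists (d / (sz v + 1)) => /=; first by rewrite divr_gt0.
move=> t /=; rewrite sub0r normrN ltr_pdivlMr // => ht.
apply: hd; rewrite szZ cn_ofR; apply: le_lt_trans ht.
by rewrite ler_wpM2l // lerDl.
Qed.

Definition hasD (F : 'rV[C]_n -> R) v z (d : R) :=
  is_derive (0 : R) 1 (fun t : R => F (z + ofR t *: v)) d.

Lemma hasD_line F v z t d : hasD F v (z + ofR t *: v) d ->
  is_derive t 1 (fun s : R => F (z + ofR s *: v)) d.
Proof.
have E (k : R) : z + ofR t *: v + ofR k *: v = z + ofR (k + t) *: v.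
  by rewrite -addrA -scalerDl ofRD [ofR k + _]addrC.
move=> /is_deriveP h; apply/is_deriveP; apply: cvg_trans h.
apply: near_eq_cvg; apply: nearW => k.
by rewrite /= !E addr0 add0r.
Qed.

Lemma hasD_mvt F v z (G : 'rV[C]_n -> R) a : 0 < a ->
  (forall t, 0 <= t <= a -> hasD F v (z + ofR t *: v) (G (z + ofR t *: v))) ->
  exists2 t, 0 <= t <= a & F (z + ofR a *: v) - F z = a * G (z + ofR t *: v).
Proof.
move=> a0 h.
have [|t /andP[t0 ta] E] := @is_derive_mvt R (fun t => F (z + ofR t *: v))
   (fun t => G (z + ofR t *: v)) a a0.
  by move=> t /h /hasD_line.
exists t; first by rewrite !ltW.
by rewrite -E ofR0 scale0r addr0.
Qed.

Lemma cont_nbhs (G : 'rV[C]_n -> R) z (e : R) : {for z, continuous G} -> 0 < e ->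
  \forall w \near z, `|G w - G z| <= e.
Proof.
move=> /cvgrPdist_le h e0; apply: filterS (h e e0) => w.
by rewrite distrC.
Qed.

(** Existence of directional derivatives alone does not make them additive in the direction. Moving
    by k u and then by k v, the second increment is k times a value of G near z by the mean value
    theorem, and continuity of G at z replaces it by k G(z) up to e k / 3. *)
Lemma hasDD F u v z (G : 'rV[C]_n -> R) d d' :
  hasD F u z d -> hasD F (u + v) z d' ->
  (\forall w \near z, hasD F v w (G w)) -> {for z, continuous G} -> d' = d + G z.
Proof.
move=> hu huv hv cG; apply/eqP; rewrite -subr_eq0 -normr_le0.
apply/ler_addgt0Pr => e e0; rewrite add0r.
have e3 : 0 < e / 3 by rewrite divr_gt0.
have [a1 a10 h1] := is_derive_eps hu e3.
have [a2 a20 h2] := is_derive_eps huv e3.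
have [a3 a30 h3] := sz_line u v (filterI hv (cont_nbhs cG e3)).
pose k := Num.min (Num.min a1 a2) a3 / 2.
have m0 : 0 < Num.min (Num.min a1 a2) a3 by rewrite !lt_min a10 a20 a30.
have k0 : 0 < k by rewrite divr_gt0.
have km : k < Num.min (Num.min a1 a2) a3 by rewrite /k; lra.
move: (km); rewrite !lt_min => /andP[/andP[k1 k2] k3].
have kn : `|k| = k by rewrite gtr0_norm.
have := h1 k; rewrite kn !addr0 ofR0 scale0r addr0 => /(_ k1) {}h1.
have := h2 k; rewrite kn !addr0 ofR0 scale0r addr0 => /(_ k2) {}h2.
have kI : 0 <= k <= a3 by rewrite !ltW.
have tI t : 0 <= t <= k -> 0 <= t <= a3.
  by move=> /andP[-> tk]; rewrite (le_trans tk) // ltW.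
have [|t tk E] := @hasD_mvt F v (z + ofR k *: u) G k k0.
  by move=> t /tI h; have [] := h3 k t kI h.
have [_ {}h3] := h3 k t kI (tI t tk).
have E2 : z + ofR k *: u + ofR k *: v = z + ofR k *: (u + v) by rewrite scalerDr addrA.
rewrite E2 in E; rewrite -(ler_pM2r k0) -{1}kn -normrM.
have h3' : `|k * G (z + ofR k *: u + ofR t *: v) - k * G z| <= e / 3 * k.
  by rewrite -mulrBr normrM kn mulrC ler_wpM2r // ltW.
rewrite -E in h3'.
move: h1 h2 h3'; rewrite !ler_norml => /andP[? ?] /andP[? ?] /andP[? ?].
by apply/andP; split; lra.
Qed.

(** The second difference of F over the parallelogram with sides a u and a v is a^2 times a nearby
    value of either mixed derivative; continuity at z makes both close to their values at z. *)
Lemma hasD_schwarz F u v z (Fu Fv Fuv Fvu : 'rV[C]_n -> R) :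
  (\forall w \near z, [/\ hasD F u w (Fu w), hasD F v w (Fv w),
      hasD Fu v w (Fuv w) & hasD Fv u w (Fvu w)]) ->
  {for z, continuous Fuv} -> {for z, continuous Fvu} -> Fuv z = Fvu z.
Proof.
move=> h c1 c2; apply/eqP; rewrite -subr_eq0 -normr_le0.
apply/ler_addgt0Pr => e e0; rewrite add0r.
have e2 : 0 < e / 2 by rewrite divr_gt0.
have [a a0 ha] := sz_line u v (filterI h (filterI (cont_nbhs c1 e2) (cont_nbhs c2 e2))).
(* Two mean value steps, first along x for a difference of values of F, then along y. The second
   difference is symmetric in x and y, so the statement is used for (u, v) and for (v, u). *)
have main (x y : 'rV[C]_n) (X Y : 'rV[C]_n -> R) :
  (forall s t, 0 <= s <= a -> 0 <= t <= a -> hasD F x (z + ofR s *: x + ofR t *: y)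
      (X (z + ofR s *: x + ofR t *: y))) ->
  (forall s t, 0 <= s <= a -> 0 <= t <= a -> hasD X y (z + ofR s *: x + ofR t *: y)
      (Y (z + ofR s *: x + ofR t *: y))) ->
  exists s t, [/\ 0 <= s <= a, 0 <= t <= a &
    F (z + ofR a *: x + ofR a *: y) - F (z + ofR a *: x) - F (z + ofR a *: y) + F z
    = a * a * Y (z + ofR s *: x + ofR t *: y)].
  move=> hX hY.
  have sw s t (p q : 'rV[C]_n) : z + ofR s *: p + ofR t *: q = z + ofR t *: q + ofR s *: p.
    by rewrite addrAC.
  have a00 : 0 <= (0 : R) <= a by rewrite lexx ltW.
  have aa : 0 <= a <= a by rewrite lexx ltW.
  have [|s /andP[s0 sa] E] := @is_derive_mvt R
     (fun s => F (z + ofR a *: y + ofR s *: x) - F (z + ofR s *: x))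
     (fun s => X (z + ofR a *: y + ofR s *: x) - X (z + ofR s *: x)) a a0.
    move=> s sa; apply: is_deriveB; apply: hasD_line.
      by rewrite -sw; apply: hX.
    by have := hX s 0 sa a00; rewrite ofR0 scale0r addr0.
  have sI : 0 <= s <= a by rewrite !ltW.
  have [|t tI E'] := @hasD_mvt X y (z + ofR s *: x) Y a a0.
    by move=> t tI; apply: hY.
  exists s, t; split => //.
  rewrite -mulrA -E' -!(sw s a x y) in E *; rewrite -E !ofR0 !scale0r !addr0 -(sw a a); ring.
have [||s [t [sI tI E]]] := main u v Fu Fuv.
- by move=> s t sI tI; have [[]] := ha s t sI tI.
- by move=> s t sI tI; have [[]] := ha s t sI tI.
have [||t' [s' [tI' sI' E']]] := main v u Fv Fvu.
- by move=> t' s' sI' tI'; rewrite addrAC; have [[]] := ha s' t' tI' sI'.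
- by move=> t' s' sI' tI'; rewrite addrAC; have [[]] := ha s' t' tI' sI'.
have [_ [k1 _]] := ha s t sI tI; have [_ [_ k2]] := ha s' t' sI' tI'.
rewrite addrAC in k2.
have EE : Fuv (z + ofR s *: u + ofR t *: v) = Fvu (z + ofR t' *: v + ofR s' *: u).
  have aa0 : a * a != 0 by rewrite mulf_neq0 // gt_eqF.
  apply: (mulfI aa0); rewrite -E -E' (addrAC z (ofR a *: u)); ring.
move: k1 k2; rewrite EE !ler_norml => /andP[? ?] /andP[? ?].
by apply/andP; split; lra.
Qed.

Lemma hasD_taylor F v z (F1 F2 : 'rV[C]_n -> R) :
  (forall t : R, 0 <= t <= 1 -> hasD F v (z + ofR t *: v) (F1 (z + ofR t *: v))) ->
  (forall t : R, 0 <= t <= 1 -> hasD F1 v (z + ofR t *: v) (F2 (z + ofR t *: v))) ->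
  exists2 t : R, 0 <= t <= 1 & F (z + v) = F z + F1 z + F2 (z + ofR t *: v) / 2.
Proof.
move=> h1 h2; have [||t tI] := @taylor_lagrange2 R (fun t => F (z + ofR t *: v))
  (fun t => F1 (z + ofR t *: v)) (fun t => F2 (z + ofR t *: v)).
- by move=> t /h1 /hasD_line.
- by move=> t /h2 /hasD_line.
by rewrite !ofR0 !scale0r !addr0 scale1r => E; exists t.
Qed.

End RowSize.

(** * Complex-valued functions of class C^k *)

Section SmoothCalculus.
Context (R : realType).
Local Notation C := (Cplx R).

Lemma is_derive_ext (f g : R -> R) (t d : R) :
  f =1 g -> is_derive t 1 f d -> is_derive t 1 g d.
Proof. by move=> /funext ->. Qed.

Lemma cont_cnP (T : topologicalType) (f : T -> C) x : {for x, continuous f} <->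
  forall e : R, 0 < e -> \forall y \near x, cn (f y - f x) <= e.
Proof.
split=> [/cvgrPdist_le h e e0|h].
  have := h (ofR e); rewrite -ofR0 ofR_lt => /(_ e0); apply: filterS => y.
  by rewrite normcn ofR_le -cnN opprB.
apply/cvgrPdist_le => e e0.
have e1 : 0 < cn e by rewrite lt_neqAle cn_ge0 eq_sym cn_eq0 gt_eqF.
apply: filterS (h _ e1) => y; rewrite -cnN opprB -ofR_le -!normcn.
by rewrite (gtr0_norm e0).
Qed.

Lemma Im_le_cn (z : C) : `|complex.Im z| <= cn z.
Proof.
by rewrite /cn normc_def /= -sqrtr_sqr ler_wsqrtr // lerDr sqr_ge0.
Qed.

Lemma normRe_le_cn (z : C) : `|complex.Re z| <= cn z.
Proof.
by rewrite /cn normc_def /= -sqrtr_sqr ler_wsqrtr // lerDl sqr_ge0.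
Qed.

Lemma cont_Re (T : topologicalType) (f : T -> C) x :
  {for x, continuous f} -> {for x, continuous (fun y => complex.Re (f y))}.
Proof.
move=> /cont_cnP h; apply/cvgrPdist_le => e e0; apply: filterS (h _ e0) => y.
by apply: le_trans; rewrite -raddfB /= -cnN opprB normRe_le_cn.
Qed.

Lemma cont_Im (T : topologicalType) (f : T -> C) x :
  {for x, continuous f} -> {for x, continuous (fun y => complex.Im (f y))}.
Proof.
move=> /cont_cnP h; apply/cvgrPdist_le => e e0; apply: filterS (h _ e0) => y.
by apply: le_trans; rewrite -raddfB /= -cnN opprB Im_le_cn.
Qed.

Context (n : nat).
Implicit Types (f g h : 'rV[C]_n -> C) (U : set 'rV[C]_n) (z u v w : 'rV[C]_n).

Definition isD h v z (d : C) :=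
  hasD (fun w => complex.Re (h w)) v z (complex.Re d) /\
  hasD (fun w => complex.Im (h w)) v z (complex.Im d).

Lemma isD_real h v z : real_derivable h v z -> isD h v z (real_derive h v z).
Proof.
move=> [h1 h2]; split; rewrite /hasD /real_derive /= derive1E.
  exact: (derivableP h1).
exact: (derivableP h2).
Qed.

Lemma isD_val h v z d : isD h v z d -> real_derivable h v z /\ real_derive h v z = d.
Proof.
move=> [h1 h2]; split; first by split; [case: h1|case: h2].
by case: d h1 h2 => a b [/= _ <-] [/= _ <-]; rewrite /real_derive !derive1E.
Qed.

Lemma isD_near h g v z d : (\forall w \near z, h w = g w) ->
  isD h v z d -> isD g v z d.
Proof.
move=> /(nbhs_line v) hg [h1 h2]; split.
  by apply: near_eq_is_derive h1; apply: filterS hg => t ->.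
by apply: near_eq_is_derive h2; apply: filterS hg => t ->.
Qed.

Lemma isD_lin (a b : C) h g v z d d' : isD h v z d -> isD g v z d' ->
  isD (fun w => a * h w + b * g w) v z (a * d + b * d').
Proof.
move=> [h1 h2] [g1 g2]; split; rewrite /hasD in h1 h2 g1 g2 *.
  apply: (is_derive_ext (f := fun t =>
    (complex.Re a * complex.Re (h (z + ofR t *: v)) - complex.Im a * complex.Im (h (z + ofR t *: v)))
  + (complex.Re b * complex.Re (g (z + ofR t *: v)) - complex.Im b * complex.Im (g (z + ofR t *: v))))).
    by move=> t; case: a b => [? ?] [? ?]; case: (h _) => ? ?; case: (g _).
  apply: is_derive_eq; case: a b => [? ?] [? ?]; case: d {h1 h2} => ? ?; case: d' {g1 g2} => ? ?.
  by rewrite /= /GRing.scale /=; ring.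
apply: (is_derive_ext (f := fun t =>
    (complex.Re a * complex.Im (h (z + ofR t *: v)) + complex.Im a * complex.Re (h (z + ofR t *: v)))
  + (complex.Re b * complex.Im (g (z + ofR t *: v)) + complex.Im b * complex.Re (g (z + ofR t *: v))))).
  by move=> t; case: a b => [? ?] [? ?]; case: (h _) => ? ?; case: (g _).
apply: is_derive_eq; case: a b => [? ?] [? ?]; case: d {h1 h2} => ? ?; case: d' {g1 g2} => ? ?.
by rewrite /= /GRing.scale /=; ring.
Qed.

Lemma isD_conj h v z d : isD h v z d -> isD (fun w => (h w)^*) v z d^*.
Proof.
move=> [h1 h2]; split; rewrite /hasD in h1 h2 *.
  case: d h1 {h2} => a b /= h1; apply: is_derive_ext h1.
  by move=> t; case: (h _).
apply: (is_derive_ext (f := fun t => - complex.Im (h (z + ofR t *: v)))).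
  by move=> t; case: (h _).
by apply: is_derive_eq; case: d {h1 h2}.
Qed.

Lemma isD_scale h v z d (s : R) : isD h v z d -> isD h (ofR s *: v) z (ofR s * d).
Proof.
have main (F : 'rV[C]_n -> R) e : hasD F v z e -> hasD F (ofR s *: v) z (s * e).
  move=> hF; have hF' : is_derive (s * 0) 1 (fun t => F (z + ofR t *: v)) e.
    by rewrite mulr0.
  have hs : is_derive (0 : R) 1 (fun t : R => s * t) s.
    by apply: is_derive_eq; rewrite /GRing.scale /= mulr1 ?mulr0 ?addr0.
  have := is_derive1_comp hF' hs; rewrite mulrC; apply: is_derive_ext.
  by move=> t; rewrite /= scalerA -ofRM mulrC.
move=> [h1 h2]; split.
  have -> : complex.Re (ofR s * d) = s * complex.Re d by case: d {h1 h2} => a b /=; ring.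
  exact: main.
have -> : complex.Im (ofR s * d) = s * complex.Im d by case: d {h1 h2} => a b /=; ring.
exact: main.
Qed.

Lemma isD_cst (c : C) v z : isD (fun=> c) v z 0.
Proof. by split; apply: is_derive_cst. Qed.

Lemma real_derive_near h g v z : (\forall w \near z, h w = g w) ->
  real_derivable h v z -> real_derive g v z = real_derive h v z.
Proof. by move=> hg /isD_real /(isD_near hg) /isD_val []. Qed.

Lemma Ck_cont k U h z : Ck k U h -> U z -> {for z, continuous h}.
Proof. by case: k => [|k] [h1 _]; apply: h1. Qed.

Lemma Ck_derivable k U h v z : Ck k.+1 U h -> U z -> real_derivable h v z.
Proof. by case=> _ H; case: (H v) => + _; apply. Qed.

Lemma Ck_D k U h v : Ck k.+1 U h -> Ck k U (real_derive h v).
Proof. by case=> _ H; case: (H v). Qed.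

Lemma Ck_isD k U h v z : Ck k.+1 U h -> U z -> isD h v z (real_derive h v z).
Proof. by move=> hh Uz; apply: isD_real; apply: Ck_derivable hh Uz. Qed.

Lemma cont_near (T : topologicalType) (f g : T -> C) x :
  (\forall y \near x, f y = g y) -> {for x, continuous f} -> {for x, continuous g}.
Proof.
move=> fg /cont_cnP h; apply/cont_cnP => e e0.
rewrite -(nbhs_singleton fg); apply: filterS (filterI fg (h e e0)) => y [<-] //.
Qed.

Lemma Ck_ext k U h g : open U -> (forall z, U z -> h z = g z) -> Ck k U h -> Ck k U g.
Proof.
move=> oU; elim: k h g => [|k IH] h g hg hh.
  split=> // z Uz; apply: cont_near (Ck_cont hh Uz).
  by apply: filterS (open_nbhs_nbhs (conj oU Uz)) => w /hg.
have ne z : U z -> \forall w \near z, h w = g w.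
  by move=> Uz; apply: filterS (open_nbhs_nbhs (conj oU Uz)) => w /hg.
split=> [z Uz|v].
  by apply: cont_near (Ck_cont hh Uz); apply: ne.
split=> [z Uz|].
  by have /isD_val[] := isD_near (ne z Uz) (Ck_isD v hh Uz).
apply: IH (Ck_D v hh) => z Uz.
by apply/esym/real_derive_near; [exact: ne|exact: Ck_derivable hh Uz].
Qed.

Lemma cont_add (T : topologicalType) (h g : T -> C) x :
  {for x, continuous h} -> {for x, continuous g} ->
  {for x, continuous (fun y => h y + g y)}.
Proof. by move=> ch cg; exact: (@continuousD C C T h g x ch cg). Qed.

Lemma cont_mul (T : topologicalType) (h g : T -> C) x :
  {for x, continuous h} -> {for x, continuous g} ->
  {for x, continuous (fun y => h y * g y)}.
Proof. by move=> ch cg; exact: (@continuousM C T h g x ch cg). Qed.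

Lemma cont_cst (T : topologicalType) (c : C) (x : T) : {for x, continuous (fun=> c)}.
Proof. exact: cvg_cst. Qed.

Lemma cont_lin (T : topologicalType) (a b : C) (h g : T -> C) x :
  {for x, continuous h} -> {for x, continuous g} ->
  {for x, continuous (fun y => a * h y + b * g y)}.
Proof.
by move=> ch cg; exact (cont_add (cont_mul (@cont_cst _ a x) ch) (cont_mul (@cont_cst _ b x) cg)).
Qed.

Lemma Ck_lin k U (a b : C) h g : open U -> Ck k U h -> Ck k U g ->
  Ck k U (fun w => a * h w + b * g w).
Proof.
move=> oU; elim: k h g => [|k IH] h g hh hg.
  split=> [z Uz|//]; exact (@cont_lin _ a b _ _ z (Ck_cont hh Uz) (Ck_cont hg Uz)).
have D v z : U z -> isD (fun w => a * h w + b * g w) v z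
    (a * real_derive h v z + b * real_derive g v z).
  by move=> Uz; apply: isD_lin; [exact: Ck_isD hh Uz|exact: Ck_isD hg Uz].
split=> [z Uz|v].
  exact (@cont_lin _ a b _ _ z (Ck_cont hh Uz) (Ck_cont hg Uz)).
split=> [z Uz|]; first by have /isD_val[] := D v z Uz.
apply: (Ck_ext oU _ (IH _ _ (Ck_D v hh) (Ck_D v hg))) => z Uz.
by have /isD_val[_ ->] := D v z Uz.
Qed.

Lemma Ck_deriveD U h u v z : open U -> Ck 1 U h -> U z ->
  real_derive h (u + v) z = real_derive h u z + real_derive h v z.
Proof.
move=> oU hh Uz; have nU := open_nbhs_nbhs (conj oU Uz).
have cD := Ck_cont (Ck_D v hh) Uz.
have [a1 a2] := Ck_isD u hh Uz; have [b1 b2] := Ck_isD (u + v) hh Uz.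
have E1 := hasDD a1 b1 (G := fun w => complex.Re (real_derive h v w)) _ (cont_Re cD).
have E2 := hasDD a2 b2 (G := fun w => complex.Im (real_derive h v w)) _ (cont_Im cD).
apply/eqP; rewrite eq_complex E1 ?E2; last 2 first.
- by apply: filterS nU => w Uw; have [] := Ck_isD v hh Uw.
- by apply: filterS nU => w Uw; have [] := Ck_isD v hh Uw.
by case: (real_derive h u z) => ? ?; case: (real_derive h v z) => ? ? /=; rewrite !eqxx.
Qed.

Lemma Ck_deriveZ U h v z (s : R) : Ck 1 U h -> U z ->
  real_derive h (ofR s *: v) z = ofR s * real_derive h v z.
Proof. by move=> hh Uz; have /isD_val[] := isD_scale s (Ck_isD v hh Uz). Qed.

Lemma Ck_schwarz U h u v z : open U -> Ck 2 U h -> U z ->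
  real_derive (real_derive h u) v z = real_derive (real_derive h v) u z.
Proof.
move=> oU hh Uz; have nU := open_nbhs_nbhs (conj oU Uz).
have cuv := Ck_cont (Ck_D v (Ck_D u hh)) Uz.
have cvu := Ck_cont (Ck_D u (Ck_D v hh)) Uz.
apply/eqP; rewrite eq_complex; apply/andP; split; apply/eqP.
  apply: (hasD_schwarz (F := fun w => complex.Re (h w))
      (Fu := fun w => complex.Re (real_derive h u w))
      (Fv := fun w => complex.Re (real_derive h v w)) _ (cont_Re cuv) (cont_Re cvu)).
    apply: filterS nU => w Uw.
    exact: And4 (Ck_isD u hh Uw).1 (Ck_isD v hh Uw).1
      (Ck_isD v (Ck_D u hh) Uw).1 (Ck_isD u (Ck_D v hh) Uw).1.
apply: (hasD_schwarz (F := fun w => complex.Im (h w))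
      (Fu := fun w => complex.Im (real_derive h u w))
      (Fv := fun w => complex.Im (real_derive h v w)) _ (cont_Im cuv) (cont_Im cvu)).
apply: filterS nU => w Uw.
exact: And4 (Ck_isD u hh Uw).2 (Ck_isD v hh Uw).2
  (Ck_isD v (Ck_D u hh) Uw).2 (Ck_isD u (Ck_D v hh) Uw).2.
Qed.

(** The differential is only real linear, so v is split along the real basis e_k, i e_k; the two
    Wirtinger derivatives collect the parts that are complex linear and antilinear in v. *)
Lemma Ck_wirtinger U h v z : open U -> Ck 1 U h -> U z ->
  real_derive h v z = \sum_k (v 0 k * dz k h z + (v 0 k)^* * dzbar k h z).
Proof.
move=> oU hh Uz.
have E : v = \sum_k (ofR (complex.Re (v 0 k)) *: delta_mx 0 k
                + ofR (complex.Im (v 0 k)) *: (imag R *: delta_mx 0 k)).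
  rewrite {1}[v]row_sum_delta; apply: eq_bigr => k _.
  by rewrite scalerA -scalerDl mulrC /imag -complexE.
have D0 : real_derive h 0 z = 0.
  by rewrite -[0](scale0r (0 : 'rV[C]_n)) -ofR0 (Ck_deriveZ _ _ hh Uz) ofR0 mul0r.
rewrite {1}E (big_morph (fun v => real_derive h v z) (fun u v => Ck_deriveD u v oU hh Uz) D0).
apply: eq_bigr => k _; rewrite (Ck_deriveD _ _ oU hh Uz) !(Ck_deriveZ _ _ hh Uz).
rewrite /dz /dzbar; set X := real_derive h _ z; set Y := real_derive h _ z.
have i2 : imag R * imag R = -1 by rewrite -expr2 sqr_i.
have -> : (v 0 k)^* = ofR (complex.Re (v 0 k)) - imag R * ofR (complex.Im (v 0 k)).
  by case: (v 0 k) => a b; apply/eqP; rewrite eq_complex /=; apply/andP; split; apply/eqP; ring.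
rewrite {3}(complexE (v 0 k)) -!/(ofR _) -/(imag R).
set a := ofR _; set b := ofR _; set i := imag R.
transitivity (a * X - i * i * (b * Y)); first by rewrite i2; ring.
by field.
Qed.

End SmoothCalculus.

(** * Wirtinger derivatives and second-order expansion of smooth functions *)

Section Wirtinger.
Context (R : realType) (n : nat).
Local Notation C := (Cplx R).
Implicit Types (f g h : 'rV[C]_n -> C) (U : set 'rV[C]_n) (z u v w : 'rV[C]_n).

Lemma smooth_isD U h v z : smooth_on U h -> U z -> isD h v z (real_derive h v z).
Proof. by move=> hh; apply: Ck_isD (hh 1%N). Qed.

Lemma smooth_D U h v : smooth_on U h -> smooth_on U (real_derive h v).
Proof. by move=> hh k; apply: Ck_D (hh k.+1). Qed.

Lemma smooth_cont U h z : smooth_on U h -> U z -> {for z, continuous h}.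
Proof. by move=> hh; apply: Ck_cont (hh 0%N). Qed.

Lemma smooth_ext U h g : open U -> (forall z, U z -> h z = g z) ->
  smooth_on U h -> smooth_on U g.
Proof. by move=> oU hg hh k; apply: Ck_ext hg (hh k). Qed.

Lemma smooth_lin U (a b : C) h g : open U -> smooth_on U h -> smooth_on U g ->
  smooth_on U (fun w => a * h w + b * g w).
Proof. by move=> oU hh hg k; apply: Ck_lin. Qed.

Lemma dzE (a : 'I_n) h : dz a h = fun z => 2^-1 * real_derive h (delta_mx 0 a) z +
   (- (2^-1 * imag R)) * real_derive h (imag R *: delta_mx 0 a) z.
Proof. by apply/funext => z; rewrite /dz mulrBr mulrA mulNr. Qed.

Lemma dzbarE (a : 'I_n) h : dzbar a h = fun z => 2^-1 * real_derive h (delta_mx 0 a) z +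
   (2^-1 * imag R) * real_derive h (imag R *: delta_mx 0 a) z.
Proof. by apply/funext => z; rewrite /dzbar mulrDr mulrA. Qed.

Lemma smooth_dz U (a : 'I_n) h : open U -> smooth_on U h -> smooth_on U (dz a h).
Proof. by move=> oU hh; rewrite dzE; apply: smooth_lin => //; apply: smooth_D. Qed.

Lemma smooth_dzbar U (a : 'I_n) h : open U -> smooth_on U h -> smooth_on U (dzbar a h).
Proof. by move=> oU hh; rewrite dzbarE; apply: smooth_lin => //; apply: smooth_D. Qed.

Lemma real_derive_ext U h g v z : open U -> (forall w, U w -> h w = g w) ->
  smooth_on U h -> U z -> real_derive g v z = real_derive h v z.
Proof.
move=> oU hg hh Uz; apply: real_derive_near; last exact: Ck_derivable (hh 1%N) Uz.
by apply: filterS (open_nbhs_nbhs (conj oU Uz)) => w /hg.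
Qed.

Lemma dz_ext U (a : 'I_n) h g z : open U -> (forall w, U w -> h w = g w) ->
  smooth_on U h -> U z -> dz a g z = dz a h z.
Proof. by move=> oU hg hh Uz; rewrite /dz !(real_derive_ext _ oU hg hh Uz). Qed.

Lemma dzbar_ext U (a : 'I_n) h g z : open U -> (forall w, U w -> h w = g w) ->
  smooth_on U h -> U z -> dzbar a g z = dzbar a h z.
Proof. by move=> oU hg hh Uz; rewrite /dzbar !(real_derive_ext _ oU hg hh Uz). Qed.

Lemma conj_imag : (imag R)^* = - imag R.
Proof. by apply/eqP; rewrite eq_complex /= oppr0 !eqxx. Qed.

Lemma conj_half : (2^-1 : C)^* = 2^-1.
Proof. by rewrite fmorphV rmorph_nat. Qed.

Lemma dzbar_conj U (a : 'I_n) h z : smooth_on U h -> U z ->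
  dzbar a (fun w => (h w)^*) z = (dz a h z)^*.
Proof.
move=> hh Uz; rewrite /dz /dzbar.
have D v := (isD_val (isD_conj (smooth_isD v hh Uz))).2.
by rewrite !D !(rmorphM, rmorphB) /= conj_imag conj_half mulNr opprK.
Qed.

Lemma dzbar_lin U (c : 'I_n) (a b : C) h g z : smooth_on U h -> smooth_on U g -> U z ->
  dzbar c (fun w => a * h w + b * g w) z = a * dzbar c h z + b * dzbar c g z.
Proof.
move=> hh hg Uz; rewrite /dzbar.
have D v := (isD_val (isD_lin a b (smooth_isD v hh Uz) (smooth_isD v hg Uz))).2.
rewrite !D.
move: (real_derive h _ z) (real_derive h _ z) (real_derive g _ z) (real_derive g _ z) => h1 h2 g1 g2.
ring.
Qed.

Lemma real_derive_lin U v (a b : C) h g z : smooth_on U h -> smooth_on U g -> U z ->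
  real_derive (fun w => a * h w + b * g w) v z = a * real_derive h v z + b * real_derive g v z.
Proof.
move=> hh hg Uz.
exact: (isD_val (isD_lin a b (smooth_isD v hh Uz) (smooth_isD v hg Uz))).2.
Qed.

(** Both [dz] and [dzbar] have the shape p D_e1 + q D_e2 by [dzE] and [dzbarE], so one application
    of Schwarz's theorem serves their commutation with every real derivative. *)
Lemma real_derive_comb U (p q : C) (e1 e2 : 'rV[C]_n) h v z :
  open U -> smooth_on U h -> U z ->
  real_derive (fun w => p * real_derive h e1 w + q * real_derive h e2 w) v z =
  p * real_derive (real_derive h v) e1 z + q * real_derive (real_derive h v) e2 z.
Proof.
move=> oU hh Uz; rewrite (real_derive_lin _ _ _ (smooth_D e1 hh) (smooth_D e2 hh) Uz).
by rewrite (Ck_schwarz e1 v oU (hh 2%N) Uz) (Ck_schwarz e2 v oU (hh 2%N) Uz).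
Qed.

Lemma real_derive_dz U (a : 'I_n) h v z : open U -> smooth_on U h -> U z ->
  real_derive (dz a h) v z = dz a (real_derive h v) z.
Proof. by move=> oU hh Uz; rewrite !dzE; exact: real_derive_comb oU hh Uz. Qed.

Lemma real_derive_dzbar U (a : 'I_n) h v z : open U -> smooth_on U h -> U z ->
  real_derive (dzbar a h) v z = dzbar a (real_derive h v) z.
Proof. by move=> oU hh Uz; rewrite !dzbarE; exact: real_derive_comb oU hh Uz. Qed.

Lemma dzbar_comb U (d : 'I_n) (p q : C) (e1 e2 : 'rV[C]_n) h z :
  open U -> smooth_on U h -> U z ->
  p * real_derive (dzbar d h) e1 z + q * real_derive (dzbar d h) e2 z =
  dzbar d (fun w => p * real_derive h e1 w + q * real_derive h e2 w) z.
Proof.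
move=> oU hh Uz; rewrite (dzbar_lin d _ _ (smooth_D e1 hh) (smooth_D e2 hh) Uz).
by rewrite (real_derive_dzbar d e1 oU hh Uz) (real_derive_dzbar d e2 oU hh Uz).
Qed.

Lemma dz_dzbar U (c d : 'I_n) h z : open U -> smooth_on U h -> U z ->
  dz c (dzbar d h) z = dzbar d (dz c h) z.
Proof. by move=> oU hh Uz; rewrite !dzE; exact: dzbar_comb oU hh Uz. Qed.

Lemma wirtinger U h v z : open U -> smooth_on U h -> U z ->
  real_derive h v z = \sum_k (v 0 k * dz k h z + (v 0 k)^* * dzbar k h z).
Proof. by move=> oU hh Uz; apply: Ck_wirtinger oU (hh 1%N) Uz. Qed.

(** The second derivative along v, written with coefficients independent of v: this form can be
    compared at two base points for all v at once. *)
Definition hessian h z v : C := \sum_k \sum_l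
  (v 0 k * v 0 l * dz l (dz k h) z + v 0 k * (v 0 l)^* * dzbar l (dz k h) z
  + ((v 0 k)^* * v 0 l * dz l (dzbar k h) z + (v 0 k)^* * (v 0 l)^* * dzbar l (dzbar k h) z)).

Lemma real_derive2 U h v z : open U -> smooth_on U h -> U z ->
  real_derive (real_derive h v) v z = hessian h z v.
Proof.
move=> oU hh Uz; rewrite (wirtinger _ oU (smooth_D v hh) Uz); apply: eq_bigr => k _.
rewrite -(real_derive_dz _ _ oU hh Uz) -(real_derive_dzbar _ _ oU hh Uz).
rewrite (wirtinger _ oU (smooth_dz k oU hh) Uz) (wirtinger _ oU (smooth_dzbar k oU hh) Uz).
rewrite !mulr_sumr -big_split; apply: eq_bigr => l _ /=.
by rewrite !mulrDr !mulrA.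
Qed.

Lemma ofR_half : ofR 2^-1 = 2^-1 :> C.
Proof. by rewrite /ofR fmorphV rmorph_nat. Qed.

Lemma Re_half (x : C) : complex.Re (x / 2) = complex.Re x / 2.
Proof. by rewrite -ofR_half; case: x => a b /=; rewrite mulr0 subr0. Qed.

Lemma Im_half (x : C) : complex.Im (x / 2) = complex.Im x / 2.
Proof. by rewrite -ofR_half; case: x => a b /=; rewrite mulr0 add0r. Qed.

Lemma le_quarters (e m x1 x2 x3 x4 : R) : 0 <= m -> x1 <= e / 4 -> x2 <= e / 4 ->
  x3 <= e / 4 -> x4 <= e / 4 -> m * x1 + m * x2 + (m * x3 + m * x4) <= m * e.
Proof.
move=> m0 h1 h2 h3 h4; have := ler_wpM2l m0 h1; have := ler_wpM2l m0 h2.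
have := ler_wpM2l m0 h3; have := ler_wpM2l m0 h4; lra.
Qed.

Lemma subr_halves (a b c d : R) : a + b + c / 2 - (a + b + d / 2) = (c - d) / 2.
Proof. by field. Qed.

(** The neighbourhood must not depend on v, because in the Taylor formula the direction is the
    increment itself. It suffices that each of the four kinds of coefficients moves by at most e /
    4, since the products |v_k| |v_l| add up to [sz v ^+ 2]. *)
Lemma hessian_near U h z (e : R) : open U -> smooth_on U h -> U z -> 0 < e ->
  \forall w \near z, forall v, cn (hessian h w v - hessian h z v) <= e * sz v ^+ 2.
Proof.
move=> oU hh Uz e0; have e4 : 0 < e / 4 by rewrite divr_gt0.
have sd a := smooth_dz a oU hh; have sb a := smooth_dzbar a oU hh.
have near2 (F : 'I_n -> 'I_n -> 'rV[C]_n -> C) : (forall k l, smooth_on U (F k l)) ->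
    \forall w \near z, forall k l, cn (F k l w - F k l z) <= e / 4.
  move=> hF; suff H : \forall w \near z, forall kl : 'I_n * 'I_n,
      cn (F kl.1 kl.2 w - F kl.1 kl.2 z) <= e / 4.
    by apply: filterS H => w H k l; exact: (H (k, l)).
  apply: (@filter_forall _ _ (fun kl : 'I_n * 'I_n =>
    [set w | cn (F kl.1 kl.2 w - F kl.1 kl.2 z) <= e / 4]) _ (nbhs_filter z)) => -[k l].
  by move/cont_cnP: (smooth_cont (hF k l) Uz); apply.
have n1 := near2 _ (fun k l => smooth_dz l oU (sd k)).
have n2 := near2 _ (fun k l => smooth_dzbar l oU (sd k)).
have n3 := near2 _ (fun k l => smooth_dz l oU (sb k)).
have n4 := near2 _ (fun k l => smooth_dzbar l oU (sb k)).
apply: filterS (filterI (filterI n1 n2) (filterI n3 n4)) => w [[h1 h2] [h3 h4]] v.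
rewrite /hessian -sumrB expr2 {1}/sz mulr_suml mulr_sumr.
apply: (le_trans (cn_sum _ _ _)); apply: ler_sum => k _.
rewrite -sumrB mulrCA mulr_sumr mulr_sumr; apply: (le_trans (cn_sum _ _ _)); apply: ler_sum => l _.
set vk := v 0 k; set vl := v 0 l.
have -> (a b c d a' b' c' d' : C) :
   vk * vl * a + vk * vl^* * b + (vk^* * vl * c + vk^* * vl^* * d) -
  (vk * vl * a' + vk * vl^* * b' + (vk^* * vl * c' + vk^* * vl^* * d')) =
   vk * vl * (a - a') + vk * vl^* * (b - b') + (vk^* * vl * (c - c') + vk^* * vl^* * (d - d')).
  by ring.
have m0 : 0 <= cn vk * cn vl by rewrite mulr_ge0 ?cn_ge0.
rewrite [leRHS]mulrA [leRHS]mulrAC.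
apply: le_trans (le_quarters m0 (h1 k l) (h2 k l) (h3 k l) (h4 k l)).
apply: (le_trans (cnD _ _)); apply: lerD.
  by apply: (le_trans (cnD _ _)); rewrite !cnM !cn_conj.
by apply: (le_trans (cnD _ _)); rewrite !cnM !cn_conj.
Qed.

Lemma nbhs_segment z (P : set 'rV[C]_n) : nbhs z P -> exists2 d : R, 0 < d &
  forall v, sz v < d -> forall t : R, 0 <= t <= 1 -> P (z + ofR t *: v).
Proof.
move=> /nbhs_sz[d d0 hd]; exists d => // v vd t /andP[t0 t1].
apply: hd; rewrite szZ cn_ofR ger0_norm //; apply: le_lt_trans vd.
by rewrite ler_piMl // sz_ge0.
Qed.

Lemma taylor2 U h z (e : R) : open U -> smooth_on U h -> U z -> 0 < e ->
  exists2 d : R, 0 < d & forall v, sz v < d ->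
    cn (h (z + v) - (h z + real_derive h v z + hessian h z v / 2)) <= e * sz v ^+ 2.
Proof.
move=> oU hh Uz e0.
have [d d0 hd] := nbhs_segment (filterI (open_nbhs_nbhs (conj oU Uz)) (hessian_near oU hh Uz e0)).
exists d => // v /hd{hd} hv.
have D1 t (tI : 0 <= t <= 1) := smooth_isD v hh (hv t tI).1.
have D2 t (tI : 0 <= t <= 1) := smooth_isD v (smooth_D v hh) (hv t tI).1.
(* Here p is the real or the imaginary part. They are treated separately because their Lagrange
   remainders sit at different intermediate points; each contributes e / 2. *)
have main (p : C -> R) (pD : {morph p : x y / x + y}) (pN : {morph p : x / - x})
   (p2 : forall x : C, p (x / 2) = p x / 2) (pn : forall x : C, `|p x| <= cn x) :
  (forall t : R, 0 <= t <= 1 ->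
     hasD (fun w => p (h w)) v (z + ofR t *: v) (p (real_derive h v (z + ofR t *: v)))) ->
  (forall t : R, 0 <= t <= 1 ->
     hasD (fun w => p (real_derive h v w)) v (z + ofR t *: v)
        (p (real_derive (real_derive h v) v (z + ofR t *: v)))) ->
  `|p (h (z + v) - (h z + real_derive h v z + hessian h z v / 2))| <= e / 2 * sz v ^+ 2.
  move=> d1 d2; have [t tI E] := hasD_taylor (F := fun w => p (h w)) (F1 := fun w => p (real_derive h v w))
    (F2 := fun w => p (real_derive (real_derive h v) v w)) d1 d2.
  rewrite (real_derive2 _ oU hh (hv t tI).1) in E.
  have := (hv t tI).2 v => /(le_trans (pn _)).
  rewrite !(pD, pN, p2) E.
  rewrite subr_halves.
  by rewrite normrM (@ger0_norm _ 2^-1) ?invr_ge0 // ler_pdivrMr // mulrAC divfK // ?pnatr_eq0.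
apply: (le_trans (cn_le_ReIm _)).
have r1 : `|complex.Re (h (z + v) - (h z + real_derive h v z + hessian h z v / 2))| <= e / 2 * sz v ^+ 2.
  apply: (main (@complex.Re R)).
  - by move=> [? ?] [? ?].
  - by move=> [? ?].
  - exact: Re_half.
  - exact: normRe_le_cn.
  - by move=> t tI; exact: (D1 t tI).1.
  - by move=> t tI; exact: (D2 t tI).1.
have r2 : `|complex.Im (h (z + v) - (h z + real_derive h v z + hessian h z v / 2))| <= e / 2 * sz v ^+ 2.
  apply: (main (@complex.Im R)).
  - by move=> [? ?] [? ?].
  - by move=> [? ?].
  - exact: Im_half.
  - exact: Im_le_cn.
  - by move=> t tI; exact: (D1 t tI).2.
  - by move=> t tI; exact: (D2 t tI).2.
by lra.
Qed.

Lemma jet_quadratic (A B E F : 'I_n -> 'I_n -> C) (del : C -> 'rV[C]_n) (X : 'I_n -> C) :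
  (forall i, jet (fun t => del t 0 i) 0 (X i) 0 0) ->
  jet (fun t => \sum_k \sum_l (del t 0 k * del t 0 l * A k l + del t 0 k * (del t 0 l)^* * B k l
     + ((del t 0 k)^* * del t 0 l * E k l + (del t 0 k)^* * (del t 0 l)^* * F k l)))
   0 0 0 (\sum_k \sum_l (X k * (X l)^* * B k l + (X k)^* * X l * E k l)).
Proof.
move=> hd; have cj k := jet_conj (hd k).
have r0 : (0 : C)^* = 0 := rmorph0 _; rewrite !r0 in cj.
have J k l := jetD (jetD (jetM (jetM (hd k) (hd l)) (jet_cst (A k l)))
                     (jetM (jetM (hd k) (cj l)) (jet_cst (B k l))))
               (jetD (jetM (jetM (cj k) (hd l)) (jet_cst (E k l)))
                     (jetM (jetM (cj k) (cj l)) (jet_cst (F k l)))).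
apply: (jet_eq (jet_sum (fun k => jet_sum (fun l => J k l)))).
- by apply: big1 => k _; apply: big1 => l _; rewrite !(mul0r, mulr0, addr0).
- by apply: big1 => k _; apply: big1 => l _; rewrite !(mul0r, mulr0, addr0).
- by apply: big1 => k _; apply: big1 => l _; rewrite !(mul0r, mulr0, addr0).
- apply: eq_bigr => k _; apply: eq_bigr => l _.
  by rewrite !(mul0r, mulr0, addr0, add0r).
Qed.

Lemma jet_linear (A B : 'I_n -> C) (del : C -> 'rV[C]_n) (X : 'I_n -> C) :
  (forall i, jet (fun t => del t 0 i) 0 (X i) 0 0) ->
  jet (fun t => \sum_k (del t 0 k * A k + (del t 0 k)^* * B k))
   0 (\sum_k X k * A k) (\sum_k (X k)^* * B k) 0.
Proof.
move=> hd; have cj k := jet_conj (hd k).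
have r0 : (0 : C)^* = 0 := rmorph0 _; rewrite !r0 in cj.
have J k := jetD (jetM (hd k) (jet_cst (A k))) (jetM (cj k) (jet_cst (B k))).
apply: (jet_eq (jet_sum (fun k => J k))).
- by apply: big1 => k _; rewrite !(mul0r, mulr0, addr0).
- by apply: eq_bigr => k _; rewrite !(mul0r, mulr0, addr0, add0r).
- by apply: eq_bigr => k _; rewrite !(mul0r, mulr0, addr0, add0r).
- by apply: big1 => k _; rewrite !(mul0r, mulr0, addr0).
Qed.

(** Since [del] has neither a tbar nor a t tbar term, the first derivatives of h contribute nothing
    to the coefficient of t tbar, which is the Levi form of h at X. The t^2 and tbar^2 terms of
    [del] may be arbitrary. *)
Lemma jet_comp U h z (X : 'I_n -> C) (del : C -> 'rV[C]_n) :
  open U -> smooth_on U h -> U z ->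
  (forall i, jet (fun t => del t 0 i) 0 (X i) 0 0) ->
  jet (fun t => h (z + del t)) (h z) (\sum_i X i * dz i h z)
    (\sum_i (X i)^* * dzbar i h z) (\sum_i \sum_j X i * (X j)^* * dz i (dzbar j h) z).
Proof.
move=> oU hh Uz hd.
have jL : jet (fun t => real_derive h (del t) z) 0 (\sum_i X i * dz i h z)
    (\sum_i (X i)^* * dzbar i h z) 0.
  have E t : \sum_k (del t 0 k * dz k h z + (del t 0 k)^* * dzbar k h z) = real_derive h (del t) z.
    by rewrite (wirtinger _ oU hh Uz).
  exact: (jet_ext E (jet_linear _ _ hd)).
have jQ : jet (fun t => hessian h z (del t) / 2) 0 0 0
    (\sum_i \sum_j X i * (X j)^* * dz i (dzbar j h) z).
  have J := jet_quadratic (fun k l => dz l (dz k h) z) (fun k l => dzbar l (dz k h) z)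
    (fun k l => dz l (dzbar k h) z) (fun k l => dzbar l (dzbar k h) z) hd.
  apply: (jet_ext (fun t => mulrC _ _)); apply: (jet_eq (jetZ 2^-1 J)); rewrite ?mulr0 //.
  (* The two families of mixed derivatives agree by [dz_dzbar], which absorbs the factor 1/2 of the
     Taylor formula. *)
  rewrite (_ : \sum_k _ = (\sum_i \sum_j X i * (X j)^* * dz i (dzbar j h) z) * 2).
    by rewrite mulrC mulfK // pnatr_eq0.
  rewrite mulr_natr mulr2n [X in _ = X + _](eq_bigr _ (fun k _ => eq_bigr _ (fun l _ =>
    congr1 _ (dz_dzbar k l oU hh Uz)))) [X in _ = _ + X]exchange_big -big_split.
  by apply: eq_bigr => k _; rewrite -big_split; apply: eq_bigr => l _ /=; rewrite [(X k)^* * _]mulrC.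
have o : o2 (fun t => h (z + del t) - (h z + real_derive h (del t) z + hessian h z (del t) / 2)).
  (* The displacement is O(|t|), so a remainder that is small against [sz (del t) ^+ 2] is small
     against |t|^2. *)
  have [K [K0 hK]] : bigo 1 (fun t => ofR (sz (del t))).
    have [K [K0 hK]] : bigo 1 (fun t => \sum_k ofR (cn (del t 0 k))).
      apply: bigo_sum => k; have [p [r hp]] := hd k.
      have b1 := bigoD (bigoD (bigo_lin (X k) 0) (@bigoW R 1 2 _ isT (bigo_quad p 0 r)))
          (@bigoW R 1 2 _ isT (o2_bigo hp)).
      case: b1 => K [K0 hK]; exists K; split => //; apply: filterS hK => t.
      rewrite cn_ofR ger0_norm ?cn_ge0 // /poly2 add0r.
      by rewrite [X in cn X](_ : _ = del t 0 k) //; ring.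
    exists K; split => //; apply: filterS hK => t; congr (cn _ <= _).
    by rewrite /sz (big_morph (@ofR R) (@ofRD R) (ofR0 R)).
  move=> e e0; have K2 : 0 < K ^+ 2 + 1 by rewrite ltr_wpDl // exprn_ge0.
  have K1 : 0 < K + 1 by rewrite ltr_wpDl.
  have [d d0 hdl] := taylor2 oU hh Uz (divr_gt0 e0 K2).
  near=> t; have hs : sz (del t) <= K * cn t.
    by rewrite -(ger0_norm (sz_ge0 _)) -cn_ofR -[cn t]expr1; near: t.
  have ht : cn t < d / (K + 1) by near: t; apply: cn_near0; rewrite divr_gt0.
  have hs' : sz (del t) < d.
    apply: (le_lt_trans hs); rewrite ltr_pdivlMr // in ht.
    have := cn_ge0 t; lra.
  apply: (le_trans (hdl _ hs')); rewrite mulrAC ler_pdivrMr //.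
  have : sz (del t) ^+ 2 <= (K * cn t) ^+ 2 by rewrite ler_sqr ?nnegrE ?sz_ge0 ?mulr_ge0 ?cn_ge0.
  rewrite exprMn => hsq; rewrite -mulrA (ler_wpM2l (ltW e0)) //.
  have := exprn_ge0 2 (cn_ge0 t); lra.
have := jetD (jet_o2 o) (jetD (jetD (jet_cst (h z)) jL) jQ).
move=> /(jet_near _) J; apply: jet_eq; first apply: J.
- by near=> t; ring.
- by rewrite !(add0r, addr0).
- by rewrite !(add0r, addr0).
- by rewrite !(add0r, addr0).
- by rewrite !(add0r, addr0).
Unshelve. all: by end_near. Qed.

End Wirtinger.

(** * Curvature and the second-order term of the metric *)

Section HermitianForm.
Context (R : realType) (n : nat).
Local Notation C := (Cplx R).
Implicit Types (G : 'M[C]_n) (v w : 'rV[C]_n).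

Lemma hprodE G v w : hprod G v w = \sum_b (v *m G) 0 b * (w 0 b)^*.
Proof.
rewrite /hprod exchange_big; apply: eq_bigr => b _.
by rewrite mxE mulr_suml; apply: eq_bigr => a _; rewrite [v 0 a * _]mulrC.
Qed.

Lemma hprodDl G u v w : hprod G (u + v) w = hprod G u w + hprod G v w.
Proof.
rewrite !hprodE -big_split; apply: eq_bigr => b _.
by rewrite mulmxDl mxE mulrDl.
Qed.

Lemma hprodDr G u v w : hprod G w (u + v) = hprod G w u + hprod G w v.
Proof.
rewrite !hprodE -big_split; apply: eq_bigr => b _.
by rewrite [(u + v) 0 b]mxE rmorphD mulrDr.
Qed.

Lemma hprodZl G a v w : hprod G (a *: v) w = a * hprod G v w.
Proof.
by rewrite !hprodE mulr_sumr; apply: eq_bigr => b _; rewrite -scalemxAl mxE mulrA.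
Qed.

Lemma hprodZr G a v w : hprod G w (a *: v) = a^* * hprod G w v.
Proof.
rewrite !hprodE mulr_sumr; apply: eq_bigr => b _.
by rewrite [(a *: v) 0 b]mxE rmorphM mulrCA.
Qed.

Lemma hprod0l G w : hprod G 0 w = 0.
Proof. by rewrite -(scale0r (0 : 'rV_n)) hprodZl mul0r. Qed.

Lemma hprod0r G w : hprod G w 0 = 0.
Proof. by rewrite -(scale0r (0 : 'rV_n)) hprodZr rmorph0 mul0r. Qed.

Lemma hprod_conj G v w : (forall a b, G b a = (G a b)^*) ->
  hprod G w v = (hprod G v w)^*.
Proof.
move=> hG; rewrite /hprod rmorph_sum exchange_big; apply: eq_bigr => a _.
rewrite rmorph_sum; apply: eq_bigr => b _; rewrite !rmorphM /= conjCK -hG; ring.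
Qed.

End HermitianForm.

Lemma exchange_big4 (V : nmodType) n (F : 'I_n -> 'I_n -> 'I_n -> 'I_n -> V) :
  \sum_p \sum_q \sum_c \sum_d F p q c d = \sum_c \sum_d \sum_p \sum_q F p q c d.
Proof.
transitivity (\sum_p \sum_c \sum_d \sum_q F p q c d).
  apply: eq_bigr => p _; rewrite exchange_big; apply: eq_bigr => c _.
  by rewrite exchange_big.
by rewrite exchange_big; apply: eq_bigr => c _; rewrite exchange_big.
Qed.

(** The definition of [curvature] contracted over c and d with a and b fixed: A holds the second
    derivatives of the metric, J its inverse, P and Q the first derivatives, and x, y the components
    X^a and conj Y^b. *)
Lemma curvature_contraction (K : comRingType) n (A : 'I_n -> 'I_n -> K)
    (J P Q : 'I_n -> 'I_n -> K) (x y : K) (Z Zb : 'I_n -> K) :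
  \sum_c \sum_d (- A c d + \sum_p \sum_q J q p * P c q * Q d p) * x * y * Z c * Zb d =
  - ((\sum_c \sum_d Z c * Zb d * A c d) * x * y) +
  (\sum_p \sum_q (\sum_c Z c * P c q) * J q p * (\sum_d Zb d * Q d p)) * x * y.
Proof.
have -> : \sum_p \sum_q (\sum_c Z c * P c q) * J q p * (\sum_d Zb d * Q d p) =
    \sum_p \sum_q \sum_c \sum_d Z c * P c q * J q p * (Zb d * Q d p).
  apply: eq_bigr => p _; apply: eq_bigr => q _; rewrite !mulr_suml.
  by apply: eq_bigr => c _; rewrite mulr_sumr.
rewrite exchange_big4 -!mulNr -sumrN -!mulrDl -big_split /= !mulr_suml.
apply: eq_bigr => c _; rewrite -sumrN -big_split /= !mulr_suml; apply: eq_bigr => d _.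
have -> : \sum_p \sum_q Z c * P c q * J q p * (Zb d * Q d p) =
   Z c * Zb d * \sum_p \sum_q J q p * P c q * Q d p.
  rewrite mulr_sumr; apply: eq_bigr => p _; rewrite mulr_sumr; apply: eq_bigr => q _.
  ring.
by move: (\sum_p _) => S; ring.
Qed.

Section CurvatureJet.
Context (R : realType) (n : nat).
Local Notation C := (Cplx R).
Context (U : set 'rV[C]_n) (G : 'rV[C]_n -> 'M[C]_n).
Context (oU : open U) (sG : forall a b, smooth_on U (fun w => G w a b)).
Context (hG : forall z a b, U z -> G z b a = (G z a b)^*).
Context (uG : forall z, U z -> G z \in unitmx).
Implicit Types (z X Y Z W : 'rV[C]_n).

(** The same sum as in [curv], for an arbitrary matrix-valued function on C^n, so that the
    computation can be carried out before manifolds enter; [curv x] unfolds to an instance of it. *)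
Definition curv_form (g : 'rV[C]_n -> 'M[C]_n) z X Y Z W : C :=
  \sum_a \sum_b \sum_c \sum_d
    curvature g z a b c d * X 0 a * (Y 0 b)^* * Z 0 c * (W 0 d)^*.

Lemma dzbar_metric z a b c : U z ->
  dzbar c (fun w => G w a b) z = (dz c (fun w => G w b a) z)^*.
Proof.
move=> Uz; rewrite -(dzbar_conj c (sG b a) Uz).
have E w : U w -> G w a b = (G w b a)^* by move=> Uw; exact: hG.
by rewrite (dzbar_ext c oU E (sG a b) Uz).
Qed.

Definition dmet z X (a b : 'I_n) : C := \sum_i X 0 i * dz i (fun w => G w a b) z.

(* The Christoffel term of the covariant derivative of [W] in the direction [X]. *)
Definition chris z X W : 'rV[C]_n :=
  (\row_q \sum_a dmet z X a q * W 0 a) *m invmx (G z).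

Lemma hprod_chrisl z X W Y : U z ->
  hprod (G z) (chris z X W) Y = \sum_a \sum_b dmet z X a b * W 0 a * (Y 0 b)^*.
Proof.
move=> Uz; rewrite hprodE /chris mulmxKV ?uG // exchange_big; apply: eq_bigr => b _.
by rewrite mxE mulr_suml.
Qed.

Lemma hprod_chrisr z X W Y : U z ->
  hprod (G z) Y (chris z X W) = \sum_a \sum_b (dmet z X b a)^* * Y 0 a * (W 0 b)^*.
Proof.
move=> Uz; rewrite (hprod_conj _ _ (fun a b => hG a b Uz)) hprod_chrisl // exchange_big.
rewrite rmorph_sum; apply: eq_bigr => a _; rewrite rmorph_sum; apply: eq_bigr => b _.
rewrite !rmorphM /= conjCK; ring.
Qed.

(** Two Christoffel vectors bring two inverse metrics and [hprod] brings one metric; the single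
    inverse left over is the one in the quadratic term of [curvature]. *)
Lemma curv_formE z X Y Z : U z -> curv_form G z X Y Z Z =
  - (\sum_a \sum_b (\sum_c \sum_d Z 0 c * (Z 0 d)^* * dz c (dzbar d (fun w => G w a b)) z)
        * X 0 a * (Y 0 b)^*)
  + hprod (G z) (chris z Z X) (chris z Z Y).
Proof.
move=> Uz.
have E b : \sum_p (dmet z Z b p)^* * chris z Z X 0 p * (Y 0 b)^* =
  \sum_a (\sum_p \sum_q dmet z Z a q * invmx (G z) q p *
     (\sum_d (Z 0 d)^* * dzbar d (fun w => G w p b) z)) * X 0 a * (Y 0 b)^*.
  under [RHS]eq_bigr do rewrite !mulr_suml.
  rewrite exchange_big; apply: eq_bigr => p _.
  rewrite /chris mxE mulr_sumr mulr_suml.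
  under [RHS]eq_bigr do rewrite !mulr_suml.
  rewrite [RHS]exchange_big; apply: eq_bigr => q _.
  rewrite mxE mulr_suml mulr_sumr mulr_suml; apply: eq_bigr => a _.
  have -> : \sum_d (Z 0 d)^* * dzbar d (fun w => G w p b) z = (dmet z Z b p)^*.
    rewrite rmorph_sum; apply: eq_bigr => d _.
    by rewrite rmorphM /= dzbar_metric.
  by rewrite [_ * X 0 a in RHS]mulrAC; ring.
have H : hprod (G z) (chris z Z X) (chris z Z Y) = \sum_a \sum_b
  (\sum_p \sum_q dmet z Z a q * invmx (G z) q p *
     (\sum_d (Z 0 d)^* * dzbar d (fun w => G w p b) z)) * X 0 a * (Y 0 b)^*.
  by rewrite hprod_chrisr // exchange_big (eq_bigr _ (fun b _ => E b)) exchange_big.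
rewrite {}H /curv_form -sumrN -big_split; apply: eq_bigr => a _.
rewrite -sumrN -big_split; apply: eq_bigr => b _.
exact: curvature_contraction.
Qed.

(** The product rule for the connection of a hermitian metric. Completing w and v to covariant
    derivatives creates a product of two Christoffel terms, and this is exactly what [curv_formE]
    separates from the second derivatives of the metric. The vector fields are differentiated along
    X, hence X fills the last two slots of the curvature. *)
Lemma jet_metric z X (del : C -> 'rV[C]_n) (W V : C -> 'rV[C]_n) (W0 w V0 v : 'rV[C]_n) :
  U z -> (forall i, jet (fun t => del t 0 i) 0 (X 0 i) 0 0) ->
  (forall i, jet (fun t => W t 0 i) (W0 0 i) (w 0 i) 0 0) ->
  (forall i, jet (fun t => V t 0 i) (V0 0 i) (v 0 i) 0 0) ->
  jet (fun t => hprod (G (z + del t)) (W t) (V t))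
    (hprod (G z) W0 V0) (hprod (G z) (w + chris z X W0) V0)
    (hprod (G z) W0 (v + chris z X V0))
    (- curv_form G z W0 V0 X X + hprod (G z) (w + chris z X W0) (v + chris z X V0)).
Proof.
move=> Uz jd jW jV.
have J a b := jetM (jetM (jet_comp oU (sG a b) Uz jd) (jW a)) (jet_conj (jV b)).
have r0 : (0 : C)^* = 0 := rmorph0 _.
apply: (jet_eq (jet_sum (fun a => jet_sum (fun b => J a b)))) => //.
- rewrite hprodDl hprod_chrisl // -big_split; apply: eq_bigr => a _.
  rewrite -big_split; apply: eq_bigr => b _; rewrite !r0 -/(dmet z X a b).
  by rewrite !mulr0 add0r mulrDl [_ * W0 0 a]mulrC.
- rewrite hprodDr hprod_chrisr // -big_split; apply: eq_bigr => a _.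
  rewrite -big_split; apply: eq_bigr => b _; rewrite mulr0 add0r; congr (_ + _ * _ * _).
  rewrite rmorph_sum; apply: eq_bigr => i _; by rewrite rmorphM /= dzbar_metric.
- rewrite hprodDl !hprodDr hprod_chrisl // hprod_chrisr // curv_formE //.
  set T := hprod (G z) (chris _ _ _) _; set S := \sum_a _.
  have -> : - (- S + T) + (hprod (G z) w v + \sum_a \sum_b (dmet z X b a)^* * w 0 a * (V0 0 b)^*
     + (\sum_a \sum_b dmet z X a b * W0 0 a * (v 0 b)^* + T)) =
     S + (hprod (G z) w v + \sum_a \sum_b (dmet z X b a)^* * w 0 a * (V0 0 b)^*
     + \sum_a \sum_b dmet z X a b * W0 0 a * (v 0 b)^*).
    move: S T (hprod _ _ _) (\sum_a _) (\sum_a _) => *; ring.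
  rewrite -!big_split; apply: eq_bigr => a _; rewrite -!big_split; apply: eq_bigr => b _ /=.
  rewrite !r0 -/(dmet z X a b).
  have -> : \sum_i (X 0 i)^* * dzbar i (fun w => G w a b) z = (dmet z X b a)^*.
    by rewrite rmorph_sum; apply: eq_bigr => d _; rewrite rmorphM /= dzbar_metric.
  move: (\sum_c _) (dmet z X a b) (dmet z X b a)^* (G z a b) (W0 0 a) (w 0 a) (V0 0 b)^* (v 0 b)^*.
  move=> *; ring.
Qed.

End CurvatureJet.

(** * Hermitian pencils *)

Section SimultaneousDiagonalization.
Context (R : realType).
Local Notation C := (Cplx R).

Lemma conj_ofR (t : R) : (ofR t)^* = ofR t :> C.
Proof. by apply/eqP; rewrite eq_complex /= oppr0 !eqxx. Qed.

Definition adj m n (A : 'M[C]_(m, n)) : 'M[C]_(n, m) := (map_mx Num.conj A)^T.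

Lemma adjM m n p (A : 'M[C]_(m, n)) (B : 'M[C]_(n, p)) : adj (A *m B) = adj B *m adj A.
Proof. by rewrite /adj map_mxM trmx_mul. Qed.

Lemma adjB m n (A B : 'M[C]_(m, n)) : adj (A - B) = adj A - adj B.
Proof. by rewrite /adj map_mxB raddfB. Qed.

Lemma adjK m n (A : 'M[C]_(m, n)) : adj (adj A) = A.
Proof. by apply/matrixP => a b; rewrite !mxE conjCK. Qed.

Definition herm_mx n (A : 'M[C]_n) := forall a b, A b a = (A a b)^*.
Definition posdef n (A : 'M[C]_n) := forall v, v != 0 -> 0 < complex.Re (hprod A v v).
Definition possemidef n (A : 'M[C]_n) := forall v, 0 <= complex.Re (hprod A v v).

Lemma hprod_mx n (A : 'M[C]_n) v w : hprod A v w = (v *m A *m adj w) 0 0.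
Proof. by rewrite hprodE mxE; apply: eq_bigr => b _; rewrite !mxE. Qed.

Lemma hprod_congr m n (H : 'M[C]_n) (J : 'M[C]_(m, n)) v w :
  hprod H (v *m J) (w *m J) = hprod (J *m H *m adj J) v w.
Proof. by rewrite !hprod_mx adjM !mulmxA. Qed.

Lemma hprod_rows m n (A : 'M[C]_n) (V : 'M[C]_(m, n)) a b :
  hprod A (row a V) (row b V) = (V *m A *m adj V) a b.
Proof.
rewrite !rowE hprod_congr hprodE -rowE (bigD1 b) //= [delta_mx _ _ _ _]mxE !eqxx rmorph1 mulr1.
rewrite mxE big1 ?addr0 // => c cb.
by rewrite [delta_mx _ _ _ _]mxE (negPf cb) andbF rmorph0 mulr0.
Qed.

Lemma hermitian_trmx n (A : 'M[C]_n) : herm_mx A <-> adj A = A.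
Proof.
split=> [h|h a b]; first by apply/matrixP => a b; rewrite !mxE -h.
by rewrite -{1}h !mxE.
Qed.

Lemma hermitian_congr m n (A : 'M[C]_n) (V : 'M[C]_(m, n)) :
  herm_mx A -> herm_mx (V *m A *m adj V).
Proof.
move=> /hermitian_trmx h; apply/hermitian_trmx.
by rewrite !adjM adjK h mulmxA.
Qed.

Lemma posdef_unit n (A : 'M[C]_n) : posdef A -> A \in unitmx.
Proof.
move=> pA; rewrite -row_free_unit -kermx_eq0; apply: contraT => /rowV0Pn[v].
move=> /sub_kermxP vA v0; have := pA v v0.
by rewrite hprod_mx vA mul0mx mxE ltxx.
Qed.

Lemma hermitian_spectral n (A : 'M[C]_n) : herm_mx A ->
  exists (P : 'M[C]_n) (d : 'I_n -> R),
    P *m adj P = 1%:M /\ P *m A *m adj P = diag_mx (\row_a ofR (d a)).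
Proof.
move=> hA; have hA' : A \is hermsymmx.
  by apply/is_hermitianmxP; rewrite expr0 scale1r -map_trmx; apply/esym/hermitian_trmx.
pose P := spectralmx A; have uP : P *m adj P = 1%:M.
  by rewrite /adj map_trmx; apply/unitarymxP; exact: spectral_unitarymx.
exists P, (fun a => complex.Re (spectral_diag A 0 a)); split=> //.
have /orthomx_spectralP E := hermitian_normalmx hA'.
rewrite {1}E -/P !mulmxA mulmxV ?spectral_unit // mul1mx -mulmxA uP mulmx1.
congr diag_mx; apply/rowP => a; rewrite !mxE.
have /mxOverP/(_ 0 a) := hermitian_spectral_diag_real hA'.
by move=> /RRe_real.
Qed.

(** Eigenvectors of G divided by the square roots of their eigenvalues give S with S G S^* = 1. The
    spectral theorem for S A S^* then supplies a unitary factor, which leaves that identity intact.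
    The rows of E form a G-unitary basis and d lists the eigenvalues of A relative to G. *)
Lemma simultaneous_diag n (G A : 'M[C]_n) : herm_mx G -> posdef G -> herm_mx A ->
  exists (E : 'M[C]_n) (d : 'I_n -> R),
    E *m G *m adj E = 1%:M /\ E *m A *m adj E = diag_mx (\row_a ofR (d a)).
Proof.
move=> hG pG hA; have [P [d [uP dP]]] := hermitian_spectral hG.
have d0 a : 0 < d a.
  have := pG (row a P); rewrite hprod_rows dP !mxE eqxx mulr1n /=; apply.
  apply/eqP => ra; have : (P *m 1%:M *m adj P) a a = 1%:M a a by rewrite mulmx1 uP.
  rewrite -hprod_rows ra hprod0l mxE eqxx => /eqP.
  by rewrite eq_sym oner_eq0.
pose S := diag_mx (\row_a ofR (Num.sqrt (d a))^-1) *m P.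
have sG : S *m G *m adj S = 1%:M.
  rewrite /S adjM !mulmxA -2!(mulmxA (diag_mx _)) dP /adj map_diag_mx tr_diag_mx !mulmx_diag -diag_const_mx.
  congr diag_mx; apply/rowP => a; rewrite !mxE.
  have s0 : Num.sqrt (d a) != 0 by rewrite gt_eqF // sqrtr_gt0.
  rewrite [X in _ * X](conj_ofR _) -!ofRM -ofR1 -[X in _ * X * _](sqr_sqrtr (ltW (d0 a))) expr2.
  by congr ofR; field; exact: s0.
clearbody S; have [P1 [d1 [uP1 dP1]]] := hermitian_spectral (hermitian_congr S hA).
exists (P1 *m S), d1; rewrite !adjM; split.
  transitivity (P1 *m (S *m G *m adj S) *m adj P1); first by rewrite !mulmxA.
  by rewrite sG mulmx1.
by rewrite -dP1 !mulmxA.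
Qed.

Section DiagonalPair.
Context (n : nat) (G A E : 'M[C]_n) (d : 'I_n -> R).
Hypothesis dG : E *m G *m adj E = 1%:M.
Hypothesis dA : E *m A *m adj E = diag_mx (\row_a ofR (d a)).

Lemma diag_hprod_basis a b : hprod G (row a E) (row b E) = (a == b)%:R.
Proof. by rewrite hprod_rows dG mxE. Qed.

Lemma diag_hprod_basisA a b : hprod A (row a E) (row b E) = (a == b)%:R * ofR (d a).
Proof. by rewrite hprod_rows dA !mxE mulr_natl. Qed.

Lemma diag_unit : E \in unitmx.
Proof. by move: dG; rewrite -mulmxA => /mulmx1_unit []. Qed.

Lemma diag_hprodG v : hprod G v v = \sum_a ofR (cn ((v *m invmx E) 0 a) ^+ 2).
Proof.
rewrite -{1 2}(mulmxKV diag_unit v) hprod_congr dG hprodE mulmx1.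
by apply: eq_bigr => a _; rewrite -normCK normcn expr2 -ofRM -expr2.
Qed.

Lemma diag_hprodA v : hprod A v v = \sum_a ofR (d a * cn ((v *m invmx E) 0 a) ^+ 2).
Proof.
rewrite -{1 2}(mulmxKV diag_unit v) hprod_congr dA hprodE.
apply: eq_bigr => a _; rewrite mul_mx_diag mxE [X in _ * X * _]mxE mulrAC -normCK normcn.
by rewrite expr2 -!ofRM -expr2 mulrC.
Qed.

Lemma diag_invmx : invmx G = adj E *m E.
Proof.
have h : (adj E *m E) *m G = 1%:M.
  by apply: mulmx1C; rewrite mulmxA; apply: mulmx1C; rewrite mulmxA.
have [_ uG] := mulmx1_unit h.
by rewrite -[LHS]mul1mx -h mulmxK.
Qed.

Lemma diag_trace : \tr (invmx G *m A) = \sum_a ofR (d a).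
Proof.
rewrite diag_invmx -mulmxA mxtrace_mulC dA mxtrace_diag.
by apply: eq_bigr => a _; rewrite mxE.
Qed.

End DiagonalPair.

Lemma mxtrace_psd n m (A : 'M[C]_n) (B : 'M[C]_(m, n)) :
  possemidef A -> 0 <= complex.Re (\tr (B *m A *m adj B)).
Proof.
move=> pA; rewrite /mxtrace raddf_sum; apply: sumr_ge0 => a _.
by rewrite -hprod_rows; exact: pA.
Qed.

(* (G^-1 - V^*V) G (G^-1 - V^*V) is positive semidefinite. *)
Lemma mxtrace_invmx_ge n (G A V : 'M[C]_n) : herm_mx G -> posdef G -> possemidef A ->
  complex.Re (2 * \tr (V *m A *m adj V) - \tr ((V *m G *m adj V) *m (V *m A *m adj V)))
  <= complex.Re (\tr (invmx G *m A)).
Proof.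
move=> hG pG pA; have [E [d [dG _]]] := simultaneous_diag hG pG hG.
have uG := posdef_unit pG; have uE := diag_unit dG.
have [W WE] : exists W, W = adj V *m V by exists (adj V *m V).
have [T TE] : exists T, T = invmx G - W by exists (invmx G - W).
have hW : adj W = W by rewrite WE adjM adjK.
have hI : adj (invmx G) = invmx G by rewrite (diag_invmx dG) adjM adjK.
have hT : adj T = T by rewrite TE adjB hI hW.
have GE : G = invmx E *m adj (invmx E).
  have h : adj (invmx E) = invmx (adj E).
    by rewrite /adj map_invmx trmx_inv.
  have uE' : adj E \in unitmx by rewrite /adj unitmx_tr map_unitmx.
  rewrite h -[invmx E]mulmx1 -dG -!mulmxA mulmxV // mulmx1 mulmxA mulVmx //.
  by rewrite mul1mx.
(* With T = G^-1 - V^* V and G factored through E, the nonnegative trace obtained here equals tr(T G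
   T A) by cyclicity; expanding T G T gives the claim. *)
have := mxtrace_psd (adj (invmx E) *m T) pA.
rewrite adjM adjK hT.
have -> : \tr (adj (invmx E) *m T *m A *m (T *m invmx E)) =
  \tr (invmx G *m A) - (2 * \tr (V *m A *m adj V) - \tr ((V *m G *m adj V) *m (V *m A *m adj V))).
  rewrite mxtrace_mulC.
  have -> : T *m invmx E *m (adj (invmx E) *m T *m A) = T *m G *m T *m A.
    by rewrite [in RHS]GE !mulmxA.
  have -> : T *m G *m T = invmx G - W - W + W *m G *m W.
    rewrite TE mulmxBl mulVmx // mulmxBl mul1mx mulmxBr (mulmxK uG).
    by rewrite opprB addrA addrAC.
  have tW : \tr (V *m A *m adj V) = \tr (W *m A) by rewrite WE mxtrace_mulC mulmxA.
  have tWW : \tr ((V *m G *m adj V) *m (V *m A *m adj V)) = \tr (W *m G *m W *m A).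
    by rewrite WE !mulmxA mxtrace_mulC !mulmxA.
  rewrite tW tWW !mulmxDl !mulNmx !raddfD /= !raddfN /=.
  by move: (\tr _) (\tr _) (\tr _) => x y z; ring.
by rewrite raddfB /= subr_ge0.
Qed.



End SimultaneousDiagonalization.

(** * Royden's averaging argument *)

Section Royden.
Context (R : realType) (n : nat).
Local Notation C := (Cplx R).
Context (G : 'M[C]_n) (Q : 'rV[C]_n -> 'rV[C]_n -> 'rV[C]_n -> 'rV[C]_n -> C).
Context (kappa : R).
Implicit Types (x y z b c d : 'rV[C]_n) (s : seq 'rV[C]_n).
Hypothesis hG : herm_mx G.
Hypothesis pG : possemidef G.
Hypothesis QD1 : forall x y b c d, Q (x + y) b c d = Q x b c d + Q y b c d.
Hypothesis QZ1 : forall a x b c d, Q (a *: x) b c d = a * Q x b c d.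
Hypothesis QD2 : forall x y b c d, Q b (x + y) c d = Q b x c d + Q b y c d.
Hypothesis QZ2 : forall a x b c d, Q b (a *: x) c d = a^* * Q b x c d.
Hypothesis Q13 : forall x b c d, Q x b c d = Q c b x d.
Hypothesis Q24 : forall x b c d, Q x b c d = Q x d c b.

(** For a tensor Q with the Kaehler symmetries [Q13] and [Q24] this is the holomorphic bisectional
    curvature, and [Qle] bounds the holomorphic sectional curvature from above. *)
Definition bisec x y : R := complex.Re (Q x x y y).
Definition nsq x : R := complex.Re (hprod G x x).

Hypothesis k0 : 0 <= kappa.
Hypothesis Qle : forall x, bisec x x <= kappa * nsq x ^+ 2.

Lemma bisec_sym x y : bisec x y = bisec y x.
Proof. by rewrite /bisec Q13 Q24. Qed.

(** Choosing y in one of the slots 1, 3 and in one of the slots 2, 4 gives four terms that the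
    symmetries identify; this is the origin of the coefficient 4 of |e|^2 Q(x, x, y, y). *)
Lemma Q_expand4 (e : C) x y : let u := x + e *: y in
  Q u u u u = Q x x x x + 2 * e * Q y x x x + 2 * e^* * Q x y x x
    + e * e * Q y x y x + e^* * e^* * Q x y x y + 4 * (e * e^*) * Q x x y y
    + 2 * (e * e * e^*) * Q y y y x + 2 * (e * e^* * e^*) * Q y y x y
    + e * e * e^* * e^* * Q y y y y.
Proof.
have D3 p q a b c : Q a b (p + q) c = Q a b p c + Q a b q c by rewrite Q13 QD1 Q13 (Q13 q).
have Z3 k p a b c : Q a b (k *: p) c = k * Q a b p c by rewrite Q13 QZ1 Q13.
have D4 p q a b c : Q a b c (p + q) = Q a b c p + Q a b c q by rewrite Q24 QD2 Q24 (Q24 _ q).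
have Z4 k p a b c : Q a b c (k *: p) = k^* * Q a b c p by rewrite Q24 QZ2 Q24.
move=> /=; rewrite !(QD1, QD2, D3, D4) !(QZ1, QZ2, Z3, Z4).
have e1 : Q x x y x = Q y x x x by rewrite Q13.
have e2 : Q x x x y = Q x y x x by rewrite Q24.
have e3 : Q y x x y = Q x x y y by rewrite Q13.
have e4 : Q x y y x = Q x x y y by rewrite Q24.
have e5 : Q y y x x = Q x x y y by rewrite Q13.
have e6 : Q y x y y = Q y y y x by rewrite Q24.
have e7 : Q x y y y = Q y y x y by rewrite Q13.
rewrite e1 e2 e3 e4 e5 e6 e7.
move: (e^*) (Q x x x x) (Q y x x x) (Q x y x x) (Q y x y x) (Q x y x y) (Q x x y y).
move: (Q y y y x) (Q y y x y) (Q y y y y) => *; ring.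
Qed.

Lemma Q_expand2 (e : C) x y z : let u := x + e *: y in
  Q u u z z = Q x x z z + e * Q y x z z + e^* * Q x y z z + e * e^* * Q y y z z.
Proof.
rewrite /= !QD1 !QD2 !QZ1 !QZ2.
by move: (e^*) (Q x x z z) (Q y x z z) (Q x y z z) (Q y y z z) => *; ring.
Qed.

Lemma imag2 : imag R * imag R = -1.
Proof. by rewrite -expr2 sqr_i. Qed.

(** The two roots 1 and -1 would leave the terms in e^2 and its conjugate; all four roots of unity
    are required to remove them. What survives are the terms with as many factors e as
    conjugates. *)
Lemma root4_average (F : C -> C) (q1 q2 q3 q4 q5 q6 q7 q8 q9 : C) :
  (forall e, F e = q1 + 2 * e * q2 + 2 * e^* * q3
    + e * e * q4 + e^* * e^* * q5 + 4 * (e * e^*) * q6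
    + 2 * (e * e * e^*) * q7 + 2 * (e * e^* * e^*) * q8
    + e * e * e^* * e^* * q9) ->
  complex.Re (F 1) + complex.Re (F (-1)) + (complex.Re (F (imag R)) + complex.Re (F (- imag R)))
  = 4 * (complex.Re q1 + complex.Re q9 + 4 * complex.Re q6).
Proof.
move=> H; rewrite -[RHS]/(4%:R * (complex.Re q1 + complex.Re q9 + 4%:R * complex.Re q6)).
rewrite !mulr_natl -!raddfMn -!raddfD -raddfMn; congr complex.Re; move: H.
move=> H; rewrite !H.
have cm : (-1 : C)^* = -1 by apply/eqP; rewrite eq_complex /= !oppr0 !eqxx.
have cn : (- imag R)^* = imag R by apply/eqP; rewrite eq_complex /= !opprK oppr0 !eqxx.
rewrite rmorph1 cm cn conj_imag.
have := imag2; move: (imag R) => i ii.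
transitivity (4 * q1 + 2 * (1 + i * i) * q4 + 2 * (1 + i * i) * q5 + 8 * (1 - i * i) * q6
  + 2 * (1 + (i * i) * (i * i)) * q9); first by ring.
by rewrite ii; ring.
Qed.

Lemma bisec_avg4 x y (q := fun e : C => bisec (x + e *: y) (x + e *: y)) :
  q 1 + q (-1) + (q (imag R) + q (- imag R)) = 4 * (bisec x x + bisec y y + 4 * bisec x y).
Proof. exact: (root4_average (fun e => Q_expand4 e x y)). Qed.

Lemma bisec_avg2 x y z (q := fun e : C => bisec (x + e *: y) z) :
  q 1 + q (-1) + (q (imag R) + q (- imag R)) = 4 * (bisec x z + bisec y z).
Proof.
(* The quadratic expansion is fitted into the quartic template: dividing by 2 and by 4 undoes the
   numerical factors written there. *)
have := @root4_average (fun e => Q (x + e *: y) (x + e *: y) z z) (Q x x z z) (Q y x z z / 2)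
  (Q x y z z / 2) 0 0 (Q y y z z / 4) 0 0 0.
have -> : complex.Re (Q y y z z / 4) = bisec y z / 4.
  have -> : (4^-1 : C) = ofR 4^-1 by rewrite /ofR fmorphV rmorph_nat.
  by rewrite /bisec; case: (Q y y z z) => a b /=; ring.
move=> E; rewrite {}/q [LHS]E.
  by rewrite addr0 [4 * (bisec y z / 4)]mulrC divfK // pnatr_eq0.
by move=> e; rewrite Q_expand2; field.
Qed.

(** Each diagonal term counts once and each unordered pair four times: the weights produced by
    averaging. In the full double sum an unordered pair would count twice. *)
Fixpoint bisec_pairs s : R :=
  if s is y :: s' then bisec y y + 4 * (\sum_(z <- s') bisec y z) + bisec_pairs s' else 0.

Lemma nsq_orth x y (e : C) : e * e^* = 1 -> hprod G x y = 0 ->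
  nsq (x + e *: y) = nsq x + nsq y.
Proof.
move=> e1 xy; rewrite /nsq -raddfD; congr complex.Re.
have yx : hprod G y x = 0 by rewrite (hprod_conj x y hG) xy rmorph0.
rewrite hprodDl !hprodDr !hprodZl !hprodZr xy yx !mulr0 addr0 add0r.
by rewrite mulrA e1 mul1r.
Qed.

Lemma sum_add4 (K I : Type) (r : seq I) (F : K -> I -> R) (T : I -> R) (e1 e2 e3 e4 : K) :
  (forall i, F e1 i + F e2 i + (F e3 i + F e4 i) = T i) ->
  \sum_(i <- r) F e1 i + \sum_(i <- r) F e2 i + (\sum_(i <- r) F e3 i + \sum_(i <- r) F e4 i)
  = \sum_(i <- r) T i.
Proof. by move=> H; rewrite -!big_split; apply: eq_bigr => i _; exact: H. Qed.

Lemma average4_le (K : Type) (f g : K -> R) (e1 e2 e3 e4 : K) (p u a b c a' b' : R) :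
  (forall e, e = e1 \/ e = e2 \/ e = e3 \/ e = e4 -> f e + 4 * g e + p <= u) ->
  f e1 + f e2 + (f e3 + f e4) = 4 * (a + b + 4 * c) ->
  g e1 + g e2 + (g e3 + g e4) = 4 * (a' + b') ->
  a + 4 * (c + a') + (b + 4 * b' + p) <= u.
Proof.
move=> H A B; have h1 := H e1 (or_introl erefl).
have h2 := H e2 (or_intror (or_introl erefl)).
have h3 := H e3 (or_intror (or_intror (or_introl erefl))).
have h4 := H e4 (or_intror (or_intror (or_intror erefl))).
lra.
Qed.

(* Averaging over [X + e y] with [e] a fourth root of unity. *)
Lemma bisec_pairs_le s x :
  pairwise (fun y z => hprod G y z == 0) s -> all (fun z => hprod G x z == 0) s ->
  bisec x x + 4 * (\sum_(z <- s) bisec x z) + bisec_pairs s <=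
  kappa * (nsq x + \sum_(z <- s) nsq z) ^+ 2.
Proof.
(* The head y is absorbed into x, replaced by x + e y. This vector stays orthogonal to the remaining
   ones, and its square norm is |x|^2 + |y|^2 for every unimodular e, so averaging does not alter
   the right-hand side. *)
elim: s x => [|y s IH] x /=.
  by move=> _ _; rewrite !big_nil mulr0 !addr0; exact: Qle.
move=> /andP[ys ps] /andP[/eqP xy xs].
have step (e : C) : e * e^* = 1 ->
   bisec (x + e *: y) (x + e *: y) + 4 * (\sum_(z <- s) bisec (x + e *: y) z) + bisec_pairs s <=
   kappa * (nsq x + (nsq y + \sum_(z <- s) nsq z)) ^+ 2.
  move=> e1; rewrite addrA -(nsq_orth e1 xy); apply: IH => //.
  apply/allP => z zs; rewrite hprodDl hprodZl.
  by rewrite (eqP (allP xs z zs)) (eqP (allP ys z zs)) mulr0 addr0.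
have ci : imag R * (imag R)^* = 1 by rewrite conj_imag mulrN imag2 opprK.
have cn : - imag R * (- imag R)^* = 1.
  have -> : (- imag R)^* = imag R by apply/eqP; rewrite eq_complex /= !opprK oppr0 !eqxx.
  by rewrite mulNr imag2 opprK.
have cm : -1 * (-1 : C)^* = 1.
  have -> : (-1 : C)^* = -1 by apply/eqP; rewrite eq_complex /= !oppr0 !eqxx.
  by rewrite mulrNN mulr1.
have c1 : 1 * (1 : C)^* = 1 by rewrite rmorph1 mulr1.
rewrite !big_cons; apply: (average4_le (f := fun e : C => bisec (x + e *: y) (x + e *: y))
  (g := fun e : C => \sum_(z <- s) bisec (x + e *: y) z) _ (bisec_avg4 x y)).
  by move=> e [->|[->|[->|->]]]; exact: step.
have := sum_add4 s (fun z => bisec_avg2 x y z).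
by rewrite -mulr_sumr big_split.
Qed.

(** With D the diagonal sum and P the sum over unordered pairs, the double sum is D + 2 P and
    [bisec_pairs] is D + 4 P. *)
Lemma bisec_pairs_double s :
  2 * (\sum_(y <- s) \sum_(z <- s) bisec y z) =
  bisec_pairs s + \sum_(y <- s) bisec y y.
Proof.
elim: s => [|y s IH] /=; first by rewrite !big_nil mulr0 addr0.
rewrite !big_cons (eq_bigr _ (fun i _ => big_cons _ _ _ _ _ _)) /= big_split /=.
have -> : \sum_(z <- s) bisec z y = \sum_(z <- s) bisec y z.
  by apply: eq_bigr => z _; exact: bisec_sym.
move: IH; move: (\sum_(z <- s) bisec y z) (\sum_(y <- s) _) (\sum_(y <- s) _) (bisec_pairs s).
move=> a b c d; lra.
Qed.

Lemma sum_sqr_le (I : Type) (r : seq I) (F : I -> R) : (forall i, 0 <= F i) ->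
  \sum_(i <- r) F i ^+ 2 <= (\sum_(i <- r) F i) ^+ 2.
Proof.
move=> F0; elim: r => [|i r IH]; first by rewrite !big_nil expr0n.
rewrite !big_cons; have S0 : 0 <= \sum_(i <- r) F i by apply: sumr_ge0.
apply: (le_trans (lerD (lexx _) IH)); have := mulr_ge0 (F0 i) S0.
by rewrite sqrrD; lra.
Qed.

(** Twice the double sum is [bisec_pairs] plus the diagonal. The first is bounded by averaging,
    started at the zero vector; the second by the sum of the |Y_a|^4, which is at most the square of
    the sum of the |Y_a|^2. As kappa is nonnegative, both are at most kappa times that square. *)
Lemma royden m (Y : 'I_m -> 'rV[C]_n) :
  (forall i j : 'I_m, i != j -> hprod G (Y i) (Y j) = 0) ->
  \sum_a \sum_b bisec (Y a) (Y b) <= kappa * (\sum_a nsq (Y a)) ^+ 2.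
Proof.
move=> orth; pose s := [seq Y a | a <- index_enum 'I_m].
have E (F : 'rV[C]_n -> R) : \sum_a F (Y a) = \sum_(y <- s) F y by rewrite big_map.
have -> : \sum_a \sum_b bisec (Y a) (Y b) = \sum_(y <- s) \sum_(z <- s) bisec y z.
  by rewrite -E; apply: eq_bigr => a _; rewrite E.
rewrite (E nsq).
have ps : pairwise (fun y z => hprod G y z == 0) s.
  rewrite pairwise_map; have : uniq (index_enum 'I_m) by exact: index_enum_uniq.
  by rewrite uniq_pairwise; apply: sub_pairwise => a b /= ab; apply/eqP/orth.
have x0 : all (fun z => hprod G 0 z == 0) s by apply/allP => z _; rewrite hprod0l.
have := bisec_pairs_le ps x0.
have q0 z : bisec 0 z = 0 by rewrite /bisec -(scale0r (0 : 'rV_n)) QZ1 mul0r.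
have n0 : nsq 0 = 0 by rewrite /nsq hprod0l.
rewrite q0 (eq_bigr _ (fun i _ => q0 i)) big1_eq mulr0 n0 !add0r => h1.
have h2 : \sum_(y <- s) bisec y y <= kappa * (\sum_(y <- s) nsq y) ^+ 2.
  apply: le_trans (ler_wpM2l k0 (sum_sqr_le s (pG : forall y, 0 <= nsq y))).
  by rewrite mulr_sumr; apply: ler_sum => y _; exact: Qle.
have := bisec_pairs_double s; move: h1 h2.
move: (bisec_pairs s) (\sum_(y <- s) bisec y y) (\sum_(y <- s) _) (kappa * _) => *; lra.
Qed.

End Royden.

(** * Kaehler symmetries of the curvature tensor *)

Section CurvatureSymmetry.
Context (R : realType) (n : nat).
Local Notation C := (Cplx R).

Lemma exchange_big13 (V : nmodType) (F : 'I_n -> 'I_n -> 'I_n -> V) :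
  \sum_a \sum_b \sum_c F a b c = \sum_a \sum_b \sum_c F c b a.
Proof.
rewrite exchange_big [RHS]exchange_big; apply: eq_bigr => b _.
by rewrite exchange_big.
Qed.

Section Multilinear.
Context (g : 'rV[C]_n -> 'M[C]_n) (z : 'rV[C]_n).
Implicit Types (x y b c d : 'rV[C]_n).

Lemma curv_formD1 x y b c d :
  curv_form g z (x + y) b c d = curv_form g z x b c d + curv_form g z y b c d.
Proof.
rewrite /curv_form -big_split; apply: eq_bigr => i _; rewrite -big_split; apply: eq_bigr => j _.
rewrite -big_split; apply: eq_bigr => k _; rewrite -big_split; apply: eq_bigr => l _.
by rewrite [(x + y) 0 i]mxE mulrDr !mulrDl.
Qed.

Lemma curv_formZ1 a x b c d : curv_form g z (a *: x) b c d = a * curv_form g z x b c d.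
Proof.
rewrite /curv_form mulr_sumr; apply: eq_bigr => i _; rewrite mulr_sumr; apply: eq_bigr => j _.
rewrite mulr_sumr; apply: eq_bigr => k _; rewrite mulr_sumr; apply: eq_bigr => l _.
by rewrite [(a *: x) 0 i]mxE mulrCA !mulrA.
Qed.

Lemma curv_formD2 x y b c d :
  curv_form g z b (x + y) c d = curv_form g z b x c d + curv_form g z b y c d.
Proof.
rewrite /curv_form -big_split; apply: eq_bigr => i _; rewrite -big_split; apply: eq_bigr => j _.
rewrite -big_split; apply: eq_bigr => k _; rewrite -big_split; apply: eq_bigr => l _.
by rewrite [(x + y) 0 j]mxE rmorphD mulrDr !mulrDl.
Qed.

Lemma curv_formZ2 a x b c d : curv_form g z b (a *: x) c d = a^* * curv_form g z b x c d.
Proof.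
rewrite /curv_form mulr_sumr; apply: eq_bigr => i _; rewrite mulr_sumr; apply: eq_bigr => j _.
rewrite mulr_sumr; apply: eq_bigr => k _; rewrite mulr_sumr; apply: eq_bigr => l _.
by rewrite [(a *: x) 0 j]mxE rmorphM mulrCA !mulrA.
Qed.

End Multilinear.

Context (U : set 'rV[C]_n) (G : 'rV[C]_n -> 'M[C]_n).
Hypothesis oU : open U.
Hypothesis sG : forall a b, smooth_on U (fun w => G w a b).
Hypothesis hG : forall z a b, U z -> G z b a = (G z a b)^*.
Hypothesis closed_G : forall z a b c, U z ->
  dz c (fun w => G w a b) z = dz a (fun w => G w c b) z.

(** Closedness exchanges a and c in the first derivatives. For the second derivatives, [dz c] is
    first commuted inside [dzbar d], and closedness is then used on the whole open set before
    differentiating. *)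
Lemma curvature13 z a b c d : U z -> curvature G z a b c d = curvature G z c b a d.
Proof.
move=> Uz; have E1 : dz c (dzbar d (fun w => G w a b)) z = dz a (dzbar d (fun w => G w c b)) z.
  apply: (eq_trans (dz_dzbar c d oU (sG a b) Uz)).
  apply: (eq_trans _ (esym (dz_dzbar a d oU (sG c b) Uz))).
  exact: (dzbar_ext d oU (fun w Uw => esym (closed_G a b c Uw)) (smooth_dz a oU (sG c b)) Uz).
apply: (congr2 (fun x y => - x + y) E1).
by apply: eq_bigr => p _; apply: eq_bigr => q _; rewrite (closed_G a q c Uz).
Qed.

Lemma dzbar_closed z a b d : U z ->
  dzbar d (fun w => G w a b) z = dzbar b (fun w => G w a d) z.
Proof.
move=> Uz; rewrite (dzbar_metric oU sG hG a b d Uz) (dzbar_metric oU sG hG a d b Uz).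
by rewrite (closed_G b a d Uz).
Qed.

Lemma curvature24 z a b c d : U z -> curvature G z a b c d = curvature G z a d c b.
Proof.
move=> Uz; have E1 : dz c (dzbar d (fun w => G w a b)) z = dz c (dzbar b (fun w => G w a d)) z.
  exact: (dz_ext c oU (fun w Uw => esym (dzbar_closed a b d Uw)) (smooth_dzbar b oU (sG a d)) Uz).
apply: (congr2 (fun x y => - x + y) E1).
by apply: eq_bigr => p _; apply: eq_bigr => q _; rewrite (dzbar_closed p b d Uz).
Qed.

Lemma curv_form13 z x b c d : U z -> curv_form G z x b c d = curv_form G z c b x d.
Proof.
move=> Uz; rewrite /curv_form exchange_big13.
apply: eq_bigr => i _; apply: eq_bigr => j _; apply: eq_bigr => k _; apply: eq_bigr => l _.
rewrite (curvature13 k j i l Uz).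
move: (curvature _ _ _ _ _ _) (x 0 k) (b 0 j)^* (c 0 i) (d 0 l)^* => *; ring.
Qed.

Lemma curv_form24 z x b c d : U z -> curv_form G z x b c d = curv_form G z x d c b.
Proof.
move=> Uz; rewrite /curv_form; apply: eq_bigr => i _.
rewrite exchange_big13.
apply: eq_bigr => j _; apply: eq_bigr => k _; apply: eq_bigr => l _.
rewrite (curvature24 i l k j Uz).
move: (curvature _ _ _ _ _ _) (x 0 i) (b 0 l)^* (c 0 k) (d 0 j)^* => *; ring.
Qed.

End CurvatureSymmetry.

(** * Second-order inequalities at a maximum *)

Section HolomorphicJets.
Context (R : realType) (m n : nat).
Local Notation C := (Cplx R).
Context (O : set 'rV[C]_m) (F : 'rV[C]_m -> 'rV[C]_n).
Hypothesis oO : open O.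
Hypothesis hF : holomorphic_on O F.
Implicit Types (z v : 'rV[C]_m).

Lemma delta_mulmx (A : 'M[C]_(m, n)) a k : ((delta_mx 0 a : 'rV[C]_m) *m A) 0 k = A a k.
Proof. by rewrite -rowE mxE. Qed.

Lemma imag_delta_mulmx (A : 'M[C]_(m, n)) a k :
  ((imag R *: (delta_mx 0 a : 'rV[C]_m)) *m A) 0 k = imag R * A a k.
Proof. by rewrite -scalemxAl -rowE !mxE. Qed.

Lemma half_sub_imag (x : C) : 2^-1 * (x - imag R * (imag R * x)) = x.
Proof.
have -> : imag R * (imag R * x) = - x by rewrite (mulrA (imag R)) imag2 mulN1r.
by rewrite opprK; field.
Qed.

Lemma half_add_imag (x : C) : 2^-1 * (x + imag R * (imag R * x)) = 0.
Proof. by rewrite (mulrA (imag R)) imag2 mulN1r subrr mulr0. Qed.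

(** The complex difference quotient is restricted to real increments. Since the Jacobian acts
    complex linearly on v, the derivative along i v is i times the one along v; [dz_holomorphic] and
    [dzbar_holomorphic] are then immediate. *)
Lemma isD_holomorphic z v k : O z -> isD (fun w => F w 0 k) v z ((v *m 'J F z) 0 k).
Proof.
move=> Oz; have dF := hF.2 z Oz.
have : (fun h : C => h^-1 *: (F (h *: v + z) - F z)) @ 0^' --> 'D_v F z.
  exact: (diff_derivable (v := v) dF).
rewrite (deriveEjacobian v dF); set L := v *m _ => /cvg_ballP cv.
have near_quot (e : R) : 0 < e -> \forall t \near (0 : R)^',
    cn (L 0 k - ofR t^-1 * (F (z + ofR t *: v) 0 k - F z 0 k)) < e.
  move=> e0; have := cv (ofR e); rewrite -ofR0 ofR_lt => /(_ e0).
  rewrite !near_withinE => /nbhs_ballP[d /= d0 hd].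
  have d1 : 0 < cn d by rewrite lt_neqAle cn_ge0 eq_sym cn_eq0 gt_eqF.
  apply/nbhs_normP; exists (cn d) => // t /=; rewrite sub0r normrN => td t0.
  have := hd (ofR t); rewrite /ball /= sub0r normrN normcn cn_ofR -(gtr0_norm d0) normcn ofR_lt.
  move=> /(_ td); have t0' : ofR t != 0 by rewrite -cn_eq0 cn_ofR normr_eq0.
  move=> /(_ t0') [_ /(_ 0 k)]; rewrite /ball /= normcn ofR_lt !mxE.
  by rewrite (addrC _ z) /ofR fmorphV.
split; apply/is_deriveP.
  apply/cvgrPdist_lt => e e0; apply: filterS (near_quot e e0) => t; apply: le_lt_trans.
  apply: le_trans (normRe_le_cn _); rewrite addr0 raddfB /=.
  have -> (x : C) : complex.Re (ofR t^-1 * x) = t^-1 * complex.Re x by case: x => a b /=; ring.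
  by rewrite raddfB /= ofR0 scale0r addr0.
apply/cvgrPdist_lt => e e0; apply: filterS (near_quot e e0) => t; apply: le_lt_trans.
apply: le_trans (Im_le_cn _); rewrite addr0 raddfB /=.
have -> (x : C) : complex.Im (ofR t^-1 * x) = t^-1 * complex.Im x by case: x => a b /=; ring.
by rewrite raddfB /= ofR0 scale0r addr0.
Qed.

Lemma real_derive_holomorphic z v k : O z ->
  real_derive (fun w => F w 0 k) v z = (v *m 'J F z) 0 k.
Proof. by move=> Oz; have /isD_val[] := isD_holomorphic v k Oz. Qed.

Lemma dz_holomorphic z a k : O z -> dz a (fun w => F w 0 k) z = 'J F z a k.
Proof.
move=> Oz; rewrite /dz !(real_derive_holomorphic _ _ Oz) !delta_mulmx imag_delta_mulmx.
exact: half_sub_imag.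
Qed.

Lemma dzbar_holomorphic z a k : O z -> dzbar a (fun w => F w 0 k) z = 0.
Proof.
move=> Oz; rewrite /dzbar !(real_derive_holomorphic _ _ Oz) !delta_mulmx imag_delta_mulmx.
exact: half_add_imag.
Qed.

Lemma smooth_jacobian a k : smooth_on O (fun w => 'J F w a k).
Proof.
apply: (smooth_ext oO _ (smooth_dz a oO (hF.1 k))) => z Oz.
exact: dz_holomorphic.
Qed.

Lemma dzbar_jacobian z a b k : O z -> dzbar b (fun w => 'J F w a k) z = 0.
Proof.
move=> Oz; have S := smooth_dz a oO (hF.1 k).
rewrite (dzbar_ext b oO (fun w Ow => dz_holomorphic a k Ow) S Oz).
rewrite -(dz_dzbar a b oO (hF.1 k) Oz).
have E w : O w -> dzbar b (fun u => F u 0 k) w = (fun=> 0) w.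
  by move=> Ow; exact: dzbar_holomorphic.
have := dz_ext a oO E (smooth_dzbar b oO (hF.1 k)) Oz.
move=> <-; rewrite /dz.
have D v := (isD_val (isD_cst (0 : C) v z)).2.
by rewrite !D mulr0 subrr mulr0.
Qed.

Lemma jet_scale_id (c : C) : jet (fun t => t * c) 0 c 0 0.
Proof.
by apply: (jet_eq (jetM (@jet_id R) (jet_cst c))); rewrite ?(mul0r, mulr0, mul1r, addr0, add0r).
Qed.

Lemma jet_line z v i : jet (fun t : C => (t *: v) 0 i) 0 (v 0 i) 0 0.
Proof. by apply: (jet_ext _ (jet_scale_id (v 0 i))) => t; rewrite mxE. Qed.

Lemma dz0 (U : set 'rV[C]_m) (h : 'rV[C]_m -> C) z a : open U -> U z ->
  smooth_on U h -> (forall w, U w -> h w = 0) -> dz a h z = 0.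
Proof.
move=> oU Uz sh h0; rewrite -(dz_ext a oU (g := fun=> 0) h0 sh Uz) /dz.
have D v := (isD_val (isD_cst (0 : C) v z)).2.
by rewrite !D mulr0 subrr mulr0.
Qed.

(* Antiholomorphic derivatives vanish identically, hence so do the mixed ones. *)
Lemma jet_holomorphic (h : 'rV[C]_m -> C) z v : smooth_on O h -> O z ->
  (forall b w, O w -> dzbar b h w = 0) ->
  jet (fun t => h (z + t *: v)) (h z) (\sum_i v 0 i * dz i h z) 0 0.
Proof.
move=> sh Oz h0; apply: (jet_eq (jet_comp oO sh Oz (jet_line z v))) => //.
  by apply: big1 => i _; rewrite h0 // mulr0.
apply: big1 => i _; apply: big1 => j _.
by rewrite (dz0 i oO Oz (smooth_dzbar j oO sh) (h0 j)) mulr0.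
Qed.

Lemma jet_map z v k : O z ->
  jet (fun t : C => (F (z + t *: v) - F z) 0 k) 0 ((v *m 'J F z) 0 k) 0 0.
Proof.
move=> Oz; have J := jet_holomorphic v (hF.1 k) Oz (fun b w Ow => dzbar_holomorphic b k Ow).
have J2 := jetD J (jet_cst (- F z 0 k)).
apply: (jet_ext _ (jet_eq J2 _ _ _ _)); rewrite ?subrr ?addr0 //.
  by move=> t; rewrite !mxE.
by rewrite mxE; apply: eq_bigr => i _; rewrite dz_holomorphic.
Qed.

Lemma jet_affine (E w : 'rV[C]_m) i :
  jet (fun t : C => (E + t *: w) 0 i) (E 0 i) (w 0 i) 0 0.
Proof.
apply: (jet_ext _ (jet_eq (jetD (jet_cst (E 0 i)) (jet_scale_id (w 0 i))) _ _ _ _));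
  rewrite ?addr0 ?add0r //.
by move=> t; rewrite !mxE.
Qed.

(** The first-order coefficient is left existential: it enters the final inequalities only through a
    square norm that is discarded. *)
Lemma jet_pushforward z v (E w : 'rV[C]_m) : O z -> exists w' : 'rV[C]_n, forall k,
  jet (fun t : C => ((E + t *: w) *m 'J F (z + t *: v)) 0 k)
    ((E *m 'J F z) 0 k) (w' 0 k) 0 0.
Proof.
move=> Oz.
have J k a := jetM (jet_affine E w a)
  (jet_holomorphic v (smooth_jacobian a k) Oz (fun b u Ou => dzbar_jacobian a b k Ou)).
exists (\row_k \sum_a (E 0 a * (\sum_i v 0 i * dz i (fun u => 'J F u a k) z) + w 0 a * 'J F z a k)).
move=> k; apply: (jet_ext _ (jet_eq (jet_sum (J k)) _ _ _ _)).
- by move=> t; rewrite mxE.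
- by rewrite mxE.
- by rewrite mxE.
- by apply: big1 => a _; rewrite mulr0 mul0r addr0.
- by apply: big1 => a _; rewrite !(mulr0, mul0r) !addr0.
Qed.

End HolomorphicJets.

(** * Metric and pulled back metric along a complex line *)

Section CoreInequalities.
Context (R : realType) (m n : nat).
Local Notation C := (Cplx R).
Context (O : set 'rV[C]_m) (U : set 'rV[C]_n) (F : 'rV[C]_m -> 'rV[C]_n).
Context (G : 'rV[C]_m -> 'M[C]_m) (H : 'rV[C]_n -> 'M[C]_n).
Hypothesis oO : open O.
Hypothesis oU : open U.
Hypothesis hF : holomorphic_on O F.
Hypothesis FU : forall z, O z -> U (F z).
Hypothesis sG : forall a b, smooth_on O (fun w => G w a b).
Hypothesis hG : forall z a b, O z -> G z b a = (G z a b)^*.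
Hypothesis pG : forall z, O z -> posdef (G z).
Hypothesis sH : forall a b, smooth_on U (fun w => H w a b).
Hypothesis hH : forall z a b, U z -> H z b a = (H z a b)^*.
Hypothesis pH : forall z, U z -> posdef (H z).

Definition pullback z : 'M[C]_m := 'J F z *m H (F z) *m adj ('J F z).

Lemma posdef_semi p (A : 'M[C]_p) : posdef A -> possemidef A.
Proof.
move=> pA v; have [->|v0] := eqVneq v 0; first by rewrite hprod0l.
exact: ltW (pA v v0).
Qed.

Lemma pullback_hprod z v w : hprod (H (F z)) (v *m 'J F z) (w *m 'J F z) = hprod (pullback z) v w.
Proof. exact: hprod_congr. Qed.

Lemma pullback_psd z : O z -> possemidef (pullback z).
Proof.
by move=> Oz v; rewrite -pullback_hprod; apply: posdef_semi; apply: pH; exact: FU.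
Qed.

(* The covariant derivative of the frame vanishes at the base point. *)
Lemma jet_parallel z v (E1 E2 w1 w2 : 'rV[C]_m) : O z ->
  w1 + chris G z v E1 = 0 -> w2 + chris G z v E2 = 0 ->
  jet (fun t : C => hprod (G (z + t *: v)) (E1 + t *: w1) (E2 + t *: w2))
   (hprod (G z) E1 E2) 0 0 (- curv_form G z E1 E2 v v).
Proof.
move=> Oz h1 h2; have uG w : O w -> G w \in unitmx by move=> /pG /posdef_unit.
have J := jet_metric oO sG hG uG Oz (jet_line z v) (jet_affine E1 w1) (jet_affine E2 w2).
apply: (jet_eq J erefl); rewrite ?h1 ?h2 ?hprod0l ?hprod0r ?addr0 //.
Qed.

(** The vector [y i] is the covariant derivative of the image of the i-th field. One family y serves
    all pairs (i, j), so that the diagonal products are square norms. The linear coefficients a and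
    b need no formula: in the trace they meet the vanishing linear coefficients of the metric. *)
Lemma jet_pullback z v p (E w : 'I_p -> 'rV[C]_m) : O z -> exists (y : 'I_p -> 'rV[C]_n)
  (a b : 'I_p -> 'I_p -> C), forall i j,
  jet (fun t : C => hprod (pullback (z + t *: v)) (E i + t *: w i) (E j + t *: w j))
   (hprod (pullback z) (E i) (E j)) (a i j) (b i j)
   (- curv_form H (F z) (E i *m 'J F z) (E j *m 'J F z) (v *m 'J F z) (v *m 'J F z)
    + hprod (H (F z)) (y i) (y j)).
Proof.
move=> Oz; have uH u : U u -> H u \in unitmx by move=> /pH /posdef_unit.
have [w' hw'] := choice (fun i => jet_pushforward oO hF v (E i) (w i) Oz).
pose y i := w' i + chris H (F z) (v *m 'J F z) (E i *m 'J F z).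
exists y, (fun i j => hprod (H (F z)) (y i) (E j *m 'J F z)), (fun i j => hprod (H (F z)) (E i *m 'J F z) (y j)) => i j.
have J := jet_metric oU sH hH uH (FU Oz) (jet_map oO hF v ^~ Oz) (hw' i) (hw' j).
apply: (jet_eq (jet_ext _ J) (pullback_hprod z (E i) (E j)) erefl erefl erefl) => t.
have -> : F z + (F (z + t *: v) - F z) = F (z + t *: v) by rewrite addrC subrK.
exact: pullback_hprod.
Qed.

Lemma near_line (z v : 'rV[C]_m) (P : set 'rV[C]_m) : nbhs z P -> \forall t \near (0 : C), P (z + t *: v).
Proof.
move=> /nbhs_sz[d d0 hd]; have K0 : 0 < sz v + 1 by rewrite ltr_wpDl // sz_ge0.
have := @cn_near0 R (d / (sz v + 1)); rewrite divr_gt0 // => /(_ isT).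
apply: filterS => t; rewrite ltr_pdivlMr // => ht.
apply: hd; rewrite szZ; apply: le_lt_trans ht.
by rewrite ler_wpM2l ?cn_ge0 // lerDl.
Qed.

Lemma Re_ofRM (l : R) (x : C) : complex.Re (ofR l * x) = l * complex.Re x.
Proof. by case: x => a b /=; rewrite mul0r subr0. Qed.

Lemma ReD (x y : C) : complex.Re (x + y) = complex.Re x + complex.Re y.
Proof. by case: x => ? ?; case: y. Qed.

Lemma ReN (x : C) : complex.Re (- x) = - complex.Re x.
Proof. by case: x. Qed.

Lemma Re_NofRM (l : R) (x : C) : complex.Re (- ofR l * x) = - (l * complex.Re x).
Proof. by rewrite mulNr ReN Re_ofRM. Qed.

(** The inequality is assumed for every vector at every nearby point, so the parallel affine field
    through v may be inserted. The difference of the two sides is then a smooth function of t with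
    maximum 0 at t = 0. *)
Lemma core_direction z v (l : R) : O z ->
  (\forall w \near z, forall V,
     complex.Re (hprod (pullback w) V V) <= l * complex.Re (hprod (G w) V V)) ->
  complex.Re (hprod (pullback z) v v) = l * complex.Re (hprod (G z) v v) ->
  l * complex.Re (curv_form G z v v v v) <=
  complex.Re (curv_form H (F z) (v *m 'J F z) (v *m 'J F z) (v *m 'J F z) (v *m 'J F z)).
Proof.
move=> Oz hle heq; pose w := - chris G z v v.
have [y [a [b Y]]] := jet_pullback v (fun _ : 'I_1 => v) (fun=> w) Oz.
have JA := Y ord0 ord0.
have J := jetD JA (jetZ (- ofR l) (jet_parallel Oz (addNr (chris G z v v)) (addNr (chris G z v v)))).
have := jet_max J; rewrite -/w !ReD !Re_NofRM !ReN heq subrr.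
have := posdef_semi (pH (FU Oz)) (y ord0).
move=> y0 h; rewrite -subr_le0; apply: le_trans (h _); first by lra.
apply: filterS (near_line v hle) => t /(_ (v + t *: w)) ht.
by rewrite ReD Re_NofRM subr_le0.
Qed.

Lemma mxtrace_rows p q (A : 'M[C]_p) (V : 'M[C]_(q, p)) :
  \tr (V *m A *m adj V) = \sum_i hprod A (row i V) (row i V).
Proof. by rewrite /mxtrace; apply: eq_bigr => i _; rewrite hprod_rows. Qed.

Lemma mxtrace_mul_rows p q (A B : 'M[C]_p) (V : 'M[C]_(q, p)) :
  \tr ((V *m A *m adj V) *m (V *m B *m adj V)) =
  \sum_i \sum_j hprod A (row i V) (row j V) * hprod B (row j V) (row i V).
Proof.
rewrite /mxtrace; apply: eq_bigr => i _; rewrite mxE; apply: eq_bigr => j _.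
by rewrite !hprod_rows.
Qed.

Lemma frame_trace_le p (A B : 'M[C]_p) (V : 'I_p -> 'rV[C]_p) :
  herm_mx A -> posdef A -> possemidef B ->
  complex.Re (2 * (\sum_i hprod B (V i) (V i)) +
     -1 * (\sum_i \sum_j hprod A (V i) (V j) * hprod B (V j) (V i)))
  <= complex.Re (\tr (invmx A *m B)).
Proof.
move=> hA pA pB; have := mxtrace_invmx_ge (\matrix_i V i) hA pA pB.
rewrite (mxtrace_rows B) mxtrace_mul_rows mulN1r.
rewrite [X in 2 * X](eq_bigr (fun i => hprod B (V i) (V i))) => [|i _]; last by rewrite rowK.
rewrite [X in - X](eq_bigr (fun i => \sum_j hprod A (V i) (V j) * hprod B (V j) (V i))) // => i _.
by apply: eq_bigr => j _; rewrite !rowK.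
Qed.

Lemma le_of_addr_le0 (x y u : R) : u + y <= 0 -> - x <= u -> y <= x.
Proof. lra. Qed.

Lemma diag_contraction0 p (i : 'I_p) (d : 'I_p -> C) :
  \sum_j (i == j)%:R * ((j == i)%:R * d j) = d i.
Proof.
rewrite (bigD1 i) //= eqxx !mul1r big1 ?addr0 // => j /negPf ji.
by rewrite ji mul0r mulr0.
Qed.

(** The coefficient of t tbar in sum_j G(V_i, V_j) A(V_j, V_i), given by the product rule for jets.
    The zeros are the linear coefficients of the metric in a parallel frame; the Kronecker symbols
    come from its being unitary and diagonalising A. *)
Lemma diag_contraction p (i : 'I_p) (q r : 'I_p -> 'I_p -> C) (d a b : 'I_p -> C) :
  \sum_j ((i == j)%:R * q j i + - r i j * ((j == i)%:R * d j) + 0 * b j + 0 * a j)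
  = q i i - r i i * d i.
Proof.
rewrite (bigD1 i) //= eqxx !mul1r big1 => [|j /negPf ji].
  by rewrite !mul0r !addr0 mulNr.
by rewrite eq_sym ji !mul0r mulr0 !addr0.
Qed.

Lemma core_trace z v (E : 'M[C]_m) (d : 'I_m -> R) : O z ->
  (\forall w \near z, complex.Re (\tr (invmx (G w) *m pullback w)) <=
     complex.Re (\tr (invmx (G z) *m pullback z))) ->
  E *m G z *m adj E = 1%:M -> E *m pullback z *m adj E = diag_mx (\row_a ofR (d a)) ->
  \sum_a d a * complex.Re (curv_form G z (row a E) (row a E) v v) <=
  \sum_a complex.Re (curv_form H (F z) (row a E *m 'J F z) (row a E *m 'J F z)
      (v *m 'J F z) (v *m 'J F z)).
Proof.
move=> Oz hle dG dA; pose w i := - chris G z v (row i E).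
have [y [a [b JA]]] := jet_pullback v (fun i => row i E) w Oz.
have JB i j : jet (fun t : C => hprod (G (z + t *: v)) (row i E + t *: w i) (row j E + t *: w j))
    (hprod (G z) (row i E) (row j E)) 0 0 (- curv_form G z (row i E) (row j E) v v) :=
  jet_parallel Oz (addNr (chris G z v (row i E))) (addNr (chris G z v (row j E))).
have J := jetD (jetZ 2 (jet_sum (fun i => JA i i)))
  (jetZ (-1) (jet_sum (fun i => jet_sum (fun j => jetM (JB i j) (JA j i))))).
have cE : complex.Re (\tr (invmx (G z) *m pullback z)) = \sum_i d i.
  by rewrite (diag_trace dG dA) raddf_sum; apply: eq_bigr.
have dB i j : hprod (G z) (row i E) (row j E) = (i == j)%:R := diag_hprod_basis dG i j.
have dP i j : hprod (pullback z) (row i E) (row j E) = (i == j)%:R * ofR (d i) :=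
  diag_hprod_basisA dA i j.
pose K i := curv_form H (F z) (row i E *m 'J F z) (row i E *m 'J F z) (v *m 'J F z) (v *m 'J F z).
pose S i := curv_form G z (row i E) (row i E) v v.
have Jc : 2 * (\sum_i hprod (pullback z) (row i E) (row i E)) +
    -1 * (\sum_i \sum_j hprod (G z) (row i E) (row j E) * hprod (pullback z) (row j E) (row i E))
    = \sum_i ofR (d i).
  have -> : \sum_i hprod (pullback z) (row i E) (row i E) = \sum_i ofR (d i).
    by apply: eq_bigr => i _; rewrite dP eqxx mul1r.
  have -> : \sum_i \sum_j hprod (G z) (row i E) (row j E) * hprod (pullback z) (row j E) (row i E)
      = \sum_i ofR (d i).
    by apply: eq_bigr => i _; under eq_bigr do rewrite dB dP; exact: diag_contraction0.
  by rewrite mulN1r mulr_natl mulr2n addrK.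
(* The terms of the pulled back metric enter twice with a plus sign and once with a minus sign, so
   one copy remains. The curvature of the source comes from the quadratic correction alone, weighted
   by the eigenvalues [d i]. *)
have Jq : 2 * (\sum_i (- K i + hprod (H (F z)) (y i) (y i))) + -1 * (\sum_i (
     (- K i + hprod (H (F z)) (y i) (y i)) - S i * ofR (d i))) =
     \sum_i (- K i + hprod (H (F z)) (y i) (y i)) + \sum_i ofR (d i) * S i.
  rewrite sumrB mulN1r mulr_natl mulr2n opprB addrA addrAC addrK; congr (_ + _).
  by apply: eq_bigr => i _; rewrite mulrC.
have Jqq := fun i => esym (diag_contraction i (fun j i => - curv_form H (F z) (row j E *m 'J F z)
    (row i E *m 'J F z) (v *m 'J F z) (v *m 'J F z) + hprod (H (F z)) (y j) (y i))
    (fun i j => curv_form G z (row i E) (row j E) v v) (fun i => ofR (d i)) (a ^~ i) (b ^~ i)).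
rewrite (eq_bigr _ (fun i _ => Jqq i)) in Jq.
have {}J := jet_eq J Jc erefl erefl (eq_trans _ Jq).
have cd : complex.Re (\sum_i ofR (d i)) = \sum_i d i by rewrite raddf_sum.
have := jet_max (J _); rewrite cd -cE => {J Jc}main.
have {main}: complex.Re (\sum_i (- K i + hprod (H (F z)) (y i) (y i)) + \sum_i ofR (d i) * S i) <= 0.
  apply: main.
    congr (_ + _ * _); apply: eq_bigr => i _; apply: eq_bigr => j _.
    by rewrite dB dP.
  (* Near t = 0 the frame expression is at most the trace at the same point, which is at most the
     trace at z. *)
  apply: filterS (near_line v (filterI (open_nbhs_nbhs (conj oO Oz)) hle)) => t [Ot].
  apply: le_trans; have hGt a' b' : G (z + t *: v) b' a' = (G (z + t *: v) a' b')^* := hG a' b' Ot.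
  exact: (frame_trace_le (fun i => row i E + t *: w i) hGt (pG Ot) (pullback_psd Ot)).
rewrite ReD !raddf_sum.
have hy i : 0 <= complex.Re (hprod (H (F z)) (y i) (y i)) := posdef_semi (pH (FU Oz)) (y i).
rewrite [X in _ + X <= 0](eq_bigr (fun i => d i * complex.Re (S i))); last by move=> i _; exact: Re_ofRM.
have hK : - (\sum_i complex.Re (K i)) <=
    \sum_i complex.Re (- K i + hprod (H (F z)) (y i) (y i)).
  by rewrite -sumrN; apply: ler_sum => i _; rewrite ReD ReN lerDl.
move=> h; suff H' : \sum_i d i * complex.Re (S i) <= \sum_i complex.Re (K i) by exact H'.
exact: (le_of_addr_le0 h hK).
Qed.

End CoreInequalities.

(** * Extremal ratio and trace of a hermitian pencil *)

Section PencilExtrema.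
Context (R : realType).
Local Notation C := (Cplx R).

Lemma row_neq0 p (v : 'rV[C]_p) : v != 0 -> exists a, v 0 a != 0.
Proof.
move=> v0; apply/existsP; apply: contraNT v0 => /existsPn h; apply/eqP/rowP => a.
by rewrite [RHS]mxE; apply/eqP; have := h a; rewrite negbK.
Qed.

Definition ratios p (G A : 'M[C]_p) : set R :=
  [set complex.Re (hprod A v v) / complex.Re (hprod G v v) | v in [set v : 'rV[C]_p | v != 0]].

(** The supremum is the largest relative eigenvalue, attained at the corresponding row of E. The
    nonzero vector guarantees that there is an index to maximise over. *)
Lemma sup_ratios p (G A : 'M[C]_p) : herm_mx G -> posdef G -> herm_mx A ->
  (exists v : 'rV[C]_p, v != 0) ->
  (forall v, complex.Re (hprod A v v) <= sup (ratios G A) * complex.Re (hprod G v v)) /\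
  exists2 v, v != 0 & complex.Re (hprod A v v) = sup (ratios G A) * complex.Re (hprod G v v).
Proof.
move=> hG pG hA [v0 v0n]; have [E [d [dG dA]]] := simultaneous_diag hG pG hA.
have [p0 _] := row_neq0 v0n.
pose a := [arg max_(i > p0) d i]%O.
have da i : d i <= d a by rewrite /a; case: arg_maxP => // j _; exact.
have le v : complex.Re (hprod A v v) <= d a * complex.Re (hprod G v v).
  rewrite (diag_hprodA dG dA) (diag_hprodG dG) !raddf_sum mulr_sumr; apply: ler_sum => i _ /=.
  by rewrite ler_wpM2r // exprn_ge0 // cn_ge0.
have ra0 : row a E != 0.
  apply/eqP => ra; have := diag_hprod_basis dG a a.
  by rewrite ra hprod0l eqxx => /eqP; rewrite eq_sym oner_eq0.
have eq : complex.Re (hprod A (row a E) (row a E)) = d a * complex.Re (hprod G (row a E) (row a E)).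
  by rewrite (diag_hprod_basisA dA) (diag_hprod_basis dG) eqxx mul1r mulr1.
have ub : ubound (ratios G A) (d a).
  by move=> _ [v v0' <-]; rewrite ler_pdivrMr ?pG.
have ina : ratios G A (d a).
  by exists (row a E) => //; rewrite eq mulfK // gt_eqF // pG.
suff -> : sup (ratios G A) = d a by split => //; exists (row a E).
apply/eqP; rewrite eq_le; apply/andP; split.
  by apply: ge_sup => //; exists (d a).
by apply: sup_ubound => //; exists (d a).
Qed.

(** Applied to a change of charts, this yields invertibility of the Jacobian directly from the
    transformation rule of the metric. *)
Lemma congr_unit p (G T : 'M[C]_p) : posdef (T *m G *m adj T) -> T \in unitmx.
Proof.
move=> pG; rewrite -row_free_unit -kermx_eq0; apply: contraT => /rowV0Pn[v].
move=> /sub_kermxP vT v0; have := pG v v0.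
by rewrite -hprod_congr vT hprod0l ltxx.
Qed.

Lemma mxtrace_congr p (G A T : 'M[C]_p) : T \in unitmx -> G \in unitmx ->
  \tr (invmx (T *m G *m adj T) *m (T *m A *m adj T)) = \tr (invmx G *m A).
Proof.
move=> uT uG; have uT' : adj T \in unitmx by rewrite unitmx_tr map_unitmx.
have -> : invmx (T *m G *m adj T) = invmx (adj T) *m (invmx G *m invmx T).
  have h : invmx (adj T) *m (invmx G *m invmx T) *m (T *m G *m adj T) = 1%:M.
    rewrite -!mulmxA (mulKmx uT) (mulKmx uG) mulVmx //.
  by rewrite -[LHS]mul1mx -h mulmxK // !unitmx_mul uT uG.
have -> : invmx (adj T) *m (invmx G *m invmx T) *m (T *m A *m adj T) =
  invmx (adj T) *m (invmx G *m A *m adj T).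
  by rewrite -!mulmxA (mulKmx uT).
by rewrite mxtrace_mulC mulmxK.
Qed.

Lemma le_congr p (G A T : 'M[C]_p) (l : R) :
  (forall v, complex.Re (hprod A v v) <= l * complex.Re (hprod G v v)) ->
  forall v, complex.Re (hprod (T *m A *m adj T) v v) <= l * complex.Re (hprod (T *m G *m adj T) v v).
Proof. by move=> H v; rewrite -!hprod_congr. Qed.

Lemma mxtrace_gt0 p (G A : 'M[C]_p) : herm_mx G -> posdef G -> herm_mx A -> possemidef A ->
  (exists v, 0 < complex.Re (hprod A v v)) -> 0 < complex.Re (\tr (invmx G *m A)).
Proof.
move=> hG pG hA pA [v v0]; have [E [d [dG dA]]] := simultaneous_diag hG pG hA.
have d0 i : 0 <= d i.
  have := pA (row i E); rewrite (diag_hprod_basisA dA) eqxx mul1r; exact.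
rewrite (diag_trace dG dA) raddf_sum /=; move: v0; rewrite (diag_hprodA dG dA) raddf_sum /=.
apply: contraTT; rewrite -!leNgt => S0; apply: sumr_le0 => i _.
suff -> : d i = 0 by rewrite mul0r.
apply/eqP; rewrite eq_le d0 andbT; apply: le_trans S0.
by rewrite (bigD1 i) //= lerDl; apply: sumr_ge0.
Qed.

End PencilExtrema.

(** * Continuity of matrix operations and openness of positivity *)

Section MatrixContinuity.
Context (R : realType) (T : topologicalType) (x : T).
Local Notation C := (Cplx R).

Definition cont_mx p q (A : T -> 'M[C]_(p, q)) :=
  forall a b, {for x, continuous (fun y => A y a b)}.

Lemma cont_ext (f g : T -> C) : f =1 g ->
  {for x, continuous f} -> {for x, continuous g}.
Proof. by move=> /funext ->. Qed.

Lemma cont_sum (I : Type) (r : seq I) (F : I -> T -> C) :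
  (forall i, {for x, continuous (F i)}) ->
  {for x, continuous (fun y => \sum_(i <- r) F i y)}.
Proof.
move=> cF; elim: r => [|i r IH].
  by refine (cont_ext _ (@cont_cst _ _ 0 x)) => y; rewrite big_nil.
by refine (cont_ext _ (cont_add (cF i) IH)) => y; rewrite big_cons.
Qed.

Lemma cont_prod (I : Type) (r : seq I) (F : I -> T -> C) :
  (forall i, {for x, continuous (F i)}) ->
  {for x, continuous (fun y => \prod_(i <- r) F i y)}.
Proof.
move=> cF; elim: r => [|i r IH].
  by refine (cont_ext _ (@cont_cst _ _ 1 x)) => y; rewrite big_nil.
by refine (cont_ext _ (cont_mul (cF i) IH)) => y; rewrite big_cons.
Qed.

Lemma cont_conj (F : T -> C) : {for x, continuous F} -> {for x, continuous (fun y => (F y)^*)}.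
Proof.
move=> /cont_cnP cF; apply/cont_cnP => e e0; apply: filterS (cF e e0) => y.
by rewrite -rmorphB cn_conj.
Qed.

Lemma cont_mulmx p q r (A : T -> 'M[C]_(p, q)) (B : T -> 'M[C]_(q, r)) :
  cont_mx A -> cont_mx B -> cont_mx (fun y => A y *m B y).
Proof.
move=> cA cB a b.
have cAB k := cont_mul (cA a k) (cB k b).
by refine (cont_ext _ (@cont_sum _ (index_enum 'I_q) _ cAB)) => y; rewrite mxE.
Qed.

Lemma cont_adj p q (A : T -> 'M[C]_(p, q)) : cont_mx A -> cont_mx (fun y => adj (A y)).
Proof. by move=> cA a b; refine (cont_ext _ (cont_conj (cA b a))) => y; rewrite !mxE. Qed.

Lemma cont_cst_mx p q (A : 'M[C]_(p, q)) : cont_mx (fun=> A).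
Proof. by move=> a b; exact: cont_cst. Qed.

Lemma cont_det p (A : T -> 'M[C]_p) : cont_mx A -> {for x, continuous (fun y => \det (A y))}.
Proof.
move=> cA.
have cs (s : 'S_p) := cont_mul (@cont_cst _ _ ((-1) ^+ s) x)
  (@cont_prod _ (index_enum 'I_p) _ (fun i => cA i (s i))).
exact (@cont_sum _ (index_enum 'S_p) _ cs).
Qed.

(** Cramer's rule expresses the entries of the inverse. Invertibility is asked near x because
    [invmx] returns its argument on singular matrices. *)
Lemma cont_invmx p (A : T -> 'M[C]_p) : cont_mx A -> (\forall y \near x, A y \in unitmx) ->
  cont_mx (fun y => invmx (A y)).
Proof.
move=> cA uA a b; have uAx := nbhs_singleton uA.
have cI : {for x, continuous (fun y => (\det (A y))^-1 * \adj (A y) a b)}.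
  have cD := cont_det cA.
  have cV : {for x, continuous (fun y => (\det (A y))^-1)}.
    by refine (cvgV _ cD); rewrite -unitfE -unitmxE.
  have cM : cont_mx (fun y => row' b (col' a (A y))).
    by move=> i j; refine (cont_ext _ (cA (lift b i) (lift a j))) => y; rewrite !mxE.
  have cc := cont_mul (@cont_cst _ _ ((-1) ^+ (b + a)) x) (cont_det cM).
  by refine (cont_mul cV (cont_ext _ cc)) => y; rewrite mxE.
by apply: cont_near cI; apply: filterS uA => y uy; rewrite /invmx uy [RHS]mxE.
Qed.

Lemma sum_average p (e : R) (F : 'I_p -> R) :
  \sum_a \sum_b e * ((F a + F b) / 2) = e * (p%:R * \sum_a F a).
Proof.
transitivity (\sum_a e * ((p%:R * F a + \sum_b F b) / 2)).
  apply: eq_bigr => a _; rewrite -mulr_sumr -mulr_suml big_split /=.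
  by rewrite sumr_const card_ord -[F a *+ p]mulr_natl.
rewrite -mulr_sumr -mulr_suml big_split /= -mulr_sumr sumr_const card_ord -[_ *+ p]mulr_natl.
by move: (\sum_a F a) => S; field.
Qed.

(** After a congruence the value at x is the identity. If all entries of the perturbation D are at
    most e, then |D(u, u)| is at most e p |u|^2, because |u_a| |u_b| is at most the mean of the two
    squares. *)
Lemma posdef_open p (B : T -> 'M[C]_p) : cont_mx B -> herm_mx (B x) -> posdef (B x) ->
  \forall y \near x, posdef (B y).
Proof.
move=> cB hB pB; have [E [_ [dG _]]] := simultaneous_diag hB pB hB.
(* With this e the product e p stays below 1, also for p = 0. *)
pose e : R := (p.+1%:R)^-1; have e0 : 0 < e by rewrite invr_gt0.
have cE := cont_mulmx (cont_mulmx (@cont_cst_mx p p E) cB) (@cont_cst_mx p p (adj E)).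
have ne : \forall y \near x, forall ab : 'I_p * 'I_p,
    cn ((E *m B y *m adj E) ab.1 ab.2 - (ab.1 == ab.2)%:R) <= e.
  apply: (@filter_forall _ _ (fun ab : 'I_p * 'I_p =>
    [set y | cn ((E *m B y *m adj E) ab.1 ab.2 - (ab.1 == ab.2)%:R) <= e]) _ (nbhs_filter x)) => -[a b].
  have := (cont_cnP _ _).1 (cE a b) e e0; apply: filterS => y /=.
  by rewrite dG [1%:M _ _]mxE.
apply: filterS ne => y hy v v0; have uE := diag_unit dG.
pose u := v *m invmx E; have vE : v = u *m E by rewrite mulmxKV.
have u0 : u != 0 by apply: contra v0 => /eqP h; rewrite vE h mul0mx.
rewrite vE hprod_congr.
pose S := \sum_a cn (u 0 a) ^+ 2.
have S0 : 0 < S.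
  have [a ua] := row_neq0 u0.
  rewrite /S (bigD1 a) //= ltr_wpDr ?sumr_ge0 // => [i _|]; first by rewrite exprn_ge0 // cn_ge0.
  by rewrite exprn_gt0 // lt_neqAle cn_ge0 eq_sym cn_eq0 ua.
pose D := E *m B y *m adj E - 1%:M.
have DE a b : D a b = (E *m B y *m adj E) a b - (a == b)%:R.
  by rewrite /D [LHS]mxE [X in _ + X]mxE [1%:M _ _]mxE.
have EB : E *m B y *m adj E = 1%:M + D by rewrite /D addrC subrK.
have h1 : hprod (E *m B y *m adj E) u u = ofR S + hprod D u u.
  have hD : hprod (1%:M + D) u u = hprod 1%:M u u + hprod D u u.
    rewrite /hprod -big_split; apply: eq_bigr => a _; rewrite -big_split; apply: eq_bigr => b _.
    by rewrite [(1%:M + D) a b]mxE !mulrDl.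
  rewrite EB hD /hprod; congr (_ + _).
  rewrite /S (big_morph (@ofR R) (@ofRD R) (ofR0 R)); apply: eq_bigr => a _.
  rewrite (bigD1 a) //= big1 => [|b ba]; last by rewrite mxE eq_sym (negPf ba) !mul0r.
  by rewrite mxE eqxx mul1r addr0 -normCK normcn expr2 -ofRM -expr2.
have h2 : cn (hprod D u u) <= e * (p%:R * S).
  apply: (@le_trans _ _ (\sum_a \sum_b (e * ((cn (u 0 a) ^+ 2 + cn (u 0 b) ^+ 2) / 2)))).
    apply: (le_trans (cn_sum _ _ _)); apply: ler_sum => a _.
    apply: (le_trans (cn_sum _ _ _)); apply: ler_sum => b _.
    rewrite !cnM cn_conj -mulrA ler_pM ?cn_ge0 ?mulr_ge0 ?cn_ge0 //.
      by have := hy (a, b); rewrite /= DE.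
    by move: (cn (u 0 a)) (cn (u 0 b)) => s t; have := sqr_ge0 (s - t); rewrite sqrrB; lra.
  rewrite (sum_average e (fun a => cn (u 0 a) ^+ 2)) //.
rewrite h1 ReD -(opprK (hprod D u u)) ReN; apply: lt_le_trans (_ : S - e * (p%:R * S) <= _).
  have : e * (p%:R * S) < S; last by rewrite subr_gt0.
  by rewrite mulrA gtr_pMl // /e mulrC ltr_pdivrMr // mul1r ltr_nat.
have := Re_le_cn (- hprod D u u); rewrite cnN; move: h2 => /=.
by move: (complex.Re _) (cn _) => s t; lra.
Qed.

End MatrixContinuity.

(** * Chart independence *)

Section Topology.
Context (R : realType).

(** Superlevel sets are nested, hence form a filter base, and compactness gives a cluster point p.
    Were phi(p) < phi(x), the neighbourhood of p where phi < phi(x) would miss the superlevel set of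
    x. *)
Lemma usc_max (T : topologicalType) (phi : T -> R) : compact [set: T] -> T ->
  (forall x c, phi x < c -> \forall y \near x, phi y < c) ->
  exists x0, forall x, phi x <= phi x0.
Proof.
move=> cT t0 usc; pose B y := [set x | phi y <= phi x].
pose F := filter_from [set: T] B.
have FF : ProperFilter F.
  apply: filter_from_proper; last by move=> y _; exists y; rewrite /B /=.
  apply: filter_from_filter; first by exists t0.
  move=> y z _ _; have [yz|zy] := leP (phi y) (phi z).
    by exists z => // x; rewrite /B /= => zx; split => //=; apply: le_trans zx.
  by exists y => // x; rewrite /B /= => yx; split => //=; apply: le_trans yx; exact: ltW.
have [p [_ cp]] := cT F FF filterT.
exists p => x; rewrite leNgt; apply/negP => px.
have [||q [Bq]] := cp (B x) [set q | phi q < phi x].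
- by exists x.
- exact: usc.
by move: Bq; rewrite /B /= leNgt => /negP Bq'; exact: Bq'.
Qed.

Lemma locally_constant_connected (T : topologicalType) (V : Type) (f : T -> V) :
  connected [set: T] -> (forall x, \forall y \near x, f y = f x) -> forall x y, f x = f y.
Proof.
move=> cT lc x y; pose A := [set z | f z = f x].
have oA : open A.
  by rewrite openE => z Az; rewrite /interior; apply: filterS (lc z) => w fw; rewrite /A /= fw.
have oC : open (~` A).
  by rewrite openE => z Az; rewrite /interior; apply: filterS (lc z) => w fw; rewrite /A /= fw.
have AT : A = setT.
  apply: cT; first by exists x.
  - by exists A => //; rewrite setTI.
  - by exists A; [rewrite -[A]setCK closedC|rewrite setTI].
by have : A y by rewrite AT.
Qed.

End Topology.

Section ChartTopology.
Context (R : realType) (n : nat) (T : topologicalType).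
Local Notation C := (Cplx R).
Implicit Types (c : chart R n T) (A : set T).

Lemma open_coord_image c A : open A -> open (Defs.coord c @` (dom c `&` A)).
Proof.
move=> oA; rewrite openE => _ [x [dx Ax] <-]; rewrite /interior.
have ci : (Defs.coord c @` dom c) (Defs.coord c x) by exists x.
have n1 : \forall w \near Defs.coord c x, (Defs.coord c @` dom c) w.
  by apply: open_nbhs_nbhs; split; [exact: image_open|exact: ci].
have n2 : \forall w \near Defs.coord c x, A (param c w).
  apply: (param_continuous ci); rewrite coordK //.
  by apply: open_nbhs_nbhs; split.
apply: filterS (filterI n1 n2) => w [[y dy <-] ].
by rewrite coordK // => Ay; exists y.
Qed.

End ChartTopology.

Section Jacobians.
Context (R : realType).
Local Notation C := (Cplx R).

Lemma jacobian_comp m n p (f : 'rV[C]_m -> 'rV[C]_n) (g : 'rV[C]_n -> 'rV[C]_p) z :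
  differentiable f z -> differentiable g (f z) ->
  'J (g \o f) z = 'J f z *m 'J g (f z).
Proof.
move=> df dg; apply/row_matrixP => i; rewrite !rowE mulmxA.
rewrite -(deriveEjacobian _ (differentiable_comp df dg)) -(deriveEjacobian _ df).
rewrite -(deriveEjacobian _ dg) !deriveE //; last exact: differentiable_comp.
by rewrite (diff_comp df dg).
Qed.

Lemma eq_mulmx_rV m n (A B : 'M[C]_(m, n)) :
  (forall v : 'rV[C]_m, v *m A = v *m B) -> A = B.
Proof. by move=> H; apply/row_matrixP => i; rewrite !rowE. Qed.

Lemma jacobian_near m n (f g : 'rV[C]_m -> 'rV[C]_n) z :
  (\forall w \near z, f w = g w) -> differentiable f z -> differentiable g z ->
  'J f z = 'J g z.
Proof.
move=> fg df dg.
apply: eq_mulmx_rV => v.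
have E1 := deriveEjacobian v df; have E2 := deriveEjacobian v dg.
exact: (eq_trans (esym E1) (eq_trans (near_eq_derive v fg) E2)).
Qed.

End Jacobians.

Lemma congr_comp (R : realType) m n p (T : 'M[Cplx R]_m) (J' : 'M[Cplx R]_(m, p))
    (J : 'M[Cplx R]_(m, n)) (S : 'M[Cplx R]_(n, p)) (H : 'M[Cplx R]_p) :
  T *m J' = J *m S ->
  J *m (S *m H *m adj S) *m adj J = T *m (J' *m H *m adj J') *m adj T.
Proof.
move=> E; transitivity ((J *m S) *m H *m adj (J *m S)); first by rewrite adjM !mulmxA.
by rewrite -E adjM !mulmxA.
Qed.

(** * Transformation of the pencil under changes of charts *)

Section ChartChange.
Context (R : realType) (m n : nat) (M : kahlerManifold R m) (N : kahlerManifold R n).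
Local Notation C := (Cplx R).

Section Metric.
Context (p : nat) (P : kahlerManifold R p).

Lemma metric_herm (i : chart_index P) z : chart_image (charts i) z -> herm_mx (metric i z).
Proof. by move=> iz a b; apply: metric_hermitian. Qed.

Lemma metric_posdef (i : chart_index P) z : chart_image (charts i) z -> posdef (metric i z).
Proof. by move=> iz v v0; have := metric_pos iz v0; rewrite ltcE /= => /andP[]. Qed.

Lemma metric_transition (i j : chart_index P) x : dom (charts i) x -> dom (charts j) x ->
  metric i (Defs.coord (charts i) x) =
  'J (transition (charts i) (charts j)) (Defs.coord (charts i) x) *m metric j (Defs.coord (charts j) x)
   *m adj ('J (transition (charts i) (charts j)) (Defs.coord (charts i) x)).
Proof.
move=> ix jx; have ov : overlap (charts i) (charts j) (Defs.coord (charts i) x) by exists x.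
by rewrite (metric_change ov) /transition /= coordK.
Qed.

Lemma transition_unit (i j : chart_index P) x : dom (charts i) x -> dom (charts j) x ->
  'J (transition (charts i) (charts j)) (Defs.coord (charts i) x) \in unitmx.
Proof.
move=> ix jx; apply: (congr_unit (G := metric j (Defs.coord (charts j) x))).
by rewrite -metric_transition //; apply: metric_posdef; exists x.
Qed.

Lemma metric_at_herm (x : P) : herm_mx (metric_at x).
Proof. by apply: metric_herm; exists x => //; exact: chart_at_dom. Qed.

Lemma metric_at_posdef (x : P) : posdef (metric_at x).
Proof. by apply: metric_posdef; exists x => //; exact: chart_at_dom. Qed.

End Metric.

Context (f : M -> N).
Hypothesis hf : holomorphic_map f.

Definition fdom (i : chart_index M) (j : chart_index N) : set 'rV[C]_m :=
  Defs.coord (charts i) @` (dom (charts i) `&` f @^-1` dom (charts j)).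

Lemma open_fdom i j : open (fdom i j).
Proof.
by apply: open_coord_image; apply: open_comp; [move=> x _; exact: hf.1|exact: dom_open].
Qed.

Definition pulled i j : 'rV[C]_m -> 'M[C]_m := pullback (local_rep f i j) (@metric _ _ N j).
Definition pulled_at x : 'M[C]_m := jac f x *m metric_at (f x) *m adj (jac f x).

Lemma local_repE i j x : dom (charts i) x ->
  local_rep f i j (Defs.coord (charts i) x) = Defs.coord (charts j) (f x).
Proof. by move=> ix; rewrite /local_rep /= coordK. Qed.

(** Both sides are chain rules for one map, f read from chart i to the preferred chart at f x: once
    through the preferred chart at x, once through chart j. *)
Lemma jacobian_transition i j x : dom (charts i) x -> dom (charts j) (f x) ->
  'J (transition (charts i) (charts (chart_at x))) (Defs.coord (charts i) x) *m jac f x =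
  'J (local_rep f i j) (Defs.coord (charts i) x) *m
  'J (transition (charts j) (charts (chart_at (f x)))) (Defs.coord (charts j) (f x)).
Proof.
move=> ix jx; set i' := chart_at x; set j' := chart_at (f x).
have ix' : dom (charts i') x := chart_at_dom x.
have jx' : dom (charts j') (f x) := chart_at_dom (f x).
have tx : transition (charts i) (charts i') (Defs.coord (charts i) x) = Defs.coord (charts i') x.
  by rewrite /transition /= coordK.
have d1 : differentiable (transition (charts i) (charts i')) (Defs.coord (charts i) x).
  by apply: (transition_holomorphic i i').2; exists x.
have d2 : differentiable (local_rep f i' j') (Defs.coord (charts i') x).
  by apply: (hf.2 i' j').2; exists x.
have d3 : differentiable (local_rep f i j) (Defs.coord (charts i) x).
  by apply: (hf.2 i j).2; exists x.
have d4 : differentiable (transition (charts j) (charts j')) (Defs.coord (charts j) (f x)).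
  by apply: (transition_holomorphic j j').2; exists (f x).
have -> : jac f x = 'J (local_rep f i' j') (transition (charts i) (charts i') (Defs.coord (charts i) x)).
  by rewrite tx.
rewrite -tx in d2; rewrite -(local_repE j ix) in d4.
rewrite -(jacobian_comp d1 d2) -(local_repE j ix) -(jacobian_comp d3 d4).
apply: (jacobian_near _ (differentiable_comp d1 d2) (differentiable_comp d3 d4)).
(* The two composites agree only where all four charts are defined, which is a neighbourhood of the
   point because f is continuous. *)
have oA : open (dom (charts i') `&` f @^-1` (dom (charts j) `&` dom (charts j'))).
  apply: openI; first exact: dom_open.
  by apply: open_comp; [move=> y _; exact: hf.1|apply: openI; exact: dom_open].
have nA : \forall w \near Defs.coord (charts i) x, (Defs.coord (charts i) @`
    (dom (charts i) `&` (dom (charts i') `&` f @^-1` (dom (charts j) `&` dom (charts j'))))) w.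
  by apply: open_nbhs_nbhs; split; [exact: open_coord_image|exists x].
apply: filterS nA => _ [y [iy [iy' [jy jy']]] <-].
by rewrite /= /transition /local_rep /= !coordK.
Qed.

Lemma fdomP i j x : dom (charts i) x -> dom (charts j) (f x) ->
  fdom i j (Defs.coord (charts i) x).
Proof. by move=> ix jx; exists x. Qed.

Lemma fdom_image i j z : fdom i j z -> chart_image (charts i) z.
Proof. by move=> [x [ix _] <-]; exists x. Qed.

Lemma local_rep_image i j z : fdom i j z -> chart_image (charts j) (local_rep f i j z).
Proof. by move=> [x [ix jx] <-]; rewrite local_repE //; exists (f x). Qed.

(* Both sides of the pencil (metric, pulled back metric) change by the same congruence. *)
Lemma pencil_change i j x : dom (charts i) x -> dom (charts j) (f x) ->
  exists2 T : 'M[C]_m, T \in unitmx &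
    metric i (Defs.coord (charts i) x) = T *m metric_at x *m adj T /\
    pulled i j (Defs.coord (charts i) x) = T *m pulled_at x *m adj T.
Proof.
move=> ix jx; exists ('J (transition (charts i) (charts (chart_at x))) (Defs.coord (charts i) x)).
  by apply: transition_unit => //; exact: chart_at_dom.
split; first by apply: metric_transition => //; exact: chart_at_dom.
have E := jacobian_transition ix jx.
have := metric_transition jx (chart_at_dom (f x)).
rewrite /pulled /pullback local_repE // => ->.
exact: congr_comp E.
Qed.

Lemma pulled_at_herm x : herm_mx (pulled_at x).
Proof. by apply: hermitian_congr; exact: metric_at_herm. Qed.

Lemma pulled_at_psd x : possemidef (pulled_at x).
Proof.
by move=> v; rewrite -hprod_congr; apply: posdef_semi; exact: metric_at_posdef.
Qed.

Lemma normsq_jac x v : normsq (f x) (v *m jac f x) = complex.Re (hprod (pulled_at x) v v).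
Proof. by rewrite /normsq hprod_congr. Qed.

Lemma max_normsqE x : max_normsq f x = sup (ratios (metric_at x) (pulled_at x)).
Proof.
rewrite /max_normsq /ratios; congr (sup (_ @` _)).
by apply/funext => v; rewrite normsq_jac.
Qed.

Lemma hs_normsqE x : hs_normsq f x = complex.Re (\tr (invmx (metric_at x) *m pulled_at x)).
Proof.
rewrite /hs_normsq /mxtrace exchange_big; congr complex.Re; apply: eq_bigr => b _.
rewrite [RHS]mxE; apply: eq_bigr => a _.
rewrite /pulled_at -hprod_rows /hprod mulr_sumr; apply: eq_bigr => i _.
rewrite mulr_sumr; apply: eq_bigr => j _; rewrite !mxE.
by rewrite !mulrA.
Qed.

End ChartChange.

(** * Manifold version and semicontinuity *)

Section MaximumPrinciple.
Context (R : realType) (m n : nat) (M : kahlerManifold R m) (N : kahlerManifold R n).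
Local Notation C := (Cplx R).
Context (f : M -> N).
Hypothesis hf : holomorphic_map f.

Lemma Ck_subset p k (U V : set 'rV[C]_p) h : V `<=` U -> Ck k U h -> Ck k V h.
Proof.
move=> VU; elim: k h => [|k IH] h [ch dh].
  by split=> [z /VU|//]; exact: ch.
split=> [z /VU|v]; first exact: ch.
by have [d1 d2] := dh v; split=> [z /VU|]; [exact: d1|exact: IH].
Qed.

Lemma smooth_metric_fdom i j a b : smooth_on (fdom f i j) (fun w => metric i w a b).
Proof.
by move=> k; apply: Ck_subset (@metric_smooth _ _ M i a b k); exact: fdom_image.
Qed.

Lemma metric_herm_fdom i j z a b : fdom f i j z -> metric i z b a = (metric i z a b)^*.
Proof. by move=> /fdom_image iz; exact: metric_herm. Qed.

Lemma metric_posdef_fdom i j z : fdom f i j z -> posdef (metric i z).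
Proof. by move=> /fdom_image iz; exact: metric_posdef. Qed.

Section AtPoint.
Context (x0 : M).
Let i := chart_at x0.
Let j := chart_at (f x0).
Let z0 := base_coord x0.

Lemma fdom_base : fdom f i j z0.
Proof. by apply: fdomP; exact: chart_at_dom. Qed.

Lemma pulled_base : pulled f i j z0 = pulled_at f x0.
Proof.
rewrite /pulled /pullback /z0 /base_coord local_repE; last exact: chart_at_dom.
by [].
Qed.

Lemma pencil_fdom z : fdom f i j z -> exists2 x, z = Defs.coord (charts i) x &
  exists2 T : 'M[C]_m, T \in unitmx &
    metric i z = T *m metric_at x *m adj T /\ pulled f i j z = T *m pulled_at f x *m adj T.
Proof. by move=> [x [ix jx] <-]; exists x => //; exact: pencil_change. Qed.

Lemma near_chart (P : set 'rV[C]_m) : (\forall z \near z0, P z) ->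
  \forall x \near x0, [/\ dom (charts i) x, dom (charts j) (f x) & P (Defs.coord (charts i) x)].
Proof.
move=> hP.
have n1 : \forall x \near x0, dom (charts i) x.
  by apply: open_nbhs_nbhs; split; [exact: dom_open|exact: chart_at_dom].
have n2 : \forall x \near x0, dom (charts j) (f x).
  apply: (hf.1 x0); apply: open_nbhs_nbhs; split; [exact: dom_open|exact: chart_at_dom].
have n3 : \forall x \near x0, P (Defs.coord (charts i) x).
  exact: (Defs.coord_continuous (chart_at_dom x0) hP).
by apply: filterS (filterI n1 (filterI n2 n3)) => x [? []].
Qed.

(** The hypothesis is expressed in the preferred chart of each x, the jets in the chart of x0; a
    bound between two hermitian forms passes from one to the other by congruence. *)
Lemma core_direction_at v (l : R) :
  (forall x w, complex.Re (hprod (pulled_at f x) w w) <= l * complex.Re (hprod (metric_at x) w w)) ->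
  complex.Re (hprod (pulled_at f x0) v v) = l * complex.Re (hprod (metric_at x0) v v) ->
  l * hol_sec x0 v <= hol_sec (f x0) (v *m jac f x0).
Proof.
move=> hle heq; have oO : open (fdom f i j) by exact: open_fdom.
have oU : open (chart_image (charts j)) by exact: image_open.
have := @core_direction R m n (fdom f i j) (chart_image (charts j)) (local_rep f i j)
  (metric i) (@metric _ _ N j) oO oU (hf.2 i j)
  (@local_rep_image _ _ _ _ _ f i j) (@smooth_metric_fdom i j) (@metric_herm_fdom i j)
  (@metric_posdef_fdom i j) (@metric_smooth _ _ N j) (fun z a b Uz => @metric_herm _ _ N j z Uz a b)
  (@metric_posdef _ _ N j) z0 v l fdom_base.
rewrite -/(pulled f i j) pulled_base => /(_ _ heq).
have -> : local_rep f i j z0 = base_coord (f x0) by rewrite local_repE //; exact: chart_at_dom.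
apply; have nO : \forall w \near z0, fdom f i j w.
  by apply: open_nbhs_nbhs; split; [exact: oO|exact: fdom_base].
apply: filterS nO => w /pencil_fdom [x _ [T uT [-> ->]]].
by apply: le_congr => u; exact: hle.
Qed.

Lemma core_trace_at v (E : 'M[C]_m) (d : 'I_m -> R) :
  (forall x, hs_normsq f x <= hs_normsq f x0) ->
  E *m metric_at x0 *m adj E = 1%:M -> E *m pulled_at f x0 *m adj E = diag_mx (\row_a ofR (d a)) ->
  \sum_a d a * complex.Re (curv x0 (row a E) (row a E) v v) <=
  \sum_a complex.Re (curv (f x0) (row a E *m jac f x0) (row a E *m jac f x0)
      (v *m jac f x0) (v *m jac f x0)).
Proof.
move=> hle dG dA; have oO : open (fdom f i j) by exact: open_fdom.
have oU : open (chart_image (charts j)) by exact: image_open.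
have := @core_trace R m n (fdom f i j) (chart_image (charts j)) (local_rep f i j)
  (metric i) (@metric _ _ N j) oO oU (hf.2 i j)
  (@local_rep_image _ _ _ _ _ f i j) (@smooth_metric_fdom i j) (@metric_herm_fdom i j)
  (@metric_posdef_fdom i j) (@metric_smooth _ _ N j) (fun z a b Uz => @metric_herm _ _ N j z Uz a b)
  (@metric_posdef _ _ N j) z0 v E d fdom_base.
rewrite -/(pulled f i j) pulled_base => /(_ _ dG dA).
have -> : local_rep f i j z0 = base_coord (f x0) by rewrite local_repE //; exact: chart_at_dom.
apply; have nO : \forall w \near z0, fdom f i j w.
  by apply: open_nbhs_nbhs; split; [exact: oO|exact: fdom_base].
apply: filterS nO => w /pencil_fdom [x _ [T uT [-> ->]]].
have uG : metric_at x \in unitmx := posdef_unit (metric_at_posdef x).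
rewrite (mxtrace_congr (pulled_at f x) uT uG).
have := hle x; rewrite !hs_normsqE; exact: id.
Qed.

Lemma cont_metric : cont_mx z0 (metric i).
Proof. by move=> a b; exact: smooth_cont (@smooth_metric_fdom i j a b) fdom_base. Qed.

Lemma cont_pulled : cont_mx z0 (pulled f i j).
Proof.
have oO : open (fdom f i j) by exact: open_fdom.
have cJ : cont_mx z0 (fun z => 'J (local_rep f i j) z).
  by move=> a k; exact: smooth_cont (smooth_jacobian oO (hf.2 i j) a k) fdom_base.
have cH : cont_mx z0 (fun z => metric j (local_rep f i j z)).
  move=> a b; have cF : {for z0, continuous (local_rep f i j)}.
    exact: differentiable_continuous ((hf.2 i j).2 _ fdom_base).
  have := smooth_cont (@metric_smooth _ _ N j a b) (local_rep_image fdom_base).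
  by move=> ch; exact: (continuous_comp cF ch).
exact (cont_mulmx (cont_mulmx cJ cH) (cont_adj cJ)).
Qed.

End AtPoint.

Lemma half_gap (a b c : R) : a - b <= (c - b) / 2 -> b < c -> a < c.
Proof. lra. Qed.

(** Read in the fixed chart of x, the trace is a continuous function of the coordinates, and by
    congruence invariance it equals [hs_normsq] at every nearby point. *)
Lemma hs_normsq_usc x c : hs_normsq f x < c -> \forall y \near x, hs_normsq f y < c.
Proof.
move=> hc; pose u z := complex.Re (\tr (invmx (metric (chart_at x) z) *m pulled f (chart_at x) (chart_at (f x)) z)).
have uE y : dom (charts (chart_at x)) y -> dom (charts (chart_at (f x))) (f y) ->
    u (Defs.coord (charts (chart_at x)) y) = hs_normsq f y.
  move=> iy jy; have [T uT [E1 E2]] := pencil_change hf iy jy.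
  have uG : metric_at y \in unitmx := posdef_unit (metric_at_posdef y).
  by rewrite /u E1 E2 (mxtrace_congr (pulled_at f y) uT uG) hs_normsqE.
have ux : u (base_coord x) = hs_normsq f x := uE x (chart_at_dom x) (chart_at_dom (f x)).
have cu : {for base_coord x, continuous u}.
  apply: cont_Re; have cI : cont_mx (base_coord x) (fun z => invmx (metric (chart_at x) z)).
    apply: cont_invmx; first exact: cont_metric.
    have : \forall w \near base_coord x, fdom f (chart_at x) (chart_at (f x)) w.
      by apply: open_nbhs_nbhs; split; [exact: open_fdom|exact: fdom_base].
    by apply: filterS => w /metric_posdef_fdom /posdef_unit.
  have cP := cont_mulmx cI (@cont_pulled x).
  exact (@cont_sum _ _ _ _ (index_enum 'I_m) _ (fun a => cP a a)).
have e0 : 0 < (c - hs_normsq f x) / 2 by rewrite divr_gt0 // subr_gt0.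
apply: filterS (near_chart (cont_nbhs cu e0)) => y [iy jy].
rewrite (uE y iy jy) ux.
by rewrite ler_norml => /andP[_ h]; exact: half_gap h hc.
Qed.

Lemma Re_hprod_pencil (G A : 'M[C]_m) (c : R) v :
  complex.Re (hprod (ofR c *: G - A) v v) =
  c * complex.Re (hprod G v v) - complex.Re (hprod A v v).
Proof.
rewrite -Re_ofRM -ReN -ReD; congr complex.Re; rewrite /hprod mulr_sumr -sumrN -big_split.
apply: eq_bigr => a _; rewrite mulr_sumr -sumrN -big_split; apply: eq_bigr => b _ /=.
by rewrite !mxE !mulrDl !mulNr !mulrA.
Qed.

Lemma pencil_gt0 (a b c s : R) : a <= s * b -> 0 < b -> s < c -> 0 < c * b - a.
Proof. by move=> h b0 sc; rewrite subr_gt0; apply: (le_lt_trans h); rewrite ltr_pM2r. Qed.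

Lemma pencil_lt (a b c s : R) : 0 < c * b - a -> a = s * b -> 0 < b -> s < c.
Proof. by move=> + ae b0; rewrite subr_gt0 ae ltr_pM2r. Qed.

Lemma pencil_entry (G A : 'M[C]_m) (c : R) a b :
  (ofR c *: G - A) a b = ofR c * G a b + -1 * A a b.
Proof. by rewrite !mxE mulN1r. Qed.

Lemma pencil_herm (G A : 'M[C]_m) (c : R) :
  herm_mx G -> herm_mx A -> herm_mx (ofR c *: G - A).
Proof.
move=> hG hA a b; rewrite !pencil_entry hG hA rmorphD !rmorphM rmorphN rmorph1 /=.
by rewrite conj_ofR.
Qed.

(** The value lies below c exactly when c G - A is positive definite, an open condition by
    [posdef_open]. At a nearby point, testing it on a vector that attains the supremum there returns
    the strict inequality. *)
Lemma max_normsq_usc x c : (exists v : 'rV[C]_m, v != 0) ->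
  max_normsq f x < c -> \forall y \near x, max_normsq f y < c.
Proof.
move=> v0 hc; pose i := chart_at x; pose j := chart_at (f x).
pose B z := ofR c *: metric i z - pulled f i j z.
have sup_at y := sup_ratios (@metric_at_herm _ _ _ y) (@metric_at_posdef _ _ _ y) (pulled_at_herm f y) v0.
have cB : cont_mx (base_coord x) B.
  move=> a b; refine (cont_ext _ (@cont_lin _ _ (ofR c) (-1) _ _ (base_coord x)
    (@cont_metric x a b) (@cont_pulled x a b))).
  by move=> z; rewrite -pencil_entry.
have Bx : B (base_coord x) = ofR c *: metric_at x - pulled_at f x by rewrite /B pulled_base.
have hB : herm_mx (B (base_coord x)).
  by rewrite Bx; apply: pencil_herm; [exact: metric_at_herm|exact: pulled_at_herm].
have pB : posdef (B (base_coord x)).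
  move=> v vn; rewrite Bx Re_hprod_pencil; have h1 := (sup_at x).1 v.
  rewrite -max_normsqE in h1.
  exact: pencil_gt0 h1 (metric_at_posdef x vn) hc.
apply: filterS (near_chart (posdef_open cB hB pB)) => y [iy jy pBy].
have [T uT [E1 E2]] := pencil_change hf iy jy.
have [v vn hv] := (sup_at y).2; rewrite -max_normsqE in hv.
have un : v *m invmx T != 0.
  by apply: contra vn => /eqP h; rewrite -(mulmxKV uT v) h mul0mx.
have key (X : 'M[C]_m) : hprod (T *m X *m adj T) (v *m invmx T) (v *m invmx T) = hprod X v v.
  by rewrite -hprod_congr mulmxKV.
have P := pBy _ un; rewrite /B Re_hprod_pencil E1 E2 !key in P.
exact: pencil_lt P hv (metric_at_posdef y vn).
Qed.

Lemma jac_neq0_pos x : jac f x != 0 -> exists v, 0 < complex.Re (hprod (pulled_at f x) v v).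
Proof.
move=> J0; have [a ra] : exists a, row a (jac f x) != 0.
  apply/existsP; apply: contraNT J0 => /existsPn h; apply/eqP/row_matrixP => a.
  by rewrite row0; apply/eqP; have := h a; rewrite negbK.
by exists (delta_mx 0 a); rewrite -hprod_congr -rowE; apply: metric_at_posdef.
Qed.

(** The hypothesis speaks of preferred charts; invertibility of the transition Jacobians of the
    target carries it to one fixed pair of charts. There the mean value theorem along segments
    applies to the real and imaginary parts of each coordinate. *)
Lemma jac0_locally_constant : (forall x, jac f x = 0) -> forall x, \forall y \near x, f y = f x.
Proof.
move=> J0 x; pose i := chart_at x; pose j := chart_at (f x); pose F := local_rep f i j.
have oO : open (fdom f i j) by exact: open_fdom.
have JF z : fdom f i j z -> 'J F z = 0.
  move=> [y [iy jy] <-]; have := jacobian_transition hf iy jy.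
  rewrite J0 mulmx0 => /esym E.
  by rewrite -(mulmxK (transition_unit jy (chart_at_dom (f y))) ('J _ _)) E mul0mx.
have nO : \forall w \near base_coord x, fdom f i j w.
  by apply: open_nbhs_nbhs; split; [exact: oO|exact: fdom_base].
have [d d0 hd] := nbhs_segment nO.
have cst k v : sz v < d -> F (base_coord x + v) 0 k = F (base_coord x) 0 k.
  move=> /hd hv.
  have D t (tI : 0 <= t <= 1) : isD (fun w => F w 0 k) v (base_coord x + ofR t *: v) 0.
    have := isD_holomorphic (hf.2 i j) v k (hv t tI).
    by rewrite JF ?mulmx0 ?mxE //; exact: hv.
  have [t tI Er] := hasD_mvt (F := fun w => complex.Re (F w 0 k)) (G := fun=> 0) ltr01 (fun t tI => (D t tI).1).
  have [s sI Ei] := hasD_mvt (F := fun w => complex.Im (F w 0 k)) (G := fun=> 0) ltr01 (fun t tI => (D t tI).2).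
  rewrite ofR1 scale1r mulr0 in Er Ei.
  have er := subr0_eq Er; have ei := subr0_eq Ei.
  by apply/eqP; rewrite eq_complex er ei !eqxx.
have nF : \forall w \near base_coord x, F w = F (base_coord x).
  apply/nbhs_sz; exists d => // v vd; apply/rowP => k; exact: cst.
apply: filterS (near_chart nF) => y [iy jy].
rewrite /F !local_repE // => [E|]; last exact: chart_at_dom.
by rewrite -(coordK jy) E coordK //; exact: chart_at_dom.
Qed.

Lemma nonconstant_jac : connected [set: M] -> nonconstant f -> exists x, jac f x != 0.
Proof.
move=> cM [x [y fxy]]; apply: contrapT => H; apply: fxy.
apply: (locally_constant_connected cM); apply: jac0_locally_constant => z.
by apply/eqP; apply: contrapT => /negP h; apply: H; exists z.
Qed.

End MaximumPrinciple.

(** * Curvature bounds at a maximum point *)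

Section Bounds.
Context (R : realType) (m n : nat) (M : kahlerManifold R m) (N : kahlerManifold R n).
Local Notation C := (Cplx R).

Lemma curv13 p (P : kahlerManifold R p) (x : P) X Y Z W : curv x X Y Z W = curv x Z Y X W.
Proof.
have iz : chart_image (charts (chart_at x)) (base_coord x).
  by exists x => //; exact: chart_at_dom.
have oU : open (chart_image (charts (chart_at x))) by exact: image_open.
exact: (curv_form13 oU (@metric_smooth _ _ P (chart_at x)) (@metric_closed _ _ P (chart_at x)) X Y Z W iz).
Qed.

Lemma curv24 p (P : kahlerManifold R p) (x : P) X Y Z W : curv x X Y Z W = curv x X W Z Y.
Proof.
have iz : chart_image (charts (chart_at x)) (base_coord x).
  by exists x => //; exact: chart_at_dom.
have oU : open (chart_image (charts (chart_at x))) by exact: image_open.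
exact: (curv_form24 oU (@metric_smooth _ _ P (chart_at x))
  (fun z a b Uz => @metric_herm _ _ P (chart_at x) z Uz a b)
  (@metric_closed _ _ P (chart_at x)) X Y Z W iz).
Qed.

Context (f : M -> N).
Hypothesis hf : holomorphic_map f.

(** In the application N0 = |v|^2, and l N0 is the square norm of the image of v. The chain K l N0^2
    <= l h <= h' <= kappa l^2 N0^2 is divided by l N0^2. *)
Lemma bound_of_direction (K kappa l N0 h h' : R) : 0 < kappa -> 0 < l -> 0 < N0 ->
  K * N0 ^+ 2 <= h -> l * h <= h' -> h' <= kappa * (l * N0) ^+ 2 -> K / kappa <= l.
Proof.
move=> k0 l0 N00 h1 h2 h3; rewrite ler_pdivrMr //.
have N2 : 0 < l * N0 ^+ 2 by rewrite mulr_gt0 // exprn_gt0.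
rewrite -(ler_pM2r N2); have := ler_wpM2l (ltW l0) h1.
have -> : l * kappa * (l * N0 ^+ 2) = kappa * (l * N0) ^+ 2 by ring.
have -> : l * (K * N0 ^+ 2) = K * (l * N0 ^+ 2) by ring.
by move=> h4; exact: le_trans h4 (le_trans h2 h3).
Qed.

Lemma max_normsq_ge (K kappa : R) x0 : 0 < kappa -> hol_sec_ge M K -> hol_sec_le N kappa ->
  (exists v : 'rV[C]_m, v != 0) ->
  (forall x, max_normsq f x <= max_normsq f x0) -> 0 < max_normsq f x0 ->
  K / kappa <= max_normsq f x0.
Proof.
move=> k0 hM hN v0 mx l0.
have sup_at y := sup_ratios (@metric_at_herm _ _ _ y) (@metric_at_posdef _ _ _ y) (pulled_at_herm f y) v0.
have hle x w : complex.Re (hprod (pulled_at f x) w w) <=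
    max_normsq f x0 * complex.Re (hprod (metric_at x) w w).
  have h1 := (sup_at x).1 w; rewrite -max_normsqE in h1.
  apply: (le_trans h1); apply: ler_wpM2r (mx x).
  exact: (posdef_semi (metric_at_posdef x) w).
have [v vn hv] := (sup_at x0).2; rewrite -max_normsqE in hv.
have h := core_direction_at hf hle hv.
have hW := hN (f x0) (v *m jac f x0); rewrite normsq_jac hv in hW.
exact: (bound_of_direction k0 l0 (metric_at_posdef x0 vn) (hM x0 v) h hW).
Qed.

Lemma hs_normsq_ge (K1 kappa : R) x0 : 0 < kappa -> ricci_ge M K1 -> hol_sec_le N kappa ->
  (forall x, hs_normsq f x <= hs_normsq f x0) -> 0 < hs_normsq f x0 ->
  K1 / kappa <= hs_normsq f x0.
Proof.
move=> k0 hM hN mx u0.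
have [E [d [dG dA]]] := simultaneous_diag (@metric_at_herm _ _ _ x0) (@metric_at_posdef _ _ _ x0)
  (pulled_at_herm f x0).
have uE : hs_normsq f x0 = \sum_a d a.
  by rewrite hs_normsqE (diag_trace dG dA) raddf_sum; apply: eq_bigr.
have nW a : nsq (metric_at (f x0)) (row a E *m jac f x0) = d a.
  by rewrite /nsq hprod_congr (diag_hprod_basisA dA) eqxx mul1r.
have d0 a : 0 <= d a.
  by rewrite -nW; apply: posdef_semi; exact: metric_at_posdef.
(* Royden's bound applies because E diagonalises the pulled back metric: the image vectors are
   orthogonal in the target, with square norms [d a]. *)
have rhs : \sum_a \sum_c bisec (@curv _ _ N (f x0)) (row a E *m jac f x0) (row c E *m jac f x0)
    <= kappa * (\sum_a d a) ^+ 2.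
  rewrite -(eq_bigr _ (fun a _ => nW a)).
  apply: royden; last first.
  - move=> a b ab; rewrite hprod_congr (diag_hprod_basisA dA) (negPf ab) mul0r; by [].
  - move=> X; exact: hN.
  - exact: ltW.
  - exact: curv24.
  - exact: curv13.
  - move=> *; exact: curv_formZ2.
  - move=> *; exact: curv_formD2.
  - move=> *; exact: curv_formZ1.
  - move=> *; exact: curv_formD1.
  - by apply: posdef_semi; exact: metric_at_posdef.
  - exact: metric_at_herm.
(* For fixed a, the symmetries turn the sum over c into the Ricci curvature of the unit vector
   [row a E]; the weights [d a] are nonnegative. *)
have lhs : K1 * (\sum_a d a) <= \sum_c \sum_a d a * complex.Re (curv x0 (row a E) (row a E) (row c E) (row c E)).
  rewrite exchange_big mulr_sumr; apply: ler_sum => a _.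
  rewrite -mulr_sumr mulrC ler_wpM2l //.
  have uB : unitary_basis x0 (fun a => row a E) by move=> b c; exact: diag_hprod_basis dG b c.
  have := hM x0 _ uB (row a E).
  have -> : normsq x0 (row a E) = 1.
    by rewrite /normsq (diag_hprod_basis dG) eqxx.
  rewrite mulr1 /ricci raddf_sum => /le_trans; apply; apply: ler_sum => c _.
  by rewrite curv13 curv24.
(* The second-order inequality holds in every direction v; here it is summed over v = [row c E]. *)
have mid : \sum_c \sum_a d a * complex.Re (curv x0 (row a E) (row a E) (row c E) (row c E)) <=
   \sum_a \sum_c bisec (@curv _ _ N (f x0)) (row a E *m jac f x0) (row c E *m jac f x0).
  rewrite [leRHS]exchange_big; apply: ler_sum => c _.
  exact: (core_trace_at hf (row c E) mx dG dA).
(* With u the sum of the [d a], the three estimates combine to K1 u <= kappa u^2, and u is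
   positive. *)
rewrite uE in u0 *; rewrite ler_pdivrMr // -(ler_pM2r u0).
apply: (le_trans lhs (le_trans mid (le_trans rhs _))).
by rewrite mulrAC -expr2 mulrC.
Qed.

Lemma jac_neq0_max x : jac f x != 0 -> 0 < max_normsq f x /\ exists v : 'rV[C]_m, v != 0.
Proof.
move=> /jac_neq0_pos [v v0].
have vn : v != 0 by apply: contraTneq v0 => ->; rewrite hprod0l ltxx.
split; last by exists v.
have [h _] := sup_ratios (@metric_at_herm _ _ _ x) (@metric_at_posdef _ _ _ x) (pulled_at_herm f x) (ex_intro _ v vn).
have {}h := h v; rewrite -max_normsqE in h.
by have := lt_le_trans v0 h; rewrite pmulr_lgt0 // metric_at_posdef.
Qed.

Lemma jac_neq0_hs x : jac f x != 0 -> 0 < hs_normsq f x.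
Proof.
move=> /jac_neq0_pos hv; rewrite hs_normsqE; apply: mxtrace_gt0 hv.
- exact: metric_at_herm.
- exact: metric_at_posdef.
- exact: pulled_at_herm.
- exact: pulled_at_psd.
Qed.

End Bounds.

Theorem corollary5p2 (R : realType) (m n : nat)
    (M : kahlerManifold R m) (N : kahlerManifold R n)
    (M_compact : compact [set: M]) (M_connected : connected [set: M]) :
  (forall K kappa : R, 0 < K -> 0 < kappa ->
     hol_sec_ge M K -> hol_sec_le N kappa ->
     forall f : M -> N, holomorphic_map f -> nonconstant f ->
     max_ge (max_normsq f) (K / kappa)) /\
  (forall K1 kappa : R, 0 < K1 -> 0 < kappa ->
     ricci_ge M K1 -> hol_sec_le N kappa ->
     forall f : M -> N, holomorphic_map f -> nonconstant f ->
     max_ge (hs_normsq f) (K1 / kappa)).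
Proof.
split=> [K kappa _ k0 hM hN f hf nf|K1 kappa _ k0 hM hN f hf nf].
  have [x jx] := nonconstant_jac hf M_connected nf.
  have [mx v0] := jac_neq0_max jx.
  have [x0 max0] := usc_max M_compact x (fun y c => max_normsq_usc hf v0).
  exists x0; split=> //.
  have l0 := lt_le_trans mx (max0 x).
  exact: (max_normsq_ge hf k0 hM hN v0 max0 l0).
have [x jx] := nonconstant_jac hf M_connected nf.
have [x0 max0] := usc_max M_compact x (fun y c => @hs_normsq_usc _ _ _ _ _ _ hf y c).
exists x0; split=> //.
have l0 := lt_le_trans (jac_neq0_hs jx) (max0 x).
exact: (hs_normsq_ge hf k0 hM hN max0 l0).
Qed.
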